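(* Assume that there exists a positive function $h\in C^{(s)}_{\mathrm{loc}}$ such that for all $M>0$, $\sup_{x\in(0,M)}\int_{(0,x)}\frac{h(y)}{h(x)}\,k(x,\mathrm dy)<+\infty$, and such that $x\mapsto \frac{\mathcal A h(x)}{h(x)}$ is bounded from above on $(0,+\infty)$ and locally bounded. Fix such an $h$ and let $B=\{f\colon(0,\infty)\to\mathbb R : f \text{ is Borel and } f/h \text{ is bounded}\}$. Then there exists a unique semigroup $(T_t)_{t\ge 0}$ on $B$ such that, for all $f\in C_c^{(s)}\cup\{h\}$, all $t\ge 0$ and all $x\in(0,+\infty)$, $$\int_0^t T_u|\mathcal A f|(x)\,\mathrm du<\infty\quad\text{and}\quad T_tf(x)=f(x)+\int_0^t T_u\mathcal A f(x)\,\mathrm du .$$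
   Context: Standing setting. $k$ is a positive kernel from $(0,+\infty)$ to itself (for each $x$, $k(x,\cdot)$ is a non-negative measure, depending measurably on $x$) with $k(x,[x,+\infty))=0$ for all $x$; $s\colon(0,+\infty)\to\mathbb R$ is strictly increasing and continuous with $s(1)=0$ and $\lim_{x\to+\infty}s(x)=+\infty$; $K\colon(0,+\infty)\to\mathbb R$ is measurable and locally bounded. ''Locally bounded'' means bounded on compact subsets of $(0,+\infty)$. The derivative with respect to $s$ is $\frac{\partial f}{\partial s}(x)=\lim_{\delta\to0,\,\delta>0}\frac{f(x+\delta)-f(x)}{s(x+\delta)-s(x)}$. $C^{(s)}$ is the set of continuous functions $f\colon(0,+\infty)\to\mathbb R$ for which $\partial f/\partial s$ is well-defined at every point of $(0,+\infty)$; $C_c^{(s)}$ is the set of $f\in C^{(s)}$ with compact support in $(0,+\infty)$ and $\partial f/\partial s$ bounded; $C^{(s)}_{\mathrm{loc}}$ is the set of $f\in C^{(s)}$ with $\partial f/\partial s$ locally bounded. The operator $\mathcal A$ is $$\mathcal A f(x)=\frac{\partial f}{\partial s}(x)+\int_{(0,x)}f(y)\,k(x,\mathrm dy)-K(x)f(x).$$ A semigroup $T=(T_t)_{t\ge0}$ on a measurable space $E$ is a family of (non-negative) kernels $T_t$ from $E$ to $E$ with $T_{t+u}(x,A)=\int_E T_t(x,\mathrm dy)T_u(y,A)$ and $T_0(x,\cdot)=\delta_x$; $T_tf(x)=\int_E T_t(x,\mathrm dy)f(y)$. It is called a semigroup on a function space $B$ if $T_t(B)\subset B$ for all $t$. No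 strong continuity is required. Here $E=(0,+\infty)$. *)

(* Defs.v *)
(* MathComp-Analysis *)
From HB Require Import structures.
From mathcomp Require Import all_boot all_order all_algebra.
From mathcomp Require Import all_classical all_reals all_analysis.
From mathcomp Require Import measurable_realfun.

Set Implicit Arguments.
Unset Strict Implicit.
Unset Printing Implicit Defensive.

Import Order.TTheory GRing.Theory Num.Theory.
Import numFieldNormedType.Exports.

Local Open Scope classical_set_scope.
Local Open Scope ring_scope.

(* The half-line (0, +oo), with the subspace topology and the trace of the
   Borel sigma-algebra (which is its own Borel sigma-algebra). *)
Definition posreal (R : realType) : Type := {x : R | 0 < x}.

HB.instance Definition _ (R : realType) := SubChoice.on (posreal R).

HB.instance Definition _ (R : realType) :=
  isPointed.Build (posreal R) (exist _ 1 (@ltr01 R)).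

HB.instance Definition _ (R : realType) :=
  Topological.copy (posreal R)
    (initial_topology (val : posreal R -> R)).

HB.instance Definition _ (R : realType) :=
  Measurable.copy (posreal R)
    (g_sigma_algebra_preimageType (val : posreal R -> R)).

(* Left inverse of [val]; the value 1 at [r <= 0] is junk. *)
Definition to_posreal (R : realType) (r : R) : posreal R :=
  insubd (exist _ 1 (@ltr01 R) : posreal R) r.

Definition locally_bounded (R : realType) (f : posreal R -> R) : Prop :=
  forall C : set (posreal R), compact C -> [bounded f x | x in C].

Section derivative.
Context {R : realType}.
Implicit Types (s f : posreal R -> R) (x : posreal R).

Definition diffquot s f x (d : R) : R :=
  (f (to_posreal (val x + d)) - f x) / (s (to_posreal (val x + d)) - s x).

Definition sderivable s f x : Prop := cvg (diffquot s f x d @[d --> 0^'+]).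

Definition sderive s f x : R := lim (diffquot s f x d @[d --> 0^'+]).

Definition Cs s : set (posreal R -> R) :=
  [set f | continuous f /\ forall x, sderivable s f x].

Definition Cs_c s : set (posreal R -> R) :=
  [set f | [/\ Cs s f, compact (closure [set x | f x != 0]) &
               bounded_fun (sderive s f)]].

Definition Cs_loc s : set (posreal R -> R) :=
  [set f | Cs s f /\ locally_bounded (sderive s f)].

End derivative.

(* The integral is the real-valued one; it is meaningful as soon as [f] is
   integrable on (0, x) for [k x]. *)
Definition opA (R : realType) (k : R.-ker (posreal R) ~> (posreal R))
    (s K f : posreal R -> R) (x : posreal R) : R :=
  sderive s f x
  + (\int[k x]_(y in [set y | val y < val x]) f y)
  - K x * f x.

Section semigroup.
Context {R : realType}.
(* Only the restriction of [T] to the times [0 <= t] is meaningful. *)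
Implicit Types (T : R -> R.-ker (posreal R) ~> (posreal R)).

Definition act T (t : R) (f : posreal R -> R) (x : posreal R) : \bar R :=
  (\int[T t x]_y (f y)%:E)%E.

Definition semigroup T : Prop :=
  (forall x A, measurable A -> T 0 x A = \d_x A) /\
  (forall t u : R, 0 <= t -> 0 <= u -> forall x A, measurable A ->
     T (t + u) x A = (\int[T t x]_y T u y A)%E).

(* [T_t B] is contained in [B]: for [f] in [B], [T_t f] is everywhere a
   well-defined finite integral and the resulting function is in [B]. *)
Definition semigroup_on T (B : set (posreal R -> R)) : Prop :=
  semigroup T /\
  forall t, 0 <= t -> forall f, B f ->
    (forall x, (T t x).-integrable setT (EFin \o f)) /\
    B (fun x => fine (act T t f x)).

End semigroup.

Definition weighted_bounded (R : realType) (h : posreal R -> R) :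
    set (posreal R -> R) :=
  [set f : posreal R -> R |
    measurable_fun setT f /\ bounded_fun (fun x => f x / h x)].

(* The two measurability clauses say that the time integrals are meaningful:
   the library integral is defined for every function. *)
Definition forward_equation (R : realType)
    (k : R.-ker (posreal R) ~> (posreal R)) (s K : posreal R -> R)
    (T : R -> R.-ker (posreal R) ~> (posreal R)) (f : posreal R -> R)
    (t : R) (x : posreal R) : Prop :=
  let Af := opA k s K f in
  let absAf y : R := `|Af y| in
  [/\ measurable_fun `[0, t] (fun u : R => act T u absAf x),
      measurable_fun `[0, t] (fun u : R => act T u Af x),
      (\int[lebesgue_measure]_(u in `[0%R, t]) act T u absAf x < +oo)%E &
      act T t f x =
        ((f x)%:E + \int[lebesgue_measure]_(u in `[0%R, t]) act T u Af x)%E].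

(* Main.v *)
(* Put kappa(x, dy) = h(y)/h(x) k(x, dy), r(x) = kappa(x, E), c = Ah/h <= b and
   lam = r - c.  Writing f = h g turns A into L g = dg/ds - lam g + kappa g, the
   function h into 1, B into the bounded functions, and L 1 = c.  Let phi be the
   flow with s (phi_t x) = s x + t; d/ds is the right derivative along phi.

   Existence: the semigroup is the increasing limit of P_0 = 0,
   P_{n+1} = S + Q P_n, where S follows phi, weighted by exp (- int lam), and Q
   makes a first jump drawn from kappa.  Each P_n maps 1 below exp (b t), and the
   forward equation holds along the flow, hence for P_n and in the limit.

   Uniqueness: fix x and let (mu_t) solve the forward equation for test functions.
   Let U f be the Laplace transform of mu_t f at some alpha > b.  For
   F = 1_[B, C) o s the function VF(y) = int_0^oo F (phi_t y) dt is piecewise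
   linear in s with right derivative exactly - F, so that chi VF is a test
   function for a cutoff chi vanishing near 0.  The identity obtained is between
   measures in F, hence holds for every Borel F >= 0.  Subtracting the instances
   F = f and F = (alpha + lam) V_lam f, where V_lam is the resolvent of S, yields
   U f >= V_lam f(x) + U (kappa (V_lam f)), so U dominates the resolvent of the
   constructed semigroup.  Both satisfy the mass balance
   (alpha - b) U 1 + U (b - c) = 1, so they are equal.  Inverting the Laplace
   transform gives int_0^t mu_u f du, and the forward equation then gives mu_t. *)

From HB Require Import structures.
Require Import Defs.
From mathcomp Require Import all_boot all_order all_algebra.
From mathcomp Require Import all_classical all_reals all_analysis.
From mathcomp Require Import measurable_realfun.
From mathcomp Require Import finmap ring lra.
Import Order.TTheory GRing.Theory Num.Theory.
Import numFieldNormedType.Exports.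
Local Open Scope classical_set_scope.
Local Open Scope ring_scope.

Set Implicit Arguments.
Unset Strict Implicit.
Unset Printing Implicit Defensive.

(** All integrals here live in [[0, +oo]], where nothing can be cancelled before it is known to be
    finite. Hence identities are stated with nonnegative terms on both sides, [D - lam * g] being
    split as [p - n], and measures and kernels enter through the functionals they induce. The rate
    [lam] is only locally bounded and may blow up near 0, where the jumps lead. In the existence
    part its integrability along the paths is deduced from the forward identity for the constant 1.
    In the uniqueness part it forces test functions that vanish near 0, and the derivative of the
    cutoff contributes a term of which only the sign is known. Discarding this term costs the
    equality: compactly supported functions alone yield no more than the domination of the minimal
    resolvent by [U]. The function [h], which becomes the constant 1, rules out a surplus: its
    equation fixes the combination [(al - b) U 1 + U (b - c)] of two nonnegative terms, each of
    which can only grow with [U]. *)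

Definition nnm d (T : measurableType d) (R : realType) (f : T -> \bar R) :=
  measurable_fun setT f /\ forall x, (0 <= f x)%E.

(* Functionals of the form [f |-> \int f dm], see [sf_riesz]; constructions of
   measures and kernels are done on functionals of nonnegative functions. *)
Record sfunctional d (T : measurableType d) (R : realType)
    (I : (T -> \bar R) -> \bar R) : Prop := SFunctional {
  sf_ge0 : forall f, nnm f -> (0 <= I f)%E;
  sf_le : forall f g, nnm f -> nnm g -> (forall x, f x <= g x)%E -> (I f <= I g)%E;
  sf_add : forall f g, nnm f -> nnm g -> I (fun x => f x + g x)%E = (I f + I g)%E;
  sf_scale : forall (c : R) f, 0 <= c -> nnm f ->
    I (fun x => c%:E * f x)%E = (c%:E * I f)%E;
  sf_lim : forall F : (T -> \bar R)^nat, (forall n, nnm (F n)) ->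
    (forall x, nondecreasing_seq (F^~ x)) ->
    I (fun x => limn (F^~ x)) = limn (fun n => I (F n)) }.

(** * Positive functionals and measures *)

Section nnm.
Local Open Scope ereal_scope.
Context d (T : measurableType d) (R : realType).
Implicit Types f g : T -> \bar R.

Lemma nnm_cst (c : \bar R) : 0 <= c -> nnm (fun _ : T => c).
Proof. by move=> c0; split => //; exact: measurable_cst. Qed.

Lemma nnmD f g : nnm f -> nnm g -> nnm (fun x => f x + g x).
Proof.
move=> [mf f0] [mg g0]; split; first exact: emeasurable_funD.
by move=> x; exact: adde_ge0.
Qed.

Lemma nnmM f g : nnm f -> nnm g -> nnm (fun x => f x * g x).
Proof.
move=> [mf f0] [mg g0]; split; first exact: emeasurable_funM.
by move=> x; exact: mule_ge0.
Qed.

Lemma nnm_EFin (f : T -> R) : measurable_fun setT f -> (forall x, (0 <= f x)%R) ->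
  nnm (fun x => (f x)%:E).
Proof. by move=> mf f0; split => //; exact/measurable_EFinP. Qed.

Lemma nnm_indic (A : set T) : measurable A -> nnm (fun x => (\1_A x)%:E : \bar R).
Proof.
by move=> mA; apply: nnm_EFin => //; exact: measurable_indic.
Qed.

Lemma nnm_lim (F : (T -> \bar R)^nat) : (forall n, nnm (F n)) ->
  (forall x, nondecreasing_seq (F^~ x)) -> nnm (fun x => limn (F^~ x)).
Proof.
move=> F0 ndF; split.
  apply: (@emeasurable_fun_cvg _ _ _ _ F) => [n|x _]; first by have [] := F0 n.
  exact: ereal_nondecreasing_is_cvgn.
move=> x; apply: lime_ge; first exact: ereal_nondecreasing_is_cvgn.
by apply: nearW => n; have [] := F0 n.
Qed.

Lemma nnm_sum (I : Type) (s : seq I) (F : I -> T -> \bar R) :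
  (forall i, nnm (F i)) -> nnm (fun x => \sum_(i <- s) F i x).
Proof.
move=> F0; split.
  by apply: emeasurable_sum => i; have [] := F0 i.
by move=> x; apply: sume_ge0 => i _; have [] := F0 i.
Qed.

End nnm.

Lemma nnm_comp d1 d2 (T1 : measurableType d1) (T2 : measurableType d2)
  (R : realType) (f : T2 -> \bar R) (p : T1 -> T2) :
  nnm f -> measurable_fun setT p -> nnm (fun x => f (p x)).
Proof. by move=> [mf f0] mp; split => //; exact: measurableT_comp. Qed.

Lemma le_limn (R : realType) (u : (\bar R)^nat) n :
  nondecreasing_seq u -> (u n <= limn u)%E.
Proof.
move=> ndu; rewrite (cvg_lim _ (ereal_nondecreasing_cvgn ndu))//.
by apply: ereal_sup_ubound; exists n.
Qed.

Lemma limn_le (R : realType) (u : (\bar R)^nat) c :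
  nondecreasing_seq u -> (forall n, u n <= c)%E -> (limn u <= c)%E.
Proof.
move=> ndu uc; apply: lime_le; first exact: ereal_nondecreasing_is_cvgn.
exact: nearW.
Qed.

Lemma limn_swap (R : realType) (a : nat -> nat -> \bar R) :
  (forall n, nondecreasing_seq (a n)) -> (forall m, nondecreasing_seq (a^~ m)) ->
  limn (fun n => limn (a n)) = limn (fun m => limn (a^~ m)).
Proof.
move=> nd1 nd2.
have half (b : nat -> nat -> \bar R) : (forall n, nondecreasing_seq (b n)) ->
    (forall m, nondecreasing_seq (b^~ m)) ->
    (limn (fun n => limn (b n)) <= limn (fun m => limn (b^~ m)))%E.
  move=> h1 h2.
  have c1 n : cvgn (b n) by exact: ereal_nondecreasing_is_cvgn.
  have c2 m : cvgn (b^~ m) by exact: ereal_nondecreasing_is_cvgn.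
  have nn1 : nondecreasing_seq (fun n => limn (b n)).
    by move=> n n' nn'; apply: lee_lim => //; apply: nearW => m; exact: h2.
  have nn2 : nondecreasing_seq (fun m => limn (b^~ m)).
    by move=> n n' nn'; apply: lee_lim => //; apply: nearW => m; exact: h1.
  have c3 := ereal_nondecreasing_is_cvgn nn1.
  have c4 := ereal_nondecreasing_is_cvgn nn2.
  apply: lime_le => //; apply: nearW => n.
  apply: lime_le => //; apply: nearW => m.
  apply: (@le_trans _ _ (limn (b^~ m))).
    exact: (@le_limn _ (b^~ m)).
  exact: (@le_limn _ (fun m => limn (b^~ m))).
apply/eqP; rewrite eq_le; apply/andP; split; first exact: half.
exact: (half (fun n m => a m n)).
Qed.

Section sfunctional_theory.
Local Open Scope ereal_scope.
Context d (T : measurableType d) (R : realType).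
Implicit Types f g : T -> \bar R.

Lemma sf_ext (I : (T -> \bar R) -> \bar R) f g : f =1 g -> I f = I g.
Proof. by move=> fg; congr I; apply/funext. Qed.

Lemma sf0 (I : (T -> \bar R) -> \bar R) : sfunctional I -> I (fun=> 0) = 0.
Proof.
move=> sI; have := sf_scale sI (lexx 0%R) (@nnm_cst _ T R 0 (lexx _)).
by rewrite !mul0e.
Qed.

Lemma sf_sum (I : (T -> \bar R) -> \bar R) (J : Type) (s : seq J)
  (F : J -> T -> \bar R) : sfunctional I -> (forall i, nnm (F i)) ->
  I (fun x => \sum_(i <- s) F i x) = \sum_(i <- s) I (F i).
Proof.
move=> sI F0; elim: s => [|j s ih].
  by rewrite big_nil -[RHS](sf0 sI); apply: sf_ext => x; rewrite big_nil.
rewrite big_cons -ih -sf_add//; last exact: nnm_sum.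
by apply: sf_ext => x; rewrite big_cons.
Qed.

Lemma sf_integral (mu : {measure set T -> \bar R}) :
  sfunctional (fun f => \int[mu]_x f x).
Proof.
split.
- by move=> f [mf f0]; exact: integral_ge0.
- by move=> f g [mf f0] [mg g0] fg; apply: ge0_le_integral.
- by move=> f g [mf f0] [mg g0]; rewrite ge0_integralD.
- by move=> c f c0 [mf f0]; rewrite ge0_integralZl_EFin.
- move=> F F0 ndF; rewrite monotone_convergence// => n.
    by have [] := F0 n.
  by move=> x _; have [] := F0 n.
Qed.

Lemma sf_dirac (x : T) : sfunctional (fun f : T -> \bar R => f x).
Proof.
split => //.
- by move=> f [].
Qed.

Lemma sf_cscale (c : \bar R) (I : (T -> \bar R) -> \bar R) : 0 <= c ->
  sfunctional I -> sfunctional (fun f => c * I f).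
Proof.
move=> c0 sI; split.
- by move=> f f0; apply: mule_ge0 => //; exact: sf_ge0.
- by move=> f g f0 g0 fg; apply: lee_wpmul2l => //; exact: (sf_le sI).
- by move=> f g f0 g0; rewrite sf_add// ge0_muleDr//; exact: (sf_ge0 sI).
- by move=> r f r0 f0; rewrite sf_scale// muleCA.
- move=> F F0 ndF; rewrite sf_lim//.
  have nd : nondecreasing_seq (fun n => I (F n)).
    by move=> m n mn; apply: (sf_le sI) => // x; exact: ndF.
  have cv := ereal_nondecreasing_is_cvgn nd.
  have h0 n : 0 <= I (F n) by exact: (sf_ge0 sI).
  move: c0; case: c => [r r0||//].
    by rewrite limeMl.
  move=> _.
  have nd' : nondecreasing_seq (fun n => +oo * I (F n)).
    by move=> m n mn; apply: lee_wpmul2l => //; exact: nd.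
  have cv' := ereal_nondecreasing_is_cvgn nd'.
  (* For [c = +oo] both sides are 0 when every term vanishes, and [+oo] as soon as one term is
     positive. *)
  have [all0|] := pselect (forall n, I (F n) = 0).
    rewrite (_ : (fun n => I (F n)) = cst 0); last exact/funext.
    rewrite (_ : (fun n => +oo * _) = cst 0) ?lim_cst ?mule0//.
    by apply/funext => n; rewrite all0 mule0.
  move/existsNP => [n /eqP hn].
  have hn0 : 0 < I (F n) by rewrite lt_def hn h0.
  have : +oo * I (F n) <= limn (fun n => +oo * I (F n)).
    exact: (@le_limn _ (fun n => +oo * I (F n))).
  rewrite gt0_mulye// leye_eq => /eqP ->.
  rewrite gt0_mulye// (lt_le_trans hn0)//.
  exact: (@le_limn _ (fun n => I (F n))).
Qed.

Lemma sf_addf (I J : (T -> \bar R) -> \bar R) :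
  sfunctional I -> sfunctional J -> sfunctional (fun f => I f + J f).
Proof.
move=> sI sJ; split.
- by move=> f f0; apply: adde_ge0; [exact: (sf_ge0 sI)|exact: (sf_ge0 sJ)].
- by move=> f g f0 g0 fg; apply: leeD; [exact: (sf_le sI)|exact: (sf_le sJ)].
- by move=> f g f0 g0; rewrite (sf_add sI)// (sf_add sJ)// addeACA.
- move=> r f r0 f0; rewrite (sf_scale sI)// (sf_scale sJ)// ge0_muleDr//.
    exact: (sf_ge0 sI).
  exact: (sf_ge0 sJ).
- move=> F F0 ndF; rewrite (sf_lim sI)// (sf_lim sJ)// limeD//.
  + by apply: ereal_nondecreasing_is_cvgn => m n mn; apply: (sf_le sI) => // x; exact: ndF.
  + by apply: ereal_nondecreasing_is_cvgn => m n mn; apply: (sf_le sJ) => // x; exact: ndF.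
  + apply: ge0_adde_def; rewrite inE; apply: lime_ge.
    * by apply: ereal_nondecreasing_is_cvgn => m n mn; apply: (sf_le sI) => // x; exact: ndF.
    * by apply: nearW => n; exact: (sf_ge0 sI).
    * by apply: ereal_nondecreasing_is_cvgn => m n mn; apply: (sf_le sJ) => // x; exact: ndF.
    * by apply: nearW => n; exact: (sf_ge0 sJ).
Qed.

(** Monotone convergence for the limit functional is the exchange of two increasing limits. This
    makes [Poo] a functional, and thereby a kernel. *)
Lemma sf_limf (J : nat -> (T -> \bar R) -> \bar R) : (forall n, sfunctional (J n)) ->
  (forall f, nnm f -> nondecreasing_seq (J^~ f)) ->
  sfunctional (fun f => limn (J^~ f)).
Proof.
move=> sJ ndJ; split.
- move=> f f0; apply: lime_ge; first exact/ereal_nondecreasing_is_cvgn/ndJ.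
  by apply: nearW => n; exact: (sf_ge0 (sJ n)).
- move=> f g f0 g0 fg; apply: lee_lim; try exact/ereal_nondecreasing_is_cvgn/ndJ.
  by apply: nearW => n; exact: (sf_le (sJ n)).
- move=> f g f0 g0; rewrite -limeD; first last.
  + apply: ge0_adde_def; rewrite inE; apply: lime_ge;
      (try exact/ereal_nondecreasing_is_cvgn/ndJ);
      by apply: nearW => n; exact: (sf_ge0 (sJ n)).
  + exact/ereal_nondecreasing_is_cvgn/ndJ.
  + exact/ereal_nondecreasing_is_cvgn/ndJ.
  + by congr (limn _); apply/funext => n; rewrite /= (sf_add (sJ n)).
- move=> c f c0 f0; rewrite -limeMl//; last exact/ereal_nondecreasing_is_cvgn/ndJ.
  by congr (limn _); apply/funext => n; rewrite /= (sf_scale (sJ n)).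
- move=> F F0 ndF.
  rewrite -(@limn_swap _ (fun n m => J n (F m))).
  + by congr (limn _); apply/funext => n; rewrite /= (sf_lim (sJ n)).
  + by move=> n m m' mm'; apply: (sf_le (sJ n)) => // x; exact: ndF.
  + by move=> m; exact: ndJ.
Qed.

End sfunctional_theory.

Lemma sf_comp d1 d2 (T1 : measurableType d1) (T2 : measurableType d2)
  (R : realType) (I : (T1 -> \bar R) -> \bar R)
  (J : T1 -> (T2 -> \bar R) -> \bar R) :
  sfunctional I -> (forall x, sfunctional (J x)) ->
  (forall f, nnm f -> measurable_fun setT (fun x => J x f)) ->
  sfunctional (fun f => I (fun x => J x f)).
Proof.
move=> sI sJ mJ.
have nJ f : nnm f -> nnm (fun x => J x f).
  by move=> f0; split; [exact: mJ|move=> x; exact: (sf_ge0 (sJ x))].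
split.
- by move=> f f0; apply: (sf_ge0 sI); exact: nJ.
- by move=> f g f0 g0 fg; apply: (sf_le sI) => [||x]; [exact: nJ|exact: nJ|exact: (sf_le (sJ x))].
- move=> f g f0 g0; rewrite -(sf_add sI); [|exact: nJ|exact: nJ].
  by apply: sf_ext => x; exact: (sf_add (sJ x)).
- move=> c f c0 f0; rewrite -(sf_scale sI)//; last exact: nJ.
  by apply: sf_ext => x; exact: (sf_scale (sJ x)).
- move=> F F0 ndF; rewrite -(sf_lim sI); first last.
  + by move=> x m n mn; apply: (sf_le (sJ x)) => // y; exact: ndF.
  + by move=> n; exact: nJ.
  by apply: sf_ext => x; exact: (sf_lim (sJ x)).
Qed.

Lemma sf_precomp d1 d2 (T1 : measurableType d1) (T2 : measurableType d2)
  (R : realType) (I : (T1 -> \bar R) -> \bar R) (p : T1 -> T2) :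
  sfunctional I -> measurable_fun setT p ->
  sfunctional (fun f : T2 -> \bar R => I (fun x => f (p x))).
Proof.
move=> sI mp; apply: sf_comp => // [x|f [mf _]]; first exact: sf_dirac.
exact: measurableT_comp.
Qed.

Lemma sf_weight d (T : measurableType d) (R : realType)
  (I : (T -> \bar R) -> \bar R) (w : T -> \bar R) :
  sfunctional I -> nnm w -> sfunctional (fun f => I (fun x => w x * f x)%E).
Proof.
move=> sI [mw w0]; apply: (@sf_comp _ _ _ _ _ I (fun x f => w x * f x)%E) => //.
  by move=> x; apply: sf_cscale => //; exact: sf_dirac.
by move=> f [mf _]; exact: emeasurable_funM.
Qed.

Section riesz.
Local Open Scope ereal_scope.
Context d (T : measurableType d) (R : realType) (I : (T -> \bar R) -> \bar R).
Hypothesis sI : sfunctional I.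

(** The value 0 off the measurable sets keeps [mu] nonnegative on every set, as the interface of
    measures requires. *)
Let mu (A : set T) : \bar R := if pselect (measurable A) is left _ then I (fun x => (\1_A x)%:E) else 0.

Let muE A : measurable A -> mu A = I (fun x => (\1_A x)%:E).
Proof. by rewrite /mu; case: pselect. Qed.

Let mu0 : mu set0 = 0.
Proof.
by rewrite muE// -[RHS](sf0 sI); apply: sf_ext => x; rewrite indic0.
Qed.

Let mu_ge0 A : 0 <= mu A.
Proof.
rewrite /mu; case: pselect => // mA; apply: (sf_ge0 sI); exact: nnm_indic.
Qed.

Let mu_sa : semi_sigma_additive mu.
Proof.
move=> F mF tF mUF.
rewrite (_ : mu (\bigcup_n F n) =
    limn (fun n => \sum_(0 <= i < n) mu (F i))).
  apply: ereal_nondecreasing_is_cvgn; apply: ereal_nondecreasing_series => n _ _.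
  exact: mu_ge0.
rewrite muE// (_ : (fun x => _) = fun x => limn (fun n => \sum_(0 <= i < n) (\1_(F i) x)%:E)).
  rewrite (sf_lim sI).
  - congr (limn _); apply/funext => n; rewrite (sf_sum _ sI).
      by apply: eq_bigr => i _; rewrite muE.
    by move=> i; exact: nnm_indic.
  - by move=> n; apply: nnm_sum => i; exact: nnm_indic.
  - move=> x; apply: ereal_nondecreasing_series => n _ _.
    by rewrite lee_fin.
by apply/funext => x; exact: indic_bigcup.
Qed.

Let mu_isM := isMeasure.Build _ _ _ mu mu0 mu_ge0 mu_sa.

Import HBNNSimple.

(** Countable additivity of [mu] is [sf_lim] applied to partial sums of indicators. The two
    functionals then agree on indicators, hence on simple functions, hence on their increasing
    limits. *)
Lemma sf_riesz : exists m : {measure set T -> \bar R},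
  (forall A, measurable A -> m A = I (fun x => (\1_A x)%:E)) /\
  (forall f, nnm f -> \int[m]_x f x = I f).
Proof.
pose m : {measure set T -> \bar R} := HB.pack mu mu_isM.
exists m; split=> [A mA|f [mf f0]]; first by rewrite /= muE.
have sM := sf_integral m.
pose f_ := nnsfun_approx measurableT mf.
have fE : f = fun x => limn (fun n => (f_ n x)%:E).
  by apply/funext => x; apply/esym/cvg_lim => //; exact: cvg_nnsfun_approx.
have nf n : nnm (fun x => (f_ n x)%:E) by apply: nnm_EFin.
have ndf x : nondecreasing_seq (fun n => (f_ n x)%:E).
  by move=> a b ab; rewrite lee_fin; exact/lefP/nd_nnsfun_approx.
rewrite fE (sf_lim sM)// (sf_lim sI)//; congr (limn _); apply/funext => n.
have fnE : (fun x => (f_ n x)%:E) = fun x =>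
   \sum_(i < #|` fset_set (range (f_ n))|)
     (nth 0%R (fset_set (range (f_ n))) i)%:E * (\1_(f_ n @^-1` [set (nth 0%R (fset_set (range (f_ n))) i)%R]) x)%:E.
  by apply/funext => x; rewrite fimfunEord -sumEFin; apply: eq_bigr => i _; rewrite EFinM.
have r0 (i : 'I_(#|` fset_set (range (f_ n))|)) : (0 <= (nth 0%R (fset_set (range (f_ n))) i))%R.
  have : (nth 0%R (fset_set (range (f_ n))) i)%R \in fset_set (range (f_ n)) by exact: mem_nth.
  by rewrite in_fset_set// => /set_mem [x _ <-].
have mA (i : 'I_(#|` fset_set (range (f_ n))|)) : measurable (f_ n @^-1` [set (nth 0%R (fset_set (range (f_ n))) i)%R]).
  exact: measurable_sfunP.
rewrite fnE (sf_sum _ sM) ?(sf_sum _ sI); last first.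
- move=> i; apply: nnmM; last exact: nnm_indic.
  by apply: nnm_cst; rewrite lee_fin.
- move=> i; apply: nnmM; last exact: nnm_indic.
  by apply: nnm_cst; rewrite lee_fin.
apply: eq_bigr => i _.
rewrite (sf_scale sM)//; last exact: nnm_indic.
rewrite (sf_scale sI)//; last exact: nnm_indic.
congr (_ * _); rewrite integral_indic// setIT.
by rewrite /= muE.
Qed.

End riesz.

Lemma sf_kernel d1 d2 (T1 : measurableType d1) (T2 : measurableType d2)
    (R : realType) (J : T1 -> (T2 -> \bar R) -> \bar R) :
  (forall x, sfunctional (J x)) ->
  (forall f, nnm f -> measurable_fun setT (fun x => J x f)) ->
  exists k : R.-ker T1 ~> T2,
    (forall x A, measurable A -> k x A = J x (fun y => (\1_A y)%:E)) /\
    (forall x f, nnm f -> (\int[k x]_y f y)%E = J x f).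
Proof.
move=> sJ mJ.
have [m hm] := choice (fun x => sf_riesz (sJ x)).
have mk U : measurable U -> measurable_fun setT (m ^~ U).
  move=> mU; rewrite (_ : m ^~ U = fun x => J x (fun y => (\1_U y)%:E)).
    by apply: mJ; exact: nnm_indic.
  by apply/funext => x; rewrite (hm x).1.
pose k : R.-ker T1 ~> T2 := HB.pack m (isKernel.Build _ _ _ _ _ m mk).
by exists k; split => [x A mA|x f f0]; [exact: (hm x).1|exact: (hm x).2].
Qed.

(** * Translation of Lebesgue measure and Tonelli's theorem *)

Section lebesgue_shift.
Context (R : realType).
Local Notation leb := (@lebesgue_measure R).

(** The image of Lebesgue measure under a translation has the right mass on each []b, c]], and these
    intervals determine it. *)
Lemma lebesgue_shift (a : R) (f : R -> \bar R) : nnm f ->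
  (\int[leb]_x f (x + a)%R = \int[leb]_x f x)%E.
Proof.
move=> [mf f0].
have ma : measurable_fun [set: R] (fun x : R => x + a) by exact: measurable_funD.
have := @ge0_integral_pushforward _ _ (measurableTypeR R) (measurableTypeR R) R _ ma leb setT f measurableT mf (fun y _ => f0 y).
rewrite preimage_setT => <-.
apply: eq_measure_integral => A mA _.
apply/esym/lebesgue_measure_unique => //.
move=> X [[b c] _ <-].
transitivity (leb `]b - a, c - a]%classic); last first.
  congr (leb _); apply/seteqP; split => x /=.
    by rewrite !in_itv /= ltrBlDr lerBrDr.
  by rewrite !in_itv /= ltrBlDr lerBrDr.
rewrite !lebesgue_measure_itv /= !lte_fin ltrD2r.
by case: ifP => // _; rewrite -!EFinB; congr EFin; ring.
Qed.

End lebesgue_shift.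

Section tonelli.
Local Open Scope ereal_scope.
Context d1 d2 (T1 : measurableType d1) (T2 : measurableType d2) (R : realType).

Lemma tonelli (m1 : {sigma_finite_measure set T1 -> \bar R})
    (m2 : {sigma_finite_measure set T2 -> \bar R}) (F : T1 -> T2 -> \bar R) :
  nnm (fun z : T1 * T2 => F z.1 z.2) ->
  \int[m1]_x \int[m2]_y F x y = \int[m2]_y \int[m1]_x F x y.
Proof.
by move=> [mF F0]; exact: (fubini_tonelli (fun z : T1 * T2 => F z.1 z.2)).
Qed.

Lemma nnm_int (m2 : {sigma_finite_measure set T2 -> \bar R}) (F : T1 -> T2 -> \bar R) :
  nnm (fun z : T1 * T2 => F z.1 z.2) -> nnm (fun x => \int[m2]_y F x y).
Proof.
move=> [mF F0]; split; last by move=> x; apply: integral_ge0 => y _; exact: (F0 (x, y)).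
exact: (measurable_fun_fubini_tonelli_F (fun z : T1 * T2 => F z.1 z.2)).
Qed.

(** The values of a kernel carry no structure beyond that of a measure; the finiteness of [m2] is
    packed here to supply the sigma-finiteness that Tonelli asks for. *)
Lemma tonelli_fin (m1 : {sigma_finite_measure set T1 -> \bar R})
    (m2 : {measure set T2 -> \bar R}) (F : T1 -> T2 -> \bar R) :
  m2 setT < +oo -> nnm (fun z : T1 * T2 => F z.1 z.2) ->
  \int[m1]_x \int[m2]_y F x y = \int[m2]_y \int[m1]_x F x y.
Proof.
move=> m2fin F0.
have fin : fin_num_fun m2 by exact: lty_fin_num_fun.
pose H1 := isFinite.Build _ _ _ _ fin.
have sg : sigma_finite setT m2.
  by apply: fin_num_fun_sigma_finite => //; rewrite measure0.
pose H2 := isSFinite.Build _ _ _ _ (sfinite_measure_sigma_finite sg).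
pose H3 := isSigmaFinite.Build _ _ _ _ sg.
pose m3 := HB.pack_for (FiniteMeasure.type T2 R) (Measure.sort m2) H1 H2 H3.
exact: (@tonelli m1 m3).
Qed.

Import HBNNSimple.

(** [F] depends on the parameter too, so measurability is obtained from simple functions on the
    product, that is, from the masses of the sections of a measurable set. Finite mass at each point
    suffices, since the bound in [hb] may depend on the point. *)
Lemma nnm_kernel_int (k : R.-ker T1 ~> T2) d3 (T3 : measurableType d3)
    (q : T3 -> T1) (F : T3 -> T2 -> \bar R) :
  (forall x, k x setT < +oo) -> measurable_fun setT q ->
  nnm (fun z : T3 * T2 => F z.1 z.2) ->
  nnm (fun p => \int[k (q p)]_y F p y).
Proof.
move=> kfin mq [mF F0].
have F0' p y : 0 <= F p y by exact: (F0 (p, y)).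
split; last by move=> p; exact: integral_ge0.
pose k' : T3 -> {measure set T2 -> \bar R} := fun p => k (q p).
have mk' U : measurable U -> measurable_fun setT (k' ^~ U).
  by move=> mU; exact: (measurableT_comp (measurable_kernel k U mU) mq).
pose kk : R.-ker T3 ~> T2 := HB.pack k' (isKernel.Build _ _ _ _ _ k' mk').
pose F_ := nnsfun_approx measurableT mF.
apply: (@measurable_fun_xsection_integral _ _ _ _ _ (fun z => F z.1 z.2) kk F_).
- by move=> a b ab; exact/nd_nnsfun_approx.
- by move=> z; exact/cvg_nnsfun_approx.
- move=> n r.
  set B := _ @^-1` _.
  have mB : measurable B by rewrite /B; exact: (measurable_funPTI (F_ n)).
  rewrite (_ : (fun x => _) =
      (fun x => mrestr (kk x) measurableT (xsection B x))); last first.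
    by apply/funext => x//=; rewrite /mrestr setIT.
  suff hb : forall x, exists M, forall X, measurable X -> (mrestr (kk x) measurableT) X < M%:E.
    exact: (measurable_prod_subset_xsection_kernel hb mB).2.
  move=> x.
  (* The bound has to be strict, whence the [+ 1]. *)
  exists (fine (k (q x) setT) + 1)%R => X mX.
  rewrite /mrestr setIT EFinD fineK ?ge0_fin_numE//.
  apply: (@le_lt_trans _ _ (k (q x) setT)).
    by apply: le_measure => //; exact: mem_set.
  by rewrite lteDl// ge0_fin_numE.
Qed.

End tonelli.

(** * Primitives along the real line *)

Section primitives.
Context (R : realType).
Local Notation leb := (@lebesgue_measure R).
Implicit Types (a b u v C : R) (F G H f g D : R -> R).

Definition bnd_on a b f := measurable_fun setT f /\
  exists C, forall x, a <= x <= b -> `|f x| <= C.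

(** An absolutely continuous function with a bounded density. Densities along the flow, such as
    [lam], are merely measurable, so no pointwise derivative is available for the product and chain
    rules. *)
Definition prim a b F f := bnd_on a b f /\
  forall u v, a <= u -> u <= v -> v <= b ->
    F v - F u = \int[leb]_(x in `[u, v]) f x.

Lemma bnd_onS a b u v f : a <= u -> v <= b -> bnd_on a b f -> bnd_on u v f.
Proof.
move=> au vb [mf [C fC]]; split => //; exists C => x /andP[ux xv]; apply: fC.
by rewrite (le_trans au ux) (le_trans xv vb).
Qed.

Lemma leb_itv_lty a b : (leb `[a, b]%classic < +oo)%E.
Proof.
have [ab|ba] := leP a b.
  by rewrite lebesgue_measure_itv /= lte_fin; case: ifP => // _; rewrite ltry.
by rewrite set_itv_ge ?measure0// -leNgt bnd_simp.
Qed.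

Lemma leb_itv a b : a <= b -> leb `[a, b]%classic = (b - a)%:E.
Proof.
move=> ab; rewrite lebesgue_measure_itv /= lte_fin.
case: ifPn => [_|]; first by rewrite -EFinB.
by rewrite -leNgt => ba; rewrite (le_anti (introT andP (conj ab ba))) subrr.
Qed.

Lemma bnd_on_int a b f : bnd_on a b f -> leb.-integrable `[a, b] (EFin \o f).
Proof.
move=> [mf [C fC]]; apply: measurable_bounded_integrable => //.
- exact: leb_itv_lty.
- exact: measurable_funTS.
- exists C; split; first exact: num_real.
  move=> M CM x /=; rewrite in_itv /= => xab.
  exact: le_trans (fC _ xab) (ltW CM).
Qed.

Lemma bnd_onD a b f g : bnd_on a b f -> bnd_on a b g -> bnd_on a b (fun x => f x + g x).
Proof.
move=> [mf [C fC]] [mg [D gD]]; split; first exact: measurable_funD.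
by exists (C + D) => x xab; rewrite (le_trans (ler_normD _ _))// lerD ?fC ?gD.
Qed.

Lemma bnd_onM a b f g : bnd_on a b f -> bnd_on a b g -> bnd_on a b (fun x => f x * g x).
Proof.
move=> [mf [C fC]] [mg [D gD]]; split; first exact: measurable_funM.
by exists (C * D) => x xab; rewrite normrM ler_pM ?fC ?gD.
Qed.

Lemma bnd_on_cst a b c : bnd_on a b (fun=> c).
Proof. by split; [exact: measurable_cst|exists `|c|]. Qed.

Lemma bnd_onN a b f : bnd_on a b f -> bnd_on a b (fun x => - f x).
Proof.
move=> [mf [C fC]]; split; first exact: measurableT_comp.
by exists C => x xab; rewrite normrN fC.
Qed.

Lemma bnd_on_le a b f C : a <= b -> bnd_on a b f -> (forall x, a <= x <= b -> `|f x| <= C) ->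
  `|\int[leb]_(x in `[a, b]) f x| <= C * (b - a).
Proof.
move=> ab bf fC.
have fi := bnd_on_int bf.
rewrite (le_trans (le_normr_Rintegral _ fi))//.
apply: (@le_trans _ _ (\int[leb]_(x in `[a, b]) C)).
  apply: le_Rintegral => //.
  - exact: integrable_norm fi.
  - exact/bnd_on_int/bnd_on_cst.
have -> : C * (b - a) = \int[leb]_(x in `[a, b]) C.
  have := @Rintegral_cst _ _ _ leb _ (measurable_itv `[a, b]) C.
  by move=> ->; congr (_ * _); rewrite -[LHS]/(fine (b - a)%:E); congr fine; exact/esym/leb_itv.
exact: lexx.
Qed.

Lemma bnd_on_chasles a b c f : a <= b -> b <= c -> bnd_on a c f ->
  \int[leb]_(x in `[a, c]) f x =
  \int[leb]_(x in `[a, b]) f x + \int[leb]_(x in `[b, c]) f x.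
Proof.
move=> ab bc /bnd_on_int fi; apply/eqP; rewrite addrC -subr_eq; apply/eqP.
rewrite Rintegral_itvB ?bnd_simp//.
rewrite Rintegral_itv_obnd_cbnd//; apply: integrableS fi => //.
by apply: subset_itv; rewrite bnd_simp.
Qed.

(** Cutting an interval in two halves the bound: twice [C * ((v - u) / 2) ^+ 2] is half of
    [C * (v - u) ^+ 2]. Iterating sends it to 0. *)
Lemma sqr_cst a b H C : (forall u v, a <= u -> u <= v -> v <= b ->
  `|H v - H u| <= C * (v - u) ^+ 2) -> a <= b -> H b = H a.
Proof.
move=> hH ab.
have hn n : forall u v, a <= u -> u <= v -> v <= b ->
    `|H v - H u| <= C * (v - u) ^+ 2 / 2 ^+ n.
  elim: n => [|n ih] u v au uv vb; first by rewrite expr0 divr1 hH.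
  pose m := (u + v) / 2.
  have um : u <= m by rewrite /m; lra.
  have mv : m <= v by rewrite /m; lra.
  have -> : H v - H u = (H v - H m) + (H m - H u) by ring.
  rewrite (le_trans (ler_normD _ _))//.
  have h1 := ih m v (le_trans au um) mv vb.
  have h2 := ih u m au um (le_trans mv vb).
  rewrite (le_trans (lerD h1 h2))// le_eqVlt; apply/orP; left; apply/eqP.
  have -> : v - m = (v - u) / 2 by rewrite /m; field.
  have -> : m - u = (v - u) / 2 by rewrite /m; field.
  rewrite [2 ^+ n.+1]exprS; field.
  by rewrite expf_neq0.
apply/eqP; rewrite -subr_eq0 -normr_le0.
have cv : (fun n => C * (b - a) ^+ 2 / 2 ^+ n) @ \oo --> (0 : R).
  rewrite -[X in _ --> X](mulr0 (C * (b - a) ^+ 2)).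
  under eq_fun do rewrite -exprVn.
  apply: cvgM; first exact: cvg_cst.
  by apply: cvg_expr; rewrite ger0_norm ?invr_ge0// invf_lt1// ltr1n.
rewrite -(cvg_lim _ cv)//; apply: limr_ge; first by apply/cvg_ex; exists 0.
by apply: nearW => n; exact: hn.
Qed.

(** Errors that are quadratic on every subinterval add up to nothing, so a first order expansion at
    the left end is enough to identify a primitive. This replaces differentiation in the rules
    below. *)
Lemma prim_crit a b H f C : bnd_on a b f ->
  (forall u v, a <= u -> u <= v -> v <= b ->
    `|H v - H u - \int[leb]_(x in `[u, v]) f x| <= C * (v - u) ^+ 2) ->
  prim a b H f.
Proof.
move=> bf hH; split => // u v au uv vb.
pose K x := H x - \int[leb]_(y in `[u, x]) f y.
have KE x y : u <= x -> x <= y -> y <= v -> K y - K x = H y - H x - \int[leb]_(z in `[x, y]) f z.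
  move=> ux xy yv; rewrite /K (@bnd_on_chasles u x y)//; first by ring.
  by apply: bnd_onS bf => //; exact: le_trans vb.
have : K v = K u.
  apply: (@sqr_cst u v K C) => // x y ux xy yv; rewrite KE//.
  by apply: hH => //; [exact: le_trans ux|exact: le_trans vb].
rewrite /K set_itv1 Rintegral_set1 subr0 => <-.
by ring.
Qed.

Lemma prim_lip a b F f : prim a b F f ->
  exists C, 0 <= C /\ forall u v, a <= u -> u <= v -> v <= b -> `|F v - F u| <= C * (v - u).
Proof.
move=> [bf hF]; have [mf [C fC]] := bf.
exists `|C|; split => // u v au uv vb; rewrite hF//.
apply: bnd_on_le => //; first exact: bnd_onS bf.
move=> x /andP[ux xv]; rewrite (le_trans (fC _ _)) ?ler_norm//.
by rewrite (le_trans au ux) (le_trans xv vb).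
Qed.

Lemma prim_bnd a b F f : prim a b F f -> exists C, 0 <= C /\ forall x, a <= x <= b -> `|F x| <= C.
Proof.
move=> pF; have [C [C0 hC]] := prim_lip pF.
have [ab|ba] := leP a b; last first.
  by exists 0; split => // x /andP[ax xb]; move: (lt_le_trans ba ax); rewrite ltNge xb.
exists (`|F a| + C * (b - a)); split.
  by rewrite addr_ge0// mulr_ge0// subr_ge0.
move=> x /andP[ax xb].
have -> : F x = F a + (F x - F a) by ring.
rewrite (le_trans (ler_normD _ _))// lerD2l (le_trans (hC _ _ _ ax xb))//.
by rewrite ler_wpM2l// lerD2r.
Qed.

Lemma prim_bnd_on a b F f : measurable_fun setT F -> prim a b F f -> bnd_on a b F.
Proof. by move=> mF /prim_bnd[C [_ hC]]; split => //; exists C. Qed.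

Lemma prim_M a b F f G g : measurable_fun setT F -> measurable_fun setT G ->
  prim a b F f -> prim a b G g ->
  prim a b (fun x => F x * G x) (fun x => f x * G x + F x * g x).
Proof.
move=> mF mG pF pG.
have [C1 [C10 h1]] := prim_lip pF.
have [C2 [C20 h2]] := prim_lip pG.
have bF := prim_bnd_on mF pF; have bG := prim_bnd_on mG pG.
have [bf hf] := pF; have [bg hg] := pG.
have [_ [Cf hCf]] := bf; have [_ [Cg hCg]] := bg.
apply: (@prim_crit _ _ _ _ (C1 * C2 + (`|Cf| * C2 + C1 * `|Cg|))).
  by apply: bnd_onD; exact: bnd_onM.
move=> u v au uv vb.
have S h : bnd_on a b h -> bnd_on u v h by exact: bnd_onS.
(* [F] and [G] are frozen at the left end [u]; what is left under the integral sign is of order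
   [v - u]. *)
have E : \int[leb]_(x in `[u, v]) (f x * G x + F x * g x) =
   (F v - F u) * G u + F u * (G v - G u) +
   \int[leb]_(x in `[u, v]) (f x * (G x - G u) + (F x - F u) * g x).
  rewrite hf// hg//.
  rewrite -RintegralZr//; last exact/bnd_on_int/S.
  rewrite -RintegralZl//; last exact/bnd_on_int/S.
  rewrite -!RintegralD//.
  - by apply: eq_Rintegral => x _; ring.
  - apply/bnd_on_int/S/bnd_onD; apply: bnd_onM => //; exact: bnd_on_cst.
  - apply/bnd_on_int/S/bnd_onD; apply: bnd_onM => //; apply: bnd_onD => //; exact: bnd_on_cst.
  - apply/bnd_on_int/S/bnd_onM => //; exact: bnd_on_cst.
  - apply/bnd_on_int/S/bnd_onM => //; exact: bnd_on_cst.
rewrite E.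
set I := \int[leb]_(x in _) _.
have -> : F v * G v - F u * G u -
   ((F v - F u) * G u + F u * (G v - G u) + I) = (F v - F u) * (G v - G u) - I by ring.
rewrite (le_trans (ler_normB _ _))//.
rewrite [leRHS]mulrDl lerD//.
  rewrite normrM (_ : C1 * C2 * _ = (C1 * (v - u)) * (C2 * (v - u))); last by ring.
  by rewrite ler_pM// ?h1 ?h2.
rewrite expr2 mulrA; apply: bnd_on_le => //.
  apply/S/bnd_onD; apply: bnd_onM => //; apply: bnd_onD => //; exact: bnd_on_cst.
move=> x /andP[ux xv].
have xab : a <= x <= b by rewrite (le_trans au ux) (le_trans xv vb).
rewrite (le_trans (ler_normD _ _))// [leRHS]mulrDl lerD// normrM.
  rewrite -mulrA ler_pM//; first by rewrite (le_trans (hCf _ xab)) ?ler_norm.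
  rewrite (le_trans (h2 _ _ au ux (le_trans xv vb)))// ler_wpM2l// lerD2r//.
rewrite mulrAC ler_pM//; last by rewrite (le_trans (hCg _ xab)) ?ler_norm.
by rewrite (le_trans (h1 _ _ au ux (le_trans xv vb)))// ler_wpM2l// lerD2r.
Qed.

Lemma expR_taylor1 (y : R) : `|expR y - 1 - y| <= y ^+ 2 * expR `|y|.
Proof.
have h0 : 0 <= expR y - 1 - y.
  by rewrite -addrA -opprD subr_ge0 expR_ge1Dx.
rewrite ger0_norm//.
have h1 : expR y - 1 <= y * expR y.
  have := expR_ge1Dx (- y); rewrite expRN => h.
  have e0 := expR_gt0 y.
  have : (1 + - y) * expR y <= 1 by rewrite -ler_pdivlMr// mul1r.
  lra.
have h2 : expR y - 1 - y <= y * (expR y - 1) by lra.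
rewrite (le_trans h2)//.
rewrite (le_trans (ler_norm _))// normrM expr2 -(normr_id y).
have e : y * y = `|y| * `|y| by rewrite -normrM ger0_norm// -expr2 sqr_ge0.
rewrite normr_id e -mulrA ler_wpM2l//.
have [y0|y0] := leP 0 y.
  rewrite ger0_norm; last by rewrite subr_ge0 -expR0 ler_expR.
  by rewrite ger0_norm.
rewrite ler0_norm; last by rewrite subr_le0 -expR0 ler_expR ltW.
rewrite ltr0_norm//.
have := expR_ge1Dx y.
have : 1 <= expR (- y) by rewrite -expR0 ler_expR oppr_ge0 ltW.
nra.
Qed.

(** The chain rule from [expR_taylor1] at [F u]: on [[u, v]] the increment of [F] is at most
    [C * (v - u)], so the remainder is quadratic. *)
Lemma prim_expR a b F f : measurable_fun setT F -> prim a b F f ->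
  prim a b (fun x => expR (F x)) (fun x => f x * expR (F x)).
Proof.
move=> mF pF.
have [C [C0 h1]] := prim_lip pF.
have [M [M0 hM]] := prim_bnd pF.
have bF := prim_bnd_on mF pF.
have [bf hf] := pF.
have [_ [Cf hCf]] := bf.
have meF : measurable_fun setT (fun x => expR (F x)).
  exact: (measurableT_comp (@measurable_expR R) mF).
have beF : bnd_on a b (fun x => expR (F x)).
  split => //; exists (expR M) => x xab.
  by rewrite ger0_norm ?expR_ge0// ler_expR (le_trans (ler_norm _))// hM.
have expL x y : a <= x <= b -> a <= y <= b -> `|expR (F x) - expR (F y)| <= expR M * (`|F x - F y| * expR (2 * M)).
  move=> xab yab.
  have -> : expR (F x) - expR (F y) = expR (F y) * (expR (F x - F y) - 1).
    by rewrite mulrBr -expRD mulr1; congr (expR _ - _); ring.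
  rewrite normrM ler_pM//.
    by rewrite ger0_norm ?expR_ge0// ler_expR (le_trans (ler_norm _))// hM.
  set z := F x - F y.
  have zM : `|z| <= 2 * M.
    by rewrite (le_trans (ler_normB _ _))// mulr_natl mulr2n lerD// hM.
  have e0 : expR `|z| <= expR (2 * M) by rewrite ler_expR.
  apply: (@le_trans _ _ (`|z| * expR `|z|)); last by rewrite ler_wpM2l.
  have [z0|z0] := leP 0 z.
    rewrite ger0_norm; last by rewrite subr_ge0 -expR0 ler_expR.
    rewrite ger0_norm//.
    have := expR_ge1Dx (- z); rewrite expRN => h.
    have ez := expR_gt0 z.
    have : (1 + - z) * expR z <= 1 by rewrite -ler_pdivlMr// mul1r.
    lra.
  rewrite ler0_norm; last by rewrite subr_le0 -expR0 ler_expR ltW.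
  rewrite ltr0_norm//.
  have := expR_ge1Dx z.
  have : 1 <= expR (- z) by rewrite -expR0 ler_expR oppr_ge0 ltW.
  nra.
pose L := expR M * (C * expR (2 * M)).
apply: (@prim_crit _ _ _ _ (expR M * (C ^+ 2 * expR (2 * M)) + `|Cf| * L)).
  exact: bnd_onM.
move=> u v au uv vb.
have S h : bnd_on a b h -> bnd_on u v h by exact: bnd_onS.
have uab : a <= u <= b by rewrite au (le_trans uv).
have vab : a <= v <= b by rewrite vb (le_trans au).
have E : \int[leb]_(x in `[u, v]) (f x * expR (F x)) =
   (F v - F u) * expR (F u) +
   \int[leb]_(x in `[u, v]) (f x * (expR (F x) - expR (F u))).
  rewrite hf// -RintegralZr//; last exact/bnd_on_int/S.
  rewrite -!RintegralD//.
  - by apply: eq_Rintegral => x _; ring.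
  - apply/bnd_on_int/S/bnd_onM => //; exact: bnd_on_cst.
  - apply/bnd_on_int/S/bnd_onM => //; apply: bnd_onD => //; exact: bnd_on_cst.
rewrite E.
set I := \int[leb]_(x in _) _.
have -> : expR (F v) - expR (F u) - ((F v - F u) * expR (F u) + I) =
   expR (F u) * (expR (F v - F u) - 1 - (F v - F u)) - I.
  rewrite mulrBr mulrBr -expRD (_ : F u + (F v - F u) = F v); last by ring.
  by ring.
rewrite (le_trans (ler_normB _ _))// mulrDl lerD//.
  rewrite normrM -mulrA ler_pM//.
    by rewrite ger0_norm ?expR_ge0// ler_expR (le_trans (ler_norm _))// hM.
  rewrite (le_trans (expR_taylor1 _))//.
  rewrite [leRHS]mulrAC ler_pM ?sqr_ge0 ?expR_ge0//.
    rewrite -exprMn -[leLHS]real_normK ?num_real//.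
    by rewrite lerXn2r ?nnegrE// ?h1// mulr_ge0// subr_ge0.
  rewrite ler_expR (le_trans (ler_normB _ _))// mulr_natl mulr2n lerD// hM//.
rewrite expr2 mulrA; apply: bnd_on_le => //.
  apply/S/bnd_onM => //; apply: bnd_onD => //; exact: bnd_on_cst.
move=> x /andP[ux xv].
have xab : a <= x <= b by rewrite (le_trans au ux) (le_trans xv vb).
rewrite normrM -mulrA ler_pM//; first by rewrite (le_trans (hCf _ xab)) ?ler_norm.
rewrite (le_trans (expL _ _ xab uab))// /L -mulrA ler_wpM2l ?expR_ge0//.
rewrite mulrAC ler_wpM2r ?expR_ge0//.
rewrite (le_trans (h1 _ _ au ux (le_trans xv vb)))// ler_wpM2l// lerD2r//.
Qed.

Lemma prim_N a b F f : prim a b F f -> prim a b (fun x => - F x) (fun x => - f x).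
Proof.
move=> [bf hf]; split; first exact: bnd_onN.
move=> u v au uv vb.
under eq_Rintegral do rewrite -mulN1r.
rewrite RintegralZl//; last by apply: bnd_on_int; exact: bnd_onS bf.
by rewrite -hf//; ring.
Qed.

End primitives.

(** * Fundamental theorem of calculus for right derivatives *)

Section right_derivative.
Context (R : realType).
Local Notation leb := (@lebesgue_measure R).
Implicit Types (a b u v C : R) (F G H f g D : R -> R).

Definition rderive_at F (x l : R) := (F (x + e) - F x) / e @[e --> 0^'+] --> l.

(** [F] attains its minimum on [[a, b]]; at a point before [b] the right derivative would be
    nonnegative, so the minimum is at [b]. *)
Lemma rderive_lt0_le a b F D : a <= b -> {within `[a, b], continuous F} ->
  (forall x, a <= x < b -> rderive_at F x (D x)) ->
  (forall x, a <= x < b -> D x < 0) -> F b <= F a.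
Proof.
move=> ab cF dF D0.
have [c cab minc] := EVT_min ab cF.
have [cb|bc] := ltP c b; last first.
  have -> : b = c.
    by move: cab; rewrite in_itv /= => /andP[_ cb]; apply/eqP; rewrite eq_le bc cb.
  by apply: minc; rewrite in_itv /= lexx.
exfalso.
have cab' : a <= c < b by move: cab; rewrite in_itv /= => /andP[-> _].
have : 0 <= D c.
  rewrite -(cvg_lim _ (dF c cab'))//.
  apply: limr_ge; first by apply/cvg_ex; exists (D c); exact: dF.
  near=> e.
  rewrite divr_ge0//.
  rewrite subr_ge0; apply: minc; rewrite in_itv /=; apply/andP; split.
    by case/andP: cab' => ac _; rewrite (le_trans ac)// lerDl.
  rewrite addrC -lerBrDr; near: e.
  by apply: nbhs_right_le; rewrite subr_gt0.
by rewrite leNgt D0.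
Unshelve. all: by end_near. Qed.

(** Apply the preceding lemma to [F - C x] and [- F - C x], whose right derivatives are negative. *)
Lemma rderive_lip a b F D C : a <= b -> {within `[a, b], continuous F} ->
  (forall x, a <= x < b -> rderive_at F x (D x)) ->
  (forall x, a <= x < b -> `|D x| < C) -> `|F b - F a| <= C * (b - a).
Proof.
move=> ab cF dF DC.
have cid : {within `[a, b], continuous (@id R)}.
  by apply: continuous_subspaceT => y; exact: cvg_id.
have lin (s c : R) : {within `[a, b], continuous (fun x => s * F x - c * x)}.
  move=> x; apply: cvgB; apply: cvgM; try exact: cvg_cst.
    exact: cF.
  exact: cid.
have dlin (s c x : R) : a <= x < b ->
    rderive_at (fun x => s * F x - c * x) x (s * D x - c).
  move=> xab; rewrite /rderive_at.
  have h : s * ((F (x + e) - F x) / e) - c @[e --> 0^'+] --> s * D x - c.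
    by apply: cvgB; [apply: cvgM; [exact: cvg_cst|exact: dF]|exact: cvg_cst].
  apply: cvg_trans h; apply: near_eq_cvg.
  near=> e.
  have e0 : e != 0 by rewrite gt_eqF//.
  by field.
rewrite ler_norml; apply/andP; split.
  have := @rderive_lt0_le a b (fun x => -1 * F x - C * x) (fun x => -1 * D x - C) ab (lin _ _) (dlin _ _).
  move=> h.
  have : forall x : R, a <= x < b -> -1 * D x - C < 0.
    by move=> x /DC; rewrite ltr_norml => /andP[? ?]; lra.
  by move/h; lra.
have := @rderive_lt0_le a b (fun x => 1 * F x - C * x) (fun x => 1 * D x - C) ab (lin _ _) (dlin _ _).
move=> h.
have : forall x : R, a <= x < b -> 1 * D x - C < 0.
  by move=> x /DC; rewrite ltr_norml => /andP[? ?]; lra.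
by move/h; lra.
Unshelve. all: by end_near. Qed.

Lemma Rint_shift f (e u v : R) : measurable_fun setT f ->
  \int[leb]_(x in `[u, v]) f (x + e) = \int[leb]_(x in `[u + e, v + e]) f x.
Proof.
move=> mf; rewrite [RHS]Rintegral_mkcond Rintegral_mkcond.
set g := f \_ _.
have mg : measurable_fun setT g.
  by apply/(measurable_restrictT _ _).1 => //; exact: measurable_funTS.
rewrite (_ : _ \_ _ = fun x => g (x + e)); last first.
  apply/funext => x; rewrite /g /patch !mem_setE !in_itv /=.
  by rewrite !lerD2r.
rewrite /Rintegral; congr fine.
rewrite integralE [RHS]integralE; congr (_ - _)%E.
  transitivity (\int[leb]_x ((fun y => (g y)%:E)^\+ (x + e)%R))%E.
    by apply: eq_integral => x _; rewrite !funeposE.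
  apply: (@lebesgue_shift R e ((fun y => (g y)%:E)^\+)%E).
  by split => //; apply/measurable_funepos/measurable_EFinP.
transitivity (\int[leb]_x ((fun y => (g y)%:E)^\- (x + e)%R))%E.
  by apply: eq_integral => x _; rewrite !funenegE.
apply: (@lebesgue_shift R e ((fun y => (g y)%:E)^\-)%E).
by split => //; apply/measurable_funeneg/measurable_EFinP.
Qed.

(** A bounded right derivative makes [F] Lipschitz, so the difference quotients are bounded. Their
    integrals tend to [F b - F a] by a change of variable and to the integral of [D] by dominated
    convergence. *)
Lemma rderive_ftc a b F D : a <= b -> {within `[a, b], continuous F} ->
  (forall x, a <= x < b -> rderive_at F x (D x)) -> bnd_on a b D ->
  F b - F a = \int[leb]_(x in `[a, b]) D x.
Proof.
move=> ab cF dF bD; have [mD [C0 DC0]] := bD.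
pose C := `|C0| + 1.
have C_gt0 : 0 < C by rewrite ltr_wpDl.
have DC x : a <= x < b -> `|D x| < C.
  move=> /andP[ax xb]; rewrite /C (le_lt_trans (DC0 x _)) ?ax ?ltW//.
  by rewrite ltr_pwDr// ler_norm.
have lipF u v : a <= u -> u <= v -> v <= b -> `|F v - F u| <= C * (v - u).
  move=> au uv vb; apply: (@rderive_lip u v F D) => //.
  - apply: continuous_subspaceW cF; apply: subset_itv; by rewrite bnd_simp.
  - by move=> x /andP[ux xv]; apply: dF; rewrite (le_trans au)//= (lt_le_trans xv).
  - by move=> x /andP[ux xv]; apply: DC; rewrite (le_trans au)//= (lt_le_trans xv).
(* [F] is extended by constants outside [[a, b]], so that [F (x + e)] makes sense up to [b]. *)
pose cl x := Num.max a (Num.min x b).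
have cl_in x : a <= cl x <= b.
  rewrite /cl le_max lexx /= ge_max ab /=.
  by rewrite ge_min lexx orbT.
have cl_id x : a <= x <= b -> cl x = x.
  by move=> /andP[ax xb]; rewrite /cl (min_idPl xb) (max_idPr ax).
have cl_lip x y : x <= y -> 0 <= cl y - cl x <= y - x.
  move=> xy; rewrite /cl !minEle !maxEle.
  case: (leP x b) => xb; case: (leP y b) => yb; case: (leP a x) => ax;
    case: (leP a y) => ay; rewrite ?ab; apply/andP; split; lra.
pose G x := F (cl x).
have lipG x y : x <= y -> `|G y - G x| <= C * (y - x).
  move=> xy; have /andP[h1 h2] := cl_lip _ _ xy.
  have /andP[h3 h4] := cl_in x; have /andP[h5 h6] := cl_in y.
  rewrite /G (le_trans (lipF _ _ _ _ _))//; first by rewrite -subr_ge0.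
  by rewrite ler_wpM2l// ltW.
have lipG' x y : `|G y - G x| <= C * `|y - x|.
  have [xy|/ltW yx] := leP x y.
    by rewrite (ger0_norm (_ : 0 <= y - x)) ?subr_ge0// lipG.
  by rewrite distrC (distrC y) (ger0_norm (_ : 0 <= x - y)) ?subr_ge0// lipG.
have cG : continuous G.
  move=> x; apply/cvgrPdist_lt => e e0.
  near=> y.
  rewrite (le_lt_trans (lipG' _ _))// mulrC -ltr_pdivlMr//.
  near: y; apply: (@cvgr_dist_lt _ _ _ (nbhs x) _ id x) => //.
  by rewrite divr_gt0.
have mG : measurable_fun setT G by exact: continuous_measurable_fun.
have bG u v : bnd_on u v G.
  split => //; exists (`|F a| + C * (b - a)) => x _.
  rewrite /G; have /andP[h1 h2] := cl_in x.
  have -> : F (cl x) = F a + (F (cl x) - F a) by ring.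
  rewrite (le_trans (ler_normD _ _))// lerD2l (le_trans (lipF _ _ _ _ _))//.
  by rewrite ler_wpM2l ?lerD2r// ltW.
have mGe (e : R) : measurable_fun setT (fun x : R => G (x + e)).
  apply: (measurableT_comp mG); exact: measurable_funD.
have bGe u v (e : R) : bnd_on u v (fun x : R => G (x + e)).
  split => //; have [_ [M hM]] := bG (u + e) (v + e); exists M => x /andP[ux xv].
  by apply: hM; rewrite !lerD2r ux.
pose ee n : R := n.+1%:R^-1.
have ee0 n : 0 < ee n by rewrite invr_gt0.
pose q n x := (ee n)^-1 * (G (x + ee n) - G x).
(* After the shift, the integral is the mean of [G] over [[b, b + e]], exactly [F b], minus that
   over [[a, a + e]], within [C * e] of [F a]. *)
have qE n : `|\int[leb]_(x in `[a, b]) q n x - (F b - F a)| <= C * ee n.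
  rewrite /q RintegralZl//; last first.
    by apply: bnd_on_int; apply: bnd_onD => //; exact: bnd_onN.
  rewrite RintegralB//; try exact: bnd_on_int.
  rewrite Rint_shift//.
  have al : a <= a + ee n by rewrite lerDl ltW.
  have bl : b <= b + ee n by rewrite lerDl ltW.
  have abl : a + ee n <= b + ee n by rewrite lerD2r.
  have e1 := bnd_on_chasles al abl (bG _ _).
  have e2 := bnd_on_chasles ab bl (bG _ _).
  have e3 : \int[leb]_(x in `[b, b + ee n]) G x = ee n * F b.
    transitivity (\int[leb]_(x in `[b, b + ee n]) (F b)).
      apply: eq_Rintegral => x /set_mem; rewrite /= in_itv /= => /andP[bx _].
      by rewrite /G /cl (min_idPr bx) (max_idPr ab).
    have := @Rintegral_cst _ _ _ leb _ (measurable_itv `[b, b + ee n]) (F b).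
    move=> ->; rewrite mulrC; congr (_ * _).
    transitivity (fine (b + ee n - b)%:E); last by rewrite /=; ring.
    by congr fine; apply: leb_itv; rewrite lerDl ltW.
  have e4 : `|\int[leb]_(x in `[a, a + ee n]) G x - ee n * F a| <= C * ee n * ee n.
    have -> : ee n * F a = \int[leb]_(x in `[a, a + ee n]) (F a).
      have := @Rintegral_cst _ _ _ leb _ (measurable_itv `[a, a + ee n]) (F a).
      move=> ->; rewrite mulrC; congr (_ * _).
      transitivity (fine (a + ee n - a)%:E); first by rewrite /=; ring.
      by congr fine; apply/esym/leb_itv; rewrite lerDl ltW.
    rewrite -RintegralB//; try exact: bnd_on_int; last exact/bnd_on_int/bnd_on_cst.
    rewrite (_ : C * ee n * ee n = C * ee n * (a + ee n - a)); last by ring.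
    apply: bnd_on_le; first by rewrite lerDl ltW.
      apply: bnd_onD => //; exact: bnd_on_cst.
    move=> x /andP[ax xa].
    have -> : F a = G a by rewrite /G cl_id// lexx.
    rewrite (le_trans (lipG _ _ ax))// ler_pM2l//.
    by rewrite lerBlDl.
  rewrite e3 in e2; rewrite e2 in e1.
  move: e1 e4; set I1 := \int[leb]_(x in `[a, b]) _.
  set I2 := \int[leb]_(x in `[a, a + _]) _.
  set I3 := \int[leb]_(x in `[a + _, b + _]) _ => e1 e4.
  have -> : (ee n)^-1 * (I3 - I1) - (F b - F a) = - ((ee n)^-1 * (I2 - ee n * F a)).
    have -> : I3 = I1 + ee n * F b - I2 by rewrite e1; ring.
    field. by rewrite gt_eqF.
  rewrite normrN normrM gtr0_norm ?invr_gt0// ler_pdivrMl//.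
  by rewrite (le_trans e4)// le_eqVlt; apply/orP; left; apply/eqP; ring.
have cvq : (fun n => \int[leb]_(x in `[a, b]) q n x) @ \oo --> F b - F a.
  apply/cvgrPdist_lt => e e_gt0.
  have ec : 0 < e / C by rewrite divr_gt0.
  near=> n.
  rewrite distrC (le_lt_trans (qE n))// mulrC -ltr_pdivlMr//.
  near: n; exact: (near_infty_natSinv_lt (PosNum ec)).
have mq n : measurable_fun setT (q n).
  apply: measurable_funM => //; exact: measurable_funB.
have qb n x : `|q n x| <= C.
  rewrite /q normrM gtr0_norm ?invr_gt0// ler_pdivrMl// mulrC.
  have xe : x <= x + ee n by rewrite lerDl ltW.
  rewrite (le_trans (lipG _ _ xe))// (_ : x + ee n - x = ee n) ?lexx//; ring.
have bq n : bnd_on a b (q n) by split => //; exists C => x _.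
have := @dominated_convergence _ _ R leb `[a, b]%classic (measurable_itv _)
  (fun n => EFin \o q n) (EFin \o D) (cst C%:E).
(* The point [b] is left out, as nothing is assumed about a right derivative there. *)
have ae_b : {ae leb, forall x, `[a, b]%classic x -> (EFin \o q n) x @[n --> \oo] --> (EFin \o D) x}.
  exists [set b]; split => //; first by rewrite lebesgue_measure_set1.
  move=> x /= hx; apply: contrapT => xb; apply: hx; rewrite in_itv /= => /andP[ax xb'].
  have xltb : x < b by rewrite lt_neqAle xb' andbT; apply/eqP.
  have xab : a <= x < b by rewrite ax xltb.
  apply: cvg_EFin; first exact: nearW.
  have := dF x xab; rewrite /rderive_at => hd.
  have := (cvg_at_rightP _ _ _).1 hd ee (conj ee0 (@cvg_harmonic R)).
  have bx : 0 < b - x by rewrite subr_gt0.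
  apply: cvg_trans; apply: near_eq_cvg; near=> n.
  have hn : ee n <= b - x.
    near: n; apply: filterS (near_infty_natSinv_lt (PosNum bx)) => y; exact: ltW.
  have h2 : a <= x + ee n <= b.
    rewrite addrC -lerBrDr hn andbT addrC (le_trans ax)// lerDl; exact: ltW.
  by rewrite /= /q /G (cl_id _ h2) (cl_id x) ?ax// mulrC.
have mqE n : measurable_fun `[a, b] (EFin \o q n).
  by apply/measurable_EFinP; exact: measurable_funTS.
have mDE : measurable_fun `[a, b] (EFin \o D).
  by apply/measurable_EFinP; exact: measurable_funTS.
have intC : leb.-integrable `[a, b] (cst C%:E).
  exact: (bnd_on_int (bnd_on_cst a b C)).
have ae_C : {ae leb, forall x n, `[a, b]%classic x -> (`|(EFin \o q n) x| <= cst C%:E x)%E}.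
  by apply: aeW => x n _; rewrite /= lee_fin.
move=> /(_ mqE mDE ae_b intC ae_C) [_ _ cvI].
have fD : (\int[leb]_(x in `[a, b]) (EFin \o D) x)%E \is a fin_num.
  exact: integrable_fin_num (bnd_on_int bD).
have cvD : (fun n => \int[leb]_(x in `[a, b]) q n x) @ \oo --> \int[leb]_(x in `[a, b]) D x.
  apply/fine_cvg; rewrite fineK//.
have := cvg_unique _ cvq cvD; exact.
Unshelve. all: by end_near. Qed.

Lemma rderive_prim a b F D : {within `[a, b], continuous F} ->
  (forall x, a <= x < b -> rderive_at F x (D x)) -> bnd_on a b D -> prim a b F D.
Proof.
move=> cF dF bD; split => // u v au uv vb.
apply: rderive_ftc => //.
- by apply: continuous_subspaceW cF; apply: subset_itv; rewrite bnd_simp.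
- by move=> x /andP[ux xv]; apply: dF; rewrite (le_trans au)//= (lt_le_trans xv).
- exact: bnd_onS bD.
Qed.

End right_derivative.

(** * The half-line and the flow *)

Section posreal_basics.
Context (R : realType).
Local Notation E := (posreal R).
Implicit Types x y : E.

Lemma val_gt0 x : 0 < val x.
Proof. exact: valP. Qed.

Lemma to_posrealK x : to_posreal (val x) = x.
Proof. by rewrite /to_posreal valKd. Qed.

Lemma val_to_posreal (r : R) : 0 < r -> val (to_posreal r) = r.
Proof. by move=> r0; rewrite /to_posreal val_insubd r0. Qed.

Lemma measurable_pval : measurable_fun setT (val : E -> R).
Proof. by move=> _ B mB; rewrite setTI; exists B => //; rewrite setTI. Qed.

Lemma measurable_posreal d (T : measurableType d) (f : T -> E) :
  measurable_fun setT (fun t => val (f t)) -> measurable_fun setT f.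
Proof.
move=> mf _ B [C mC <-]; rewrite !setTI.
by have := mf measurableT C mC; rewrite setTI.
Qed.

Lemma pval_continuous : continuous (val : E -> R).
Proof. exact: initial_continuous. Qed.

Lemma cvg_posreal (T : Type) (F : set_system T) {FF : Filter F} (f : T -> E) x :
  val (f t) @[t --> F] --> val x -> f @ F --> x.
Proof.
move=> h U [V [[W oW WV] Vx VU]].
have nW : nbhs (val x) W by apply: open_nbhs_nbhs; split => //; rewrite -WV in Vx.
have := h W nW; rewrite /nbhs /=; apply: filterS.
by move=> t /= Wt; apply: VU; rewrite -WV.
Qed.

Lemma cvg_to_posreal x : to_posreal r @[r --> val x] --> x.
Proof.
apply: cvg_posreal.
have : id r @[r --> val x] --> val x by exact: cvg_id.
apply: cvg_trans; apply: near_eq_cvg.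
near=> r; rewrite val_to_posreal//.
by near: r; apply: lt_nbhsr; exact: val_gt0.
Unshelve. all: by end_near. Qed.

Lemma continuous_posrealP (f : E -> R) x : {for x, continuous f} ->
  f (to_posreal r) @[r --> val x] --> f x.
Proof. by move=> cf; exact: (cvg_comp _ _ (@cvg_to_posreal x) cf). Qed.

Lemma continuous_measurable_posreal (f : E -> R) : continuous f ->
  measurable_fun setT f.
Proof.
move=> cf; have cg : {in `]0, +oo[%classic, continuous (fun r => f (to_posreal r))}.
  move=> r /set_mem; rewrite /= in_itv /= andbT => r0.
  by have := @continuous_posrealP f (to_posreal r) (cf _); rewrite val_to_posreal.
have mg : measurable_fun (`]0, +oo[%classic : set R) (fun r : R => f (to_posreal r)).
  by apply: open_continuous_measurable_fun => //; exact: interval_open.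
have mg' : measurable_fun setT (fun r : R => if 0 < r then f (to_posreal r) else 0).
  apply: measurable_fun_if => //.
  - exact: measurable_fun_ltr.
  - rewrite setTI; apply: measurable_funS mg => //.
    by move=> r /= ; rewrite in_itv /= andbT.
have := measurableT_comp mg' measurable_pval.
congr (measurable_fun _ _); apply/funext => x /=.
by rewrite val_gt0 to_posrealK.
Qed.

Lemma compact_posreal_itv (a b : R) : 0 < a -> compact [set x : E | a <= val x <= b].
Proof.
move=> a0; rewrite (_ : [set _ | _] = (@to_posreal R) @` `[a, b]%classic).
  apply: continuous_compact; last exact: segment_compact.
  apply: continuous_in_subspaceT => r /set_mem; rewrite /= in_itv /= => /andP[ar _].
  have r0 : 0 < r by rewrite (lt_le_trans a0).
  by have := @cvg_to_posreal (to_posreal r); rewrite val_to_posreal.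
apply/seteqP; split => [x /= xab|x [r]].
  by exists (val x); rewrite ?to_posrealK//= in_itv.
rewrite /= in_itv /= => rab <-; rewrite val_to_posreal//.
by rewrite (lt_le_trans a0)//; case/andP: rab.
Qed.

Lemma compact_bounded_fun (f : E -> R) (C : set E) : continuous f -> compact C ->
  exists M, forall x, C x -> `|f x| <= M.
Proof.
move=> cf cC.
have : compact (f @` C) by apply: continuous_compact => //; exact: continuous_subspaceT.
move/compact_bounded => [M [_ hM]]; exists (M + 1) => x Cx.
apply: (hM (M + 1)); first by rewrite ltrDl.
by exists x.
Qed.

(** [val] and its inverse are continuous, hence bounded on [C]; the second bound keeps [C] away from
    0. *)
Lemma compact_posreal_sub (C : set E) : compact C ->
  exists a b, [/\ 0 < a & C `<=` [set x | a <= val x <= b]].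
Proof.
move=> cC.
have [M hM] := compact_bounded_fun pval_continuous cC.
have cV : continuous (fun x : E => (val x)^-1).
  move=> x; have x0 : val x != 0 by rewrite gt_eqF// val_gt0.
  exact: (cvgV x0 (@pval_continuous x)).
have [N hN] := compact_bounded_fun cV cC.
exists (`|N| + 1)^-1, M; split => [|x Cx].
  by rewrite invr_gt0 ltr_wpDl.
apply/andP; split; last by rewrite (le_trans _ (hM x Cx))// ler_norm.
rewrite -[leRHS]invrK lef_pV2 ?posrE ?invr_gt0 ?val_gt0 ?ltr_wpDl//.
by rewrite (le_trans (ler_norm _))// (le_trans (hN x Cx))// (le_trans (ler_norm _))// lerDl.
Qed.

Lemma locally_boundedP (f : E -> R) (a b : R) : locally_bounded f -> 0 < a ->
  exists M, forall x, a <= val x <= b -> `|f x| <= M.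
Proof.
move=> lf a0; have [M [_ hM]] := lf _ (@compact_posreal_itv a b a0).
by exists (M + 1) => x xab; apply: (hM (M + 1)) => //; rewrite ltrDl.
Qed.

Lemma locally_bounded_of (f : E -> R) : (forall a b, 0 < a ->
  exists M, forall x, a <= val x <= b -> `|f x| <= M) -> locally_bounded f.
Proof.
move=> h C /compact_posreal_sub [a [b [a0 Cab]]].
have [M hM] := h a b a0.
exists M; split; first exact: num_real.
move=> N MN x Cx /=; rewrite (le_trans (hM _ (Cab _ Cx)))//; exact: ltW.
Qed.

End posreal_basics.

Section flow.
Context (R : realType).
Local Notation E := (posreal R).
Context (s : E -> R).
Hypothesis s_incr : forall x y : E, val x < val y -> s x < s y.
Hypothesis s_cont : continuous s.
Hypothesis s_lim : s (to_posreal r) @[r --> +oo] --> +oo.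
Implicit Types x y : E.

Lemma s_leW x y : val x <= val y -> s x <= s y.
Proof.
rewrite le_eqVlt => /orP[/eqP/val_inj ->//|]; by move/s_incr/ltW.
Qed.

Lemma s_lt x y : (s x < s y) = (val x < val y).
Proof.
apply/idP/idP => [|/s_incr//]; rewrite !ltNge; apply: contra; exact: s_leW.
Qed.

Lemma s_le x y : (s x <= s y) = (val x <= val y).
Proof. by rewrite !leNgt s_lt. Qed.

Lemma s_inj x y : s x = s y -> x = y.
Proof.
by move=> e; apply/val_inj/eqP; rewrite eq_le -!s_le e lexx.
Qed.

(** Only upwards: [s] may have a finite limit at 0, so its range is an interval unbounded above
    whose lower end is unknown. *)
Lemma s_surj x (r : R) : s x <= r -> exists y, s y = r.
Proof.
move=> xr.
have /cvgryPge/(_ r) := s_lim.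
move=> [M [_ hM]].
pose b := Num.max (val x) (M + 1).
have xb : val x <= b by rewrite le_max lexx.
have Mb : M < b by rewrite lt_max ltrDl ltr01 orbT.
have b0 : 0 < b by rewrite (lt_le_trans (val_gt0 x)).
have [||c] := @IVT _ (fun r => s (to_posreal r)) (val x) b r xb.
- apply: continuous_in_subspaceT => z /set_mem; rewrite /= in_itv /= => /andP[xz _].
  have z0 : 0 < z by rewrite (lt_le_trans (val_gt0 x)).
  by have := @continuous_posrealP R s (to_posreal z) (@s_cont _); rewrite val_to_posreal.
- rewrite to_posrealK; apply/andP; split.
    by rewrite ge_min xr.
  by rewrite le_max (hM b)// orbT.
by move=> _ <-; exists (to_posreal c).
Qed.

(** Below the range of [s] the value is [point], which is 1 and without meaning; [measurable_sinv]
    has to account for it. *)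
Definition sinv (r : R) : E :=
  if pselect (exists y, s y = r) is left e then projT1 (cid e) else point.

Lemma sinvK x : sinv (s x) = x.
Proof.
rewrite /sinv; case: pselect => [e|[]]; last by exists x.
by case: cid => y /= /s_inj.
Qed.

Lemma s_sinv x r : s x <= r -> s (sinv r) = r.
Proof. by move/s_surj => [y <-]; rewrite sinvK. Qed.

Lemma measurable_s : measurable_fun setT s.
Proof. exact: continuous_measurable_posreal. Qed.

Lemma measurable_sinv : measurable_fun setT sinv.
Proof.
apply: measurable_posreal.
apply: (measurability (@RGenCInfty.G R)) => [|/= _ [_] [r] -> <-].
  exact: RGenCInfty.measurableE.
rewrite setTI.
pose I := [set z : R | exists y, s y = z].
have mI : measurable I.
  apply: is_interval_measurable => a b [y <-] _ z /andP[az _].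
  exact: s_surj az.
rewrite -(setIT (_ @^-1` _)) -(setUv I) setIUr; apply: measurableU.
  apply: is_interval_measurable => a b /=.
  rewrite !in_itv /= !andbT => -[ra [y ya]] [rb [y' yb]] z /andP[az zb].
  have [w wz] : I z by apply: (@s_surj y); rewrite ya.
  split; last by exists w.
  rewrite in_itv /= andbT -wz sinvK.
  move: ra; rewrite -ya sinvK => ra; apply: (le_trans ra).
  by rewrite -s_le ya wz.
(* Off the range [sinv] is constantly 1, so this part of the preimage is the whole complement of [I]
   or empty. *)
have [r1|r1] := leP r 1.
  rewrite (_ : _ `&` _ = ~` I); first exact: measurableC.
  apply/seteqP; split => [z []//|z nIz]; split => //=.
  rewrite in_itv /= andbT /sinv; case: pselect => //=.
rewrite (_ : _ `&` _ = set0)//.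
apply/seteqP; split => // z [] /=.
rewrite in_itv /= andbT /sinv; case: pselect => //= _.
by move=> h _; move: (lt_le_trans r1 h); rewrite ltxx.
Qed.

Lemma sinv_continuous x : sinv r @[r --> s x] --> x.
Proof.
apply: cvg_posreal; apply/cvgrPdist_lt => e e0.
pose d := Num.min (e / 2) (val x / 2).
have x0 := val_gt0 x.
have d0 : 0 < d by rewrite lt_min !divr_gt0.
have dx : d <= val x / 2 by rewrite ge_min lexx orbT.
have de : d <= e / 2 by rewrite ge_min lexx.
pose y1 : E := to_posreal (val x - d); pose y2 : E := to_posreal (val x + d).
have v1 : val y1 = val x - d by rewrite val_to_posreal//; lra.
have v2 : val y2 = val x + d by rewrite val_to_posreal//; lra.
have s1 : s y1 < s x by apply: s_incr; rewrite v1; lra.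
have s2 : s x < s y2 by apply: s_incr; rewrite v2; lra.
near=> r.
have r1 : s y1 < r by near: r; exact: lt_nbhsr.
have r2 : r < s y2 by near: r; exact: lt_nbhsl.
have [z zr] := s_surj (ltW r1).
rewrite -zr sinvK.
have : val y1 < val z by rewrite -s_lt zr.
have : val z < val y2 by rewrite -s_lt zr.
by rewrite v1 v2 ltr_distlC => h1 h2; apply/andP; split; lra.
Unshelve. all: by end_near. Qed.

(** The translation by [t] in the coordinate [s]. It is meaningful for [0 <= t]; a negative time may
    leave the range of [s]. *)
Definition phi (t : R) (x : E) : E := sinv (s x + t).

Lemma s_phi t x : 0 <= t -> s (phi t x) = s x + t.
Proof. by move=> t0; apply: (@s_sinv x); rewrite lerDl. Qed.

Lemma phi0 x : phi 0 x = x.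
Proof. by rewrite /phi addr0 sinvK. Qed.

Lemma phiD t u x : 0 <= t -> phi u (phi t x) = phi (t + u) x.
Proof. by move=> t0; rewrite {1}/phi s_phi// /phi addrA. Qed.

Lemma le_phi t x : 0 <= t -> val x <= val (phi t x).
Proof. by move=> t0; rewrite -s_le s_phi// lerDl. Qed.

Lemma le_phi2 t u x : 0 <= t -> t <= u -> val (phi t x) <= val (phi u x).
Proof. by move=> t0 tu; rewrite -s_le !s_phi ?lerD2l// (le_trans t0). Qed.

Lemma measurable_phi : measurable_fun setT (fun z : R * E => phi z.1 z.2).
Proof.
apply: (measurableT_comp measurable_sinv); apply: measurable_funD => //.
exact: (measurableT_comp measurable_s).
Qed.

Lemma measurable_phi_l x : measurable_fun setT (phi^~ x).
Proof.
by apply: (measurableT_comp measurable_sinv); apply: measurable_funD.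
Qed.

Lemma phi_continuous x (t : R) : 0 <= t -> phi u x @[u --> t] --> phi t x.
Proof.
move=> t0; rewrite /phi.
have h : s x + u @[u --> t] --> s (phi t x).
  by rewrite s_phi//; apply: cvgD; [exact: cvg_cst|exact: cvg_id].
apply: cvg_comp h _; exact: sinv_continuous.
Qed.

Lemma phi_fun_continuous (g : E -> R) x (a b : R) : continuous g -> 0 <= a ->
  {within `[a, b], continuous (fun u => g (phi u x))}.
Proof.
move=> cg a0; apply: continuous_in_subspaceT => u /set_mem; rewrite /= in_itv /= => /andP[au _].
have u0 : 0 <= u by exact: le_trans au.
exact: (cvg_comp _ _ (@phi_continuous x u u0) (cg _)).
Qed.

(** Increments of position and of [s] correspond to each other through a homeomorphism, so one tends
    to 0 from the right exactly when the other does. Both directions are checked along sequences. *)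
Lemma sderiveP (f : E -> R) x (l : R) :
  diffquot s f x d @[d --> 0^'+] --> l <->
  (f (phi e x) - f x) / e @[e --> 0^'+] --> l.
Proof.
have x0 := val_gt0 x.
split => h; apply/cvg_at_rightP => u [u0 cu].
  pose d n := val (phi (u n) x) - val x.
  have d0 n : 0 < d n by rewrite subr_gt0 -s_lt s_phi ?ltW// ltrDl.
  have cd : d @ \oo --> (0 : R).
    rewrite -(subrr (val x)); apply: cvgB; last exact: cvg_cst.
    have : phi (u n) x @[n --> \oo] --> x.
      rewrite -{2}[x]phi0.
      apply: (cvg_comp u (phi^~ x) cu); exact: phi_continuous.
    by move=> cp; apply: (cvg_comp (fun n => phi (u n) x) (val : E -> R) cp); exact: pval_continuous.
  have := (cvg_at_rightP _ _ _).1 h d (conj d0 cd).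
  apply: cvg_trans; apply: near_eq_cvg; apply: nearW => n; rewrite /diffquot /=.
  have -> : val x + d n = val (phi (u n) x) by rewrite /d; ring.
  by rewrite to_posrealK s_phi ?ltW//; congr (_ / _); ring.
pose e n := s (to_posreal (val x + u n)) - s x.
have vu n : val (to_posreal (val x + u n)) = val x + u n by rewrite val_to_posreal// addr_gt0.
have e0 n : 0 < e n by rewrite subr_gt0 s_lt vu ltrDl.
have ce : e @ \oo --> (0 : R).
  rewrite -(subrr (s x)); apply: cvgB; last exact: cvg_cst.
  have : val x + u n @[n --> \oo] --> val x.
    by rewrite -[X in _ --> X]addr0; apply: cvgD => //; exact: cvg_cst.
  move=> cv; exact: (cvg_comp _ _ cv (@continuous_posrealP R s x (@s_cont x))).
have := (cvg_at_rightP _ _ _).1 h e (conj e0 ce).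
apply: cvg_trans; apply: near_eq_cvg; apply: nearW => n; rewrite /diffquot /phi /=.
have -> : s x + e n = s (to_posreal (val x + u n)) by rewrite /e; ring.
by rewrite sinvK.
Qed.

Lemma sderiveE (f : E -> R) x (l : R) :
  (f (phi e x) - f x) / e @[e --> 0^'+] --> l -> sderivable s f x /\ sderive s f x = l.
Proof.
move/sderiveP => h; split; first by apply/cvg_ex; exists l.
exact: cvg_lim h.
Qed.

Lemma sderive_cvg (f : E -> R) x : sderivable s f x ->
  (f (phi e x) - f x) / e @[e --> 0^'+] --> sderive s f x.
Proof. by move=> h; apply/sderiveP. Qed.

Lemma rderive_phi (f : E -> R) (x : E) : (forall y, sderivable s f y) ->
  forall u, 0 <= u -> rderive_at (fun u => f (phi u x)) u (sderive s f (phi u x)).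
Proof.
move=> df u u0; rewrite /rderive_at.
have := sderive_cvg (df (phi u x)).
apply: cvg_trans; apply: near_eq_cvg; near=> e.
by rewrite phiD.
Unshelve. all: by end_near. Qed.

Lemma measurable_sderive (f : E -> R) : measurable_fun setT f ->
  (forall y, sderivable s f y) -> measurable_fun setT (sderive s f).
Proof.
move=> mf df.
apply: (@measurable_fun_cvg _ _ _ _ (fun n x => (f (phi n.+1%:R^-1 x) - f x) / n.+1%:R^-1)).
  move=> n; apply: measurable_funM => //; apply: measurable_funB => //.
  apply: (measurableT_comp mf); apply: (measurableT_comp measurable_sinv).
  by apply: measurable_funD => //; exact: measurable_s.
move=> x _; have := sderive_cvg (df x) => /cvg_at_rightP; apply; split.
  by move=> n; rewrite invr_gt0.
exact: cvg_harmonic.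
Qed.

End flow.

Record scale (R : realType) (s : posreal R -> R) : Prop := Scale {
  sc_incr : forall x y : posreal R, val x < val y -> s x < s y;
  sc_cont : continuous s;
  sc_lim : s (to_posreal r) @[r --> +oo] --> +oo }.

(* In the application [fine (kap x setT) - lam x = A h x / h x]. *)
Record rates (R : realType) (kap : R.-ker posreal R ~> posreal R)
    (lam : posreal R -> R) (b : R) : Prop := Rates {
  rt_fin : forall x, (kap x setT < +oo)%E;
  rt_low : forall x : posreal R, kap x [set y | val x <= val y] = 0%E;
  rt_bnd : forall M : R, exists C : R, forall x : posreal R,
    val x <= M -> fine (kap x setT) <= C;
  rt_meas : measurable_fun setT lam;
  rt_lb : locally_bounded lam;
  rt_b0 : 0 <= b;
  rt_ge : forall x, fine (kap x setT) - b <= lam x }.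

Lemma measurable_natr d (T : measurableType d) (R : realType) (p : T -> bool) :
  measurable_fun setT p -> measurable_fun setT (fun z => (p z)%:R : R).
Proof.
move=> mp; rewrite (_ : (fun z => _) = fun z => if p z then 1 else 0).
  exact: measurable_fun_ifT.
by apply/funext => z; case: (p z).
Qed.

(** * The survival weight along the flow *)

Section semigroup_construction.
Context (R : realType).
Local Notation E := (posreal R).
Local Notation leb := (@lebesgue_measure R).
Context (s : E -> R).
Context (kap : R.-ker E ~> E) (lam : E -> R) (b : R).
Hypothesis hs : scale s.
Hypothesis hr : rates kap lam b.
Let r x := fine (kap x setT).

Let s_incr := sc_incr hs.
Let s_cont := sc_cont hs.
Let s_lim := sc_lim hs.
Let kap_fin := rt_fin hr.
Let m_lam := rt_meas hr.
Let lam_lb := rt_lb hr.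
Let lam_ge := rt_ge hr.

Local Notation phi := (phi s).

Let r_ge0 x : 0 <= r x.
Proof. exact: fine_ge0. Qed.

Let rE x : (r x)%:E = kap x setT.
Proof. by rewrite fineK// ge0_fin_numE. Qed.

Let lamb_ge0 x : 0 <= lam x + b.
Proof. by have := lam_ge x; have := r_ge0 x; rewrite /r; lra. Qed.

Let mphi := measurable_phi s_incr s_cont s_lim.

Lemma measurable_phi_comp d (T : measurableType d) (p : T -> R) (q : T -> E) :
  measurable_fun setT p -> measurable_fun setT q ->
  measurable_fun setT (fun z => phi (p z) (q z)).
Proof.
move=> mp mq.
exact: (measurableT_comp mphi (measurable_fun_pair mp mq)).
Qed.

(* [lam + b] is nonnegative, so [weight t x = exp (- int_0^t lam (phi u x) du)]. *)
Definition rate_int (t : R) (x : E) : R :=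
  fine (\int[leb]_u ((0 <= u <= t)%R%:R * (lam (phi u x) + b))%:E).

Definition weight (t : R) (x : E) : R := expR (b * t - rate_int t x).

Lemma weight_ge0 t x : 0 <= weight t x.
Proof. exact: expR_ge0. Qed.

Lemma measurable_lam_phi d (T : measurableType d) (p : T -> R) (q : T -> E) :
  measurable_fun setT p -> measurable_fun setT q ->
  measurable_fun setT (fun z => lam (phi (p z) (q z))).
Proof.
move=> mp mq; exact: (measurableT_comp m_lam (measurable_phi_comp mp mq)).
Qed.

Lemma measurable_rate_int :
  measurable_fun setT (fun z : R * E => rate_int z.1 z.2).
Proof.
apply: (measurableT_comp (@fine_measurable R _ measurableT)).
apply: (proj1 (@nnm_int _ _ _ _ _ leb (fun (z : R * E) u => ((0 <= u <= z.1)%R%:R * (lam (phi u z.2) + b))%:E) _)).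
apply: nnm_EFin; last by move=> z; rewrite mulr_ge0.
apply: measurable_funM.
  apply: measurable_natr; apply: measurable_and.
    by apply: measurable_fun_ler.
  apply: measurable_fun_ler => //.
  exact: (measurableT_comp measurable_fst).
apply: measurable_funD => //; apply: measurable_lam_phi => //.
exact: (measurableT_comp measurable_snd).
Qed.

Lemma measurable_weight : measurable_fun setT (fun z : R * E => weight z.1 z.2).
Proof.
apply: (measurableT_comp (@measurable_expR R)); apply: measurable_funB.
  exact: measurable_funM.
exact: measurable_rate_int.
Qed.

Lemma lam_phi_bnd_on x (T : R) : bnd_on 0 T (fun u => lam (phi u x)).
Proof.
split; first exact: measurable_lam_phi.
have [M hM] := locally_boundedP (val (phi T x)) lam_lb (val_gt0 x).
exists M => u /andP[u0 uT]; apply: hM.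
by rewrite (le_phi s_incr s_cont s_lim)//= (le_phi2 s_incr s_cont s_lim).
Qed.

Lemma Rint_itvE (f : R -> R) (t : R) :
  \int[leb]_(u in `[0, t]) f u = fine (\int[leb]_u ((0 <= u <= t)%R%:R * f u)%:E).
Proof.
rewrite Rintegral_mkcond /Rintegral; congr fine.
apply: eq_integral => u _; rewrite /patch mem_setE in_itv /=.
by case: ifP => _; rewrite ?mul1r ?mul0r.
Qed.

Lemma rate_prim x (T : R) :
  prim 0 T (fun t => b * t - rate_int t x) (fun t => - lam (phi t x)).
Proof.
have bl := lam_phi_bnd_on x T.
have blb : bnd_on 0 T (fun u => lam (phi u x) + b).
  by apply: bnd_onD => //; exact: bnd_on_cst.
split; first exact: bnd_onN.
move=> u v u0 uv vT.
rewrite /rate_int -!Rint_itvE.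
rewrite (@bnd_on_chasles R 0 u v)//; last exact: bnd_onS blb.
have bl' := bnd_onS u0 vT bl.
under [X in _ = X]eq_Rintegral do rewrite -mulN1r.
rewrite RintegralZl//; last exact: bnd_on_int.
set I0 := \int[leb]_(x0 in `[0, u]) _.
rewrite RintegralD//; [|exact: bnd_on_int|exact/bnd_on_int/bnd_on_cst].
have -> : \int[leb]_(x0 in `[u, v]) b = b * (v - u).
  have := @Rintegral_cst _ _ _ leb _ (measurable_itv `[u, v]) b.
  move=> ->; congr (_ * _).
  transitivity (fine (v - u)%:E) => //.
  by congr fine; exact: leb_itv.
by ring.
Qed.

Lemma measurable_rate_t x : measurable_fun setT (fun t => b * t - rate_int t x).
Proof.
apply: measurable_funB; first exact: measurable_funM.
exact: (measurableT_comp measurable_rate_int (@pair2_measurable _ _ R E x)).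
Qed.

Lemma weight_prim x (T : R) :
  prim 0 T (fun t => weight t x) (fun t => - lam (phi t x) * weight t x).
Proof.
by apply: prim_expR; [exact: measurable_rate_t|exact: rate_prim].
Qed.

Lemma measurable_weight_t x : measurable_fun setT (fun t => weight t x).
Proof. exact: (measurableT_comp measurable_weight (@pair2_measurable _ _ R E x)). Qed.

Lemma rate_int_le0 t x : t <= 0 -> rate_int t x = 0.
Proof.
rewrite le_eqVlt => /orP[/eqP ->|t0].
  by rewrite /rate_int -Rint_itvE set_itv1 Rintegral_set1.
rewrite /rate_int -Rint_itvE set_itv_ge ?Rintegral_set0//.
by rewrite bnd_simp -ltNge.
Qed.

Lemma weight0 x : weight 0 x = 1.
Proof. by rewrite /weight rate_int_le0// mulr0 subr0 expR0. Qed.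

(** The integral of [lam] over [[0, t + u]] is split at [t], and its second part is the integral
    along the flow started at [phi t x]. *)
Lemma weightD t u x : 0 <= t -> 0 <= u ->
  weight (t + u) x = weight t x * weight u (phi t x).
Proof.
move=> t0 u0; rewrite /weight -expRD; congr expR.
have tu : t <= t + u by rewrite lerDl.
have tu0 : 0 <= t + u by rewrite addr_ge0.
have [_ h1] := rate_prim x (t + u).
have [_ h2] := rate_prim (phi t x) u.
have := h1 t (t + u) t0 tu (lexx _).
have := h2 0 u (lexx _) u0 (lexx _).
have -> : \int[leb]_(x0 in `[t, (t + u)]) - lam (phi x0 x) =
  \int[leb]_(x0 in `[0, u]) - lam (phi x0 (phi t x)).
  have -> : `[t, t + u]%classic = `[0 + t, u + t]%classic by rewrite add0r addrC.
  rewrite -(@Rint_shift R (fun x0 => - lam (phi x0 x))).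
    apply: eq_Rintegral => v _; congr (- lam _).
    by rewrite (phiD s_incr s_cont s_lim)// addrC.
  by apply: measurable_funN; exact: measurable_lam_phi.
move=> <-; rewrite (@rate_int_le0 0 (phi t x))// mulr0 => h; lra.
Qed.

End semigroup_construction.

Lemma adde_eq (R : realType) (x x' y y' : \bar R) :
  x = x' -> y = y' -> (x + y = x' + y')%E.
Proof. by move=> -> ->. Qed.

(** * The minimal semigroup *)

Section minimal_semigroup.
Context (R : realType).
Local Notation E := (posreal R).
Local Notation leb := (@lebesgue_measure R).
Context (s : E -> R) (kap : R.-ker E ~> E) (lam : E -> R) (b : R).
Hypothesis hs : scale s.
Hypothesis hr : rates kap lam b.
Local Notation phi := (phi s).
Local Notation weight := (weight s lam b).
Local Open Scope ereal_scope.

Let mphi d (T : measurableType d) (p : T -> R) (q : T -> E) mp mq :=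
  @measurable_phi_comp R s hs d T p q mp mq.
Let mw := measurable_weight hs hr.
Let kfin := rt_fin hr.

(* All operators act on functions of (time, position) and vanish at negative
   times: [Sop] follows the flow, [Qop] makes the first jump at time [u], and
   [Pn n] counts the paths with fewer than [n] jumps. *)
Definition Swt (t : R) (x : E) : \bar R := ((0 <= t)%R%:R * weight t x)%:E.
Definition Qwt (t : R) (x : E) : \bar R := ((0 < t)%R%:R * weight t x)%:E.
Definition Sop (f : E -> \bar R) (z : R * E) := Swt z.1 z.2 * f (phi z.1 z.2).
Definition Qop (G : R * E -> \bar R) (z : R * E) :=
  \int[leb]_u (Qwt u z.2 * \int[kap (phi u z.2)]_y G (z.1 - u, y)%R).

Fixpoint Pn (n : nat) (f : E -> \bar R) (z : R * E) : \bar R :=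
  if n is m.+1 then Sop f z + Qop (Pn m f) z else 0.

Definition Poo (f : E -> \bar R) (z : R * E) : \bar R := limn (fun n => Pn n f z).

Lemma SopE f (t : R) x : Sop f (t, x) = Swt t x * f (phi t x).
Proof. by []. Qed.

Lemma QopE G (t : R) x : Qop G (t, x) =
  \int[leb]_u (Qwt u x * \int[kap (phi u x)]_y G (t - u, y)%R).
Proof. by []. Qed.

Lemma PnS n f z : Pn n.+1 f z = Sop f z + Qop (Pn n f) z.
Proof. by []. Qed.

Lemma Pn0 f z : Pn 0 f z = 0.
Proof. by []. Qed.

Lemma Swt_ge t x : (0 <= t)%R -> Swt t x = (weight t x)%:E.
Proof. by move=> t0; rewrite /Swt t0 mul1r. Qed.

Lemma Swt_lt t x : (t < 0)%R -> Swt t x = 0.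
Proof. by move=> t0; rewrite /Swt leNgt t0 mul0r. Qed.

Lemma Qwt_gt t x : (0 < t)%R -> Qwt t x = (weight t x)%:E.
Proof. by move=> t0; rewrite /Qwt t0 mul1r. Qed.

Lemma Qwt_le t x : (t <= 0)%R -> Qwt t x = 0.
Proof. by move=> t0; rewrite /Qwt ltNge t0 mul0r. Qed.

Lemma Swt_ge0 t x : 0 <= Swt t x.
Proof. by rewrite lee_fin mulr_ge0// weight_ge0. Qed.

Lemma nnm_Swt d (T : measurableType d) (p : T -> R) (q : T -> E) :
  measurable_fun setT p -> measurable_fun setT q -> nnm (fun z => Swt (p z) (q z)).
Proof.
move=> mp mq; apply: nnm_EFin; last by move=> z; rewrite mulr_ge0// weight_ge0.
apply: measurable_funM; first by apply: measurable_natr; exact: measurable_fun_ler.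
exact: (measurableT_comp mw (measurable_fun_pair mp mq)).
Qed.

Lemma nnm_Qwt d (T : measurableType d) (p : T -> R) (q : T -> E) :
  measurable_fun setT p -> measurable_fun setT q -> nnm (fun z => Qwt (p z) (q z)).
Proof.
move=> mp mq; apply: nnm_EFin; last by move=> z; rewrite mulr_ge0// weight_ge0.
apply: measurable_funM; first by apply: measurable_natr; exact: measurable_fun_ltr.
exact: (measurableT_comp mw (measurable_fun_pair mp mq)).
Qed.

Lemma nnm_kap d (T : measurableType d) (q : T -> E) (F : T -> E -> \bar R) :
  measurable_fun setT q -> nnm (fun z : T * E => F z.1 z.2) ->
  nnm (fun p => \int[kap (q p)]_y F p y).
Proof. exact: nnm_kernel_int. Qed.

Lemma nnm_Sop f : nnm f -> nnm (Sop f).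
Proof.
move=> f0; apply: nnmM; first exact: nnm_Swt.
by apply: nnm_comp => //; exact: mphi.
Qed.

Lemma nnm_Qint d (T : measurableType d) (G : R * E -> \bar R)
    (u t : T -> R) (x : T -> E) : nnm G ->
  measurable_fun setT u -> measurable_fun setT t -> measurable_fun setT x ->
  nnm (fun p => Qwt (u p) (x p) * \int[kap (phi (u p) (x p))]_y G (t p - u p, y)%R).
Proof.
move=> G0 mu mt mx; apply: nnmM; first exact: nnm_Qwt.
apply: nnm_kap; first exact: mphi.
apply: nnm_comp => //; apply: measurable_fun_pair => //.
by apply: measurable_funB; exact: measurableT_comp.
Qed.

Lemma nnm_Qop G : nnm G -> nnm (Qop G).
Proof.
move=> G0.
apply: (@nnm_int _ _ _ _ _ leb (fun (z : R * E) u =>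
  Qwt u z.2 * \int[kap (phi u z.2)]_y G (z.1 - u, y)%R)).
apply: nnm_Qint => //; exact: measurableT_comp.
Qed.

Lemma nnm_Pn n f : nnm f -> nnm (Pn n f).
Proof.
move=> f0; elim: n => [|n ih]; first exact: nnm_cst.
by apply: nnmD; [exact: nnm_Sop|exact: nnm_Qop].
Qed.

Lemma sf_Sop z : sfunctional (fun f => Sop f z).
Proof.
apply: sf_cscale; last exact: sf_dirac.
by rewrite lee_fin mulr_ge0// weight_ge0.
Qed.

Lemma sf_Qop z : sfunctional (fun G => Qop G z).
Proof.
apply: (@sf_comp _ _ _ _ _ (fun f => \int[leb]_u f u)
  (fun u G => Qwt u z.2 * \int[kap (phi u z.2)]_y G (z.1 - u, y)%R)).
- exact: sf_integral.
- move=> u; apply: sf_cscale.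
    by rewrite lee_fin mulr_ge0// weight_ge0.
  apply: (@sf_precomp _ _ _ _ _ (fun f => \int[kap (phi u z.2)]_y f y) (fun y => (z.1 - u, y)%R)).
    exact: sf_integral.
  exact: measurable_fun_pair.
- move=> G G0; apply: (proj1 (nnm_Qint G0 _ _ _)) => //.
Qed.

Opaque Swt Qwt Sop Qop Pn.

Lemma sf_Pn n z : sfunctional (fun f => Pn n f z).
Proof.
elim: n z => [|n ih] z.
  have h : sfunctional (fun f : E -> \bar R => 0 * f point).
    by apply: sf_cscale => //; exact: sf_dirac.
  rewrite (_ : (fun f => Pn 0 f z) = (fun f => 0 * f point))//.
  by apply/funext => f; rewrite mul0e Pn0.
rewrite (_ : (fun f => _) = (fun f => Sop f z + Qop (Pn n f) z)); last first.
  by apply/funext => f; rewrite PnS.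
apply: sf_addf; first exact: sf_Sop.
apply: (@sf_comp _ _ _ _ _ (fun G => Qop G z) (fun z' f => Pn n f z') (sf_Qop z) ih).
by move=> f f0; have [] := nnm_Pn n f0.
Qed.

Lemma Sop_ge0 f z : nnm f -> 0 <= Sop f z.
Proof. by move=> f0; have [_] := nnm_Sop f0; exact. Qed.

Lemma Pn_ge0 n f z : nnm f -> 0 <= Pn n f z.
Proof. by move=> f0; have [_] := nnm_Pn n f0; exact. Qed.

Lemma Qop_le G H z : nnm G -> nnm H -> (forall z', G z' <= H z') -> Qop G z <= Qop H z.
Proof. exact: (sf_le (sf_Qop z)). Qed.

Lemma nd_Pn f z : nnm f -> nondecreasing_seq (fun n => Pn n f z).
Proof.
move=> f0; apply/nondecreasing_seqP => n; elim: n z => [|n ih] z.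
  by rewrite Pn0; exact: Pn_ge0.
rewrite (PnS n) (PnS n.+1); apply: leeD2l; apply: Qop_le => //.
  exact: nnm_Pn.
exact: (nnm_Pn n.+1).
Qed.

Lemma Pn_lt0 n f (t : R) x : (t < 0)%R -> nnm f -> Pn n f (t, x) = 0.
Proof.
move=> t0 f0; elim: n t x t0 => [|n ih] t x t0; first by rewrite Pn0.
rewrite PnS SopE Swt_lt// mul0e add0e QopE.
apply: integral0_eq => u _.
have [u0|u0] := ltP 0%R u; last by rewrite Qwt_le// mul0e.
rewrite integral0_eq ?mule0// => y _; apply: ih.
by rewrite subr_lt0 (lt_trans t0).
Qed.

Lemma nnm_Poo f : nnm f -> nnm (Poo f).
Proof.
move=> f0; apply: nnm_lim => [n|z]; [exact: nnm_Pn|exact: nd_Pn].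
Qed.

Lemma sf_Poo z : sfunctional (fun f => Poo f z).
Proof.
apply: sf_limf => [n|f f0]; [exact: sf_Pn|exact: nd_Pn].
Qed.

Lemma Pn_le_Poo n f z : nnm f -> Pn n f z <= Poo f z.
Proof. by move=> f0; apply: (@le_limn _ (fun n => Pn n f z)); exact: nd_Pn. Qed.

Lemma Poo_lt0 f (t : R) x : (t < 0)%R -> nnm f -> Poo f (t, x) = 0.
Proof.
move=> t0 f0; rewrite /Poo (_ : (fun n => _) = cst 0) ?lim_cst//.
by apply/funext => n; exact: Pn_lt0.
Qed.

Lemma Qop_lim f z : nnm f -> limn (fun n => Qop (Pn n f) z) = Qop (Poo f) z.
Proof.
move=> f0; rewrite (sf_lim (sf_Qop z))// => [n|z']; [exact: nnm_Pn|exact: nd_Pn].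
Qed.

Lemma nd_Qop f z : nnm f -> nondecreasing_seq (fun n => Qop (Pn n f) z).
Proof.
by move=> f0 m n mn; apply: Qop_le; [exact: nnm_Pn|exact: nnm_Pn|move=> z'; exact: nd_Pn].
Qed.

Lemma limn_S (u : (\bar R)^nat) : nondecreasing_seq u -> limn (fun n => u n.+1) = limn u.
Proof.
move=> ndu; apply/cvg_lim => //.
by rewrite (cvg_shiftS u); exact: ereal_nondecreasing_is_cvgn.
Qed.

Lemma limn_addl (c : \bar R) (u : (\bar R)^nat) : 0 <= c -> (forall n, 0 <= u n) ->
  nondecreasing_seq u -> limn (fun n => c + u n) = c + limn u.
Proof.
move=> c0 u0 ndu; rewrite limeD.
- by rewrite lim_cst.
- exact: is_cvg_cst.
- exact: ereal_nondecreasing_is_cvgn.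
- apply: ge0_adde_def; rewrite inE ?lim_cst//.
  by apply: lime_ge; [exact: ereal_nondecreasing_is_cvgn|exact: nearW].
Qed.

(** The renewal equation: condition on the first jump. It is the limit of the recursion for [Pn],
    carried through [Qop] by monotone convergence. *)
Lemma Poo_fix f z : nnm f -> Poo f z = Sop f z + Qop (Poo f) z.
Proof.
move=> f0; rewrite /Poo -(limn_S (nd_Pn z f0)).
rewrite -Qop_lim// -limn_addl; first by [].
- exact: Sop_ge0.
- by move=> n; have [_] := nnm_Qop (nnm_Pn n f0); exact.
- exact: nd_Qop.
Qed.

Lemma kap_eq x (f g : E -> \bar R) : nnm f -> nnm g ->
  (forall y, (val y < val x)%R -> f y = g y) ->
  \int[kap x]_y f y = \int[kap x]_y g y.
Proof.
move=> [mf f0] [mg g0] fg; apply: ge0_ae_eq_integral => //.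
have mA : measurable [set y : E | (val x <= val y)%R].
  rewrite (_ : [set y : E | _] = (val : E -> R) @^-1` `[val x, +oo[%classic).
    rewrite -[X in measurable X]setTI.
    by apply: (@measurable_pval R measurableT).
  by apply/seteqP; split => y /=; rewrite in_itv /= andbT.
exists [set y | (val x <= val y)%R]; split => //.
- exact: (rt_low hr).
- move=> y /= h; rewrite leNgt; apply/negP => yx; apply: h => _; exact: fg.
Qed.

(* A path started at [x] stays below [phi t x] up to time [t], so [Poo f (t, x)]
   only depends on [f] there. *)
Definition below (t : R) (x : E) (f g : E -> \bar R) :=
  forall y, (s y <= s x + t)%R -> f y = g y.

(** A jump at time [u] leads below [phi u x] and leaves the time [t - u], so the level [s x + t]
    bounds the continuation as well. *)
Lemma Pn_eq n f g (t : R) x : nnm f -> nnm g -> below t x f g ->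
  Pn n f (t, x) = Pn n g (t, x).
Proof.
move=> f0 g0; elim: n t x => [|n ih] t x fg; first by rewrite !Pn0.
rewrite !PnS.
rewrite !SopE.
rewrite !QopE.
apply: adde_eq.
  have [t0|t0] := leP 0%R t; last by rewrite Swt_lt// !mul0e.
  by rewrite fg// (s_phi (sc_incr hs) (sc_cont hs) (sc_lim hs)).
apply: eq_integral => u _.
have [u0|u0] := ltP 0%R u; last by rewrite Qwt_le// !mul0e.
congr (_ * _); apply: kap_eq => [||y yu].
- apply: (nnm_comp (nnm_Pn n f0)); exact: measurable_fun_pair.
- apply: (nnm_comp (nnm_Pn n g0)); exact: measurable_fun_pair.
- apply: ih => z zy; apply: fg.
  have := sc_incr hs yu; rewrite (s_phi (sc_incr hs) (sc_cont hs) (sc_lim hs)) ?(ltW u0)//.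
  by move: zy => /= zy h; lra.
Qed.

Lemma Poo_eq f g (t : R) x : nnm f -> nnm g -> below t x f g ->
  Poo f (t, x) = Poo g (t, x).
Proof.
by move=> f0 g0 fg; congr (limn _); apply/funext => n; exact: Pn_eq.
Qed.

Lemma SopD f (t u : R) x : (0 <= t)%R -> (0 <= u)%R ->
  Sop f (t + u, x)%R = Swt t x * Sop f (u, phi t x).
Proof.
move=> t0 u0; rewrite !SopE !Swt_ge ?addr_ge0// (weightD hs hr)// EFinM.
by rewrite (phiD (sc_incr hs) (sc_cont hs) (sc_lim hs))// muleA.
Qed.

(** The factor cuts off negative times, where the translate of [Pn n f] need not vanish. [Qop]
    integrates over all jump times and relies on the vanishing of its operand at negative times to
    stop at [t]. *)
Definition shifted n f (u : R) (z : R * E) : \bar R :=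
  (0 <= z.1)%R%:R%:E * Pn n f (z.1 + u, z.2)%R.

Lemma nnm_shifted n f u : nnm f -> nnm (shifted n f u).
Proof.
move=> f0; apply: nnmM.
  apply: nnm_EFin => //; apply: measurable_natr; exact: measurable_fun_ler.
apply: (nnm_comp (nnm_Pn n f0)); apply: measurable_fun_pair => //.
exact: measurable_funD.
Qed.

(** The first jump comes either after [t], and then the path can be restarted at [phi t x], or by
    time [t], and then the time left after it still has to be prolonged by [u]. *)
Lemma Pn_split n f (t u : R) x : nnm f -> (0 <= t)%R -> (0 <= u)%R ->
  Pn n.+1 f (t + u, x)%R =
  Sop (fun y => Pn n.+1 f (u, y)) (t, x) + Qop (shifted n f u) (t, x).
Proof.
move=> f0 t0 u0.
have G0 := nnm_Pn n f0.
rewrite (PnS n f (t + u, x)%R).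
rewrite (SopD _ _ t0 u0).
rewrite [X in _ = X + _]SopE.
rewrite (PnS n f (u, _)).
rewrite ge0_muleDr; last 2 first.
- exact: Sop_ge0.
- by have [_] := nnm_Qop G0; exact.
rewrite -addeA; apply: adde_eq; first by [].
pose A v := ((v <= t)%R%:R%:E * (Qwt v x * \int[kap (phi v x)]_y Pn n f (t + u - v, y)%R)).
(* The strict inequality agrees with that in [Qwt]: the shift by [t] turns [t < v] into [0 < v]. *)
pose B v := ((t < v)%R%:R%:E * (Qwt v x * \int[kap (phi v x)]_y Pn n f (t + u - v, y)%R)).
have base0 : nnm (fun v => Qwt v x * \int[kap (phi v x)]_y Pn n f (t + u - v, y)%R).
  exact: (@nnm_Qint _ R (Pn n f) id (fun=> (t + u)%R) (fun=> x)).
have A0 : nnm A.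
  apply: nnmM => //; apply: nnm_EFin => //; apply: measurable_natr; exact: measurable_fun_ler.
have B0 : nnm B.
  apply: nnmM => //; apply: nnm_EFin => //; apply: measurable_natr; exact: measurable_fun_ltr.
have -> : Qop (Pn n f) (t + u, x)%R = \int[leb]_v (A v + B v).
  rewrite QopE; apply: eq_integral => v _; rewrite /A /B.
  by case: (leP v t) => _; rewrite ?mul1e ?mul0e ?adde0 ?add0e.
have eB : \int[leb]_v B v = Swt t x * Qop (Pn n f) (u, phi t x).
  rewrite -(lebesgue_shift t B0) QopE.
  have h0 : nnm (fun v => Qwt v (phi t x) * \int[kap (phi v (phi t x))]_y Pn n f (u - v, y)%R).
    exact: (@nnm_Qint _ R (Pn n f) id (fun=> u) (fun=> phi t x)).
  rewrite Swt_ge// [RHS](esym (sf_scale (sf_integral leb) (weight_ge0 _ _ _ _ _) h0)).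
  apply: eq_integral => v _; rewrite /B ltrDr.
  have [v0|v0] := ltP 0%R v; last by rewrite (Qwt_le _ v0) !mul0e mule0.
  have vt : (0 < v + t)%R by rewrite ltr_wpDr.
  rewrite mul1e (Qwt_gt _ vt) (Qwt_gt _ v0) addrC (weightD hs hr) ?(ltW v0)//.
  rewrite EFinM -muleA -(phiD (sc_incr hs) (sc_cont hs) (sc_lim hs))//.
  by congr (_ * (_ * _)); apply: eq_integral => y _; congr (Pn n f (_, y)); ring.
have eA : \int[leb]_v A v = Qop (shifted n f u) (t, x).
  rewrite QopE; apply: eq_integral => v _; rewrite /A /shifted /=.
  rewrite subr_ge0; case: (leP v t) => vt /=; last first.
    by rewrite mul0e integral0_eq ?mule0// => y _; rewrite mul0e.
  rewrite mul1e; congr (_ * _); apply: eq_integral => y _; rewrite mul1e.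
  by congr (Pn n f (_, y)); ring.
by rewrite -eA -eB [LHS](sf_add (sf_integral leb) A0 B0) addeC.
Qed.

End minimal_semigroup.

#[global] Opaque Swt Qwt Sop Qop Pn.

Section minimal_semigroup_theory.
Context (R : realType).
Local Notation E := (posreal R).
Local Notation leb := (@lebesgue_measure R).
Context (s : E -> R) (kap : R.-ker E ~> E) (lam : E -> R) (b : R).
Hypothesis hs : scale s.
Hypothesis hr : rates kap lam b.
Local Notation phi := (phi s).
Local Notation weight := (weight s lam b).
Local Notation Swt := (Swt s lam b).
Local Notation Qwt := (Qwt s lam b).
Local Notation Sop := (Sop s lam b).
Local Notation Qop := (Qop s kap lam b).
Local Notation Pn := (Pn s kap lam b).
Local Notation Poo := (Poo s kap lam b).
Local Notation shifted := (shifted s kap lam b).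
Local Open Scope ereal_scope.

Let mphi d (T : measurableType d) (p : T -> R) (q : T -> E) mp mq :=
  @measurable_phi_comp R s hs d T p q mp mq.

Let nnm_Poo_u f (u : R) : nnm f -> nnm (fun y => Poo f (u, y)).
Proof.
by move=> f0; apply: (nnm_comp (nnm_Poo hs hr f0)); exact: measurable_fun_pair.
Qed.

Let nnm_Pn_u n f (u : R) : nnm f -> nnm (fun y => Pn n f (u, y)).
Proof.
by move=> f0; apply: (nnm_comp (nnm_Pn hs hr n f0)); exact: measurable_fun_pair.
Qed.

Lemma shifted_lt0 n f (u t : R) x : (t < 0)%R -> shifted n f u (t, x) = 0.
Proof. by move=> t0; rewrite /shifted /= leNgt t0 mul0e. Qed.

Lemma shiftedE n f (u t : R) x : (0 <= t)%R -> shifted n f u (t, x) = Pn n f (t + u, x)%R.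
Proof. by move=> t0; rewrite /shifted /= t0 mul1e. Qed.

Lemma nd_shifted f (u : R) z : nnm f -> nondecreasing_seq (fun n => shifted n f u z).
Proof.
by move=> f0 m n mn; rewrite lee_wpmul2l ?lee_fin//; exact: (nd_Pn hs hr).
Qed.

(** The jumps of a path on [[0, t + u]] are divided between the two factors in an unknown way, so
    the orders [n] cannot be matched. Instead [A], the left side as a function of [(t, x)], is shown
    to solve the fixed point equation of [Poo ph]. Iteration from 0 gives one inequality; induction
    on [shifted], with [Poo_fix] for [ph], gives the other. *)
Theorem Poo_semigroup f (t u : R) x : nnm f -> (0 <= t)%R -> (0 <= u)%R ->
  Poo f (t + u, x)%R = Poo (fun y => Poo f (u, y)) (t, x).
Proof.
move=> f0 t0 u0.
pose ph y := Poo f (u, y).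
have ph0 : nnm ph by exact: nnm_Poo_u.
pose A z := limn (fun n => shifted n f u z).
have sh0 n : nnm (shifted n f u) by exact: (nnm_shifted hs hr).
have A0 : nnm A by apply: nnm_lim => // z; exact: nd_shifted.
have AE t' x' : (0 <= t')%R -> A (t', x') = Poo f (t' + u, x')%R.
  by move=> t'0; congr (limn _); apply/funext => n; rewrite shiftedE.
have AN t' x' : (t' < 0)%R -> A (t', x') = 0.
  move=> t'0; rewrite /A (_ : (fun n => _) = cst 0) ?lim_cst//.
  by apply/funext => n; exact: shifted_lt0.
have Afix t' x' : (0 <= t')%R -> A (t', x') = Sop ph (t', x') + Qop A (t', x').
  move=> t'0; rewrite AE// /Poo -(limn_S (nd_Pn hs hr _ f0)).
  under eq_fun do rewrite (Pn_split hs hr)//.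
  have nd1 : nondecreasing_seq (fun n => Sop (fun y => Pn n.+1 f (u, y)) (t', x')).
    move=> m n mn.
    apply: (sf_le (sf_Sop s lam b _) (nnm_Pn_u _ _ f0) (nnm_Pn_u _ _ f0)) => y.
    exact: (nd_Pn hs hr _ f0).
  have nd2 : nondecreasing_seq (fun n => Qop (shifted n f u) (t', x')).
    move=> m n mn; apply: (Qop_le hs hr _ (sh0 _) (sh0 _)) => z; exact: nd_shifted.
  rewrite limeD.
  - apply: adde_eq.
      rewrite -(sf_lim (sf_Sop s lam b (t', x')) (fun n => nnm_Pn_u n.+1 u f0)).
        congr (Sop _ _); apply/funext => y.
        exact: (limn_S (nd_Pn hs hr _ f0)).
      by move=> y m n mn; exact: (nd_Pn hs hr).
    rewrite -(sf_lim (sf_Qop hs hr (t', x')) sh0)//.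
    by move=> z; exact: nd_shifted.
  - exact: ereal_nondecreasing_is_cvgn.
  - exact: ereal_nondecreasing_is_cvgn.
  - apply: ge0_adde_def; rewrite inE; apply: lime_ge;
      try exact: ereal_nondecreasing_is_cvgn; apply: nearW => n.
      by apply: (Sop_ge0 hs hr); exact: nnm_Pn_u.
    by have [_] := nnm_Qop hs hr (sh0 n); exact.
rewrite -/ph -(AE _ _ t0); apply/eqP; rewrite eq_le; apply/andP; split.
  apply: limn_le; first exact: nd_shifted.
  move=> n; elim: n t x t0 => [|n ih] t x t0.
    by rewrite (shiftedE _ _ _ _ t0) Pn0; have [_] := nnm_Poo hs hr ph0; exact.
  rewrite (shiftedE _ _ _ _ t0) (Pn_split hs hr _ _ f0 t0 u0) (Poo_fix hs hr _ ph0).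
  apply: leeD.
    apply: (sf_le (sf_Sop s lam b _) (nnm_Pn_u _ _ f0) ph0) => y.
    exact: (Pn_le_Poo hs hr _ _ f0).
  apply: (Qop_le hs hr _ (sh0 _) (nnm_Poo hs hr ph0)) => -[t' x'].
  have [t'0|t'0] := leP 0%R t'; first exact: ih.
  by rewrite (shifted_lt0 _ _ _ _ t'0); have [_] := nnm_Poo hs hr ph0; exact.
apply: limn_le; first exact: (nd_Pn hs hr _ ph0).
move=> n; elim: n t x t0 => [|n ih] t x t0; first by rewrite Pn0; have [_] := A0; exact.
rewrite (Afix _ _ t0) PnS; apply: leeD2l.
apply: (Qop_le hs hr _ (nnm_Pn hs hr n ph0) A0) => -[t' x'].
have [t'0|t'0] := leP 0%R t'; first exact: ih.
by rewrite (Pn_lt0 s kap lam b _ _ t'0 ph0); have [_] := A0; exact.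
Qed.

Lemma EFin_Rint (f : R -> R) (t : R) : bnd_on 0%R t f ->
  (\int[leb]_(u in `[0%R, t]) f u)%R%:E = \int[leb]_u ((0 <= u <= t)%R%:R * f u)%:E.
Proof.
move=> bf; rewrite Rint_itvE fineK//.
have : \int[leb]_(u in `[0%R, t]) (EFin \o f) u \is a fin_num.
  exact: integrable_fin_num (bnd_on_int bf).
rewrite integral_mkcond; congr (_ \is a fin_num).
apply: eq_integral => u _; rewrite /patch mem_setE in_itv /=.
by case: ifP => _; rewrite ?mul1r ?mul0r.
Qed.

(** [expR (- (b * t)) * weight t x] is the probability that a clock of rate [lam + b] along the flow
    has not rung by time [t]; the integrand is the density of the ringing time. *)
Lemma weight_total (t : R) x : (0 <= t)%R ->
  (expR (- (b * t)) * weight t x)%R%:E +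
  \int[leb]_u ((0 <= u <= t)%R%:R * ((lam (phi u x) + b) * (expR (- (b * u)) * weight u x)))%:E = 1.
Proof.
move=> t0.
have we u : (expR (- (b * u)) * weight u x = expR (- rate_int s lam b u x))%R.
  by rewrite /weight -expRD; congr expR; ring.
have p0 : prim 0%R t (fun u => (- rate_int s lam b u x)%R) (fun u => - (lam (phi u x) + b))%R.
  have [h1 h2] := rate_prim hs hr x t.
  have bL := lam_phi_bnd_on hs hr x t.
  split; first by apply: bnd_onN; apply: bnd_onD => //; exact: bnd_on_cst.
  move=> v w v0 vw wt.
  under eq_Rintegral do rewrite opprD.
  rewrite RintegralD//; last 2 first.
  - by apply: bnd_on_int; apply: bnd_onN; exact: bnd_onS bL.
  - by apply: bnd_on_int; exact: bnd_on_cst.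
  rewrite -h2//.
  have -> : (\int[leb]_(x0 in `[v, w]) (- b) = (- b) * (w - v))%R.
    have := @Rintegral_cst _ _ _ leb _ (measurable_itv `[v, w]) (- b)%R.
    move=> ->; congr (_ * _)%R.
    transitivity (fine (w - v)%:E) => //.
    by congr fine; exact: leb_itv.
  ring.
have mri : measurable_fun setT (fun u => (- rate_int s lam b u x)%R).
  apply: measurable_funN.
  exact: (measurableT_comp (measurable_rate_int hs hr) (@pair2_measurable _ _ R E x)).
have [h1 h2] := prim_expR mri p0.
have := h2 0%R t (lexx _) t0 (lexx _).
rewrite [in X in (_ - X)%R = _](rate_int_le0 s lam b x (lexx 0%R)) oppr0 expR0 => h3.
have h4 : bnd_on 0%R t (fun u => (lam (phi u x) + b) * expR (- rate_int s lam b u x))%R.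
  have := bnd_onN h1; congr (bnd_on _ _ _); apply/funext => u; ring.
under eq_integral do rewrite we.
rewrite -EFin_Rint// we -EFinD.
have -> : (\int[leb]_(u in `[0, t]) ((lam (phi u x) + b) * expR (- rate_int s lam b u x)) =
  - \int[leb]_(u in `[0, t]) (- (lam (phi u x) + b) * expR (- rate_int s lam b u x)))%R.
  rewrite -mulN1r -RintegralZl//; last exact: bnd_on_int.
  by apply: eq_Rintegral => u _; ring.
by rewrite -h3; congr EFin; ring.
Qed.

(** Multiply [weight_total] by [expR (b * t)] and compare term by term: the first jump has intensity
    [kap], of mass at most [lam + b], and the induction hypothesis bounds what follows by
    [expR (b * (t - u))]. *)
Lemma Pn_le_exp n (t : R) x : (0 <= t)%R -> Pn n (fun=> 1) (t, x) <= (expR (b * t))%:E.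
Proof.
elim: n t x => [|n ih] t x t0; first by rewrite Pn0 lee_fin expR_ge0.
rewrite PnS SopE mule1 (Swt_ge _ _ _ _ t0).
have n1 : nnm (fun _ : E => 1 : \bar R) by apply: nnm_cst; exact: lee01.
rewrite -[leRHS]mule1 -[X in _ <= _ * X](weight_total x t0).
set I := \int[leb]_u _.
have h0 : nnm (fun u : R => ((0 <= u <= t)%R%:R *
   ((lam (phi u x) + b) * (expR (- (b * u)) * weight u x)))%:E).
  apply: nnm_EFin.
    apply: measurable_funM.
      by apply: measurable_natr; apply: measurable_and; exact: measurable_fun_ler.
    apply: measurable_funM.
      by apply: measurable_funD => //; exact: (measurable_lam_phi hs hr).
    apply: measurable_funM; last exact: (measurable_weight_t hs hr).
    apply: (measurableT_comp (@measurable_expR R)).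
    by apply: measurable_funN; exact: measurable_funM.
  move=> u; rewrite !mulr_ge0// ?expR_ge0 ?weight_ge0//.
  have := rt_ge hr (phi u x); have : (0 <= fine (kap (phi u x) setT))%R by exact: fine_ge0.
  lra.
rewrite ge0_muleDr ?lee_fin ?mulr_ge0 ?expR_ge0 ?weight_ge0//; last exact: (sf_ge0 (sf_integral leb) h0).
apply: leeD.
  by rewrite -EFinM lee_fin mulrA -expRD subrr expR0 mul1r.
have hq : nnm (fun u : R => Qwt u x * \int[kap (phi u x)]_y Pn n (fun=> 1) (t - u, y)%R).
  by apply: (nnm_Qint (u := id) (t := fun=> t) (x := fun=> x) hs hr (nnm_Pn hs hr n n1)).
rewrite QopE /I -(sf_scale (sf_integral leb) _ h0) ?expR_ge0//.
apply: (sf_le (sf_integral leb)).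
- exact: hq.
- apply: nnmM h0; exact: nnm_cst.
move=> u /=.
have [u0|u0] := ltP 0%R u; last first.
  rewrite (Qwt_le _ _ _ _ u0) mul0e; apply: mule_ge0; last exact: (h0.2 u).
  by rewrite lee_fin expR_ge0.
have [ut|tu] := leP u t; last first.
  rewrite integral0_eq ?mule0; last by move=> y _; apply: Pn_lt0; rewrite ?subr_lt0.
  by rewrite andbF mul0r mule0.
rewrite (Qwt_gt _ _ _ _ u0) (ltW u0) /= !mul1r.
have -> : (expR (b * t))%:E * ((lam (phi u x) + b) * (expR (- (b * u)) * weight u x))%:E =
  (weight u x)%:E * ((lam (phi u x) + b) * expR (b * (t - u)))%:E.
  rewrite -!EFinM; congr EFin.
  rewrite (_ : expR (b * (t - u)) = (expR (b * t) * expR (- (b * u)))%R); last first.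
    by rewrite -expRD; congr expR; ring.
  by ring.
apply: lee_wpmul2l; first by rewrite lee_fin weight_ge0.
apply: (@le_trans _ _ (\int[kap (phi u x)]_y (expR (b * (t - u)))%:E)).
  apply: ge0_le_integral => //.
  - by move=> y _; exact: (Pn_ge0 hs hr).
  - by have [] := nnm_Pn_u n (t - u) n1.
  - by move=> y _; apply: ih; rewrite subr_ge0.
rewrite integral_cst//= muleC EFinM; apply: lee_wpmul2r.
  by rewrite lee_fin expR_ge0.
have := rt_ge hr (phi u x).
rewrite -{2}(fineK (_ : kap (phi u x) setT \is a fin_num)) ?ge0_fin_numE ?(rt_fin hr)//.
by rewrite lee_fin; lra.
Qed.

Lemma Poo_le_exp (t : R) x : (0 <= t)%R -> Poo (fun=> 1) (t, x) <= (expR (b * t))%:E.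
Proof.
move=> t0; apply: limn_le; first by apply: (nd_Pn hs hr); exact: nnm_cst.
by move=> n; exact: Pn_le_exp.
Qed.

(** The integral over [[0, t]] for operands vanishing at negative times, which spares the lower
    bound. *)
Definition Iop (G : R * E -> \bar R) (z : R * E) :=
  \int[leb]_u ((u <= z.1)%R%:R%:E * G (u, z.2)).

Lemma nnm_ler d (T : measurableType d) (p q : T -> R) : measurable_fun setT p ->
  measurable_fun setT q -> nnm (fun z => (p z <= q z)%R%:R%:E : \bar R).
Proof.
by move=> mp mq; apply: nnm_EFin => //; apply: measurable_natr; exact: measurable_fun_ler.
Qed.

Lemma nnm_Iop G : nnm G -> nnm (Iop G).
Proof.
move=> G0; apply: (@nnm_int _ _ _ _ _ leb (fun (z : R * E) u => ((u <= z.1)%R%:R%:E * G (u, z.2)))).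
apply: nnmM.
  by apply: nnm_ler => //; exact: measurableT_comp.
by apply: (nnm_comp G0); apply: measurable_fun_pair => //; exact: measurableT_comp.
Qed.

Lemma sf_Iop z : sfunctional (fun G => Iop G z).
Proof.
have hw : nnm (fun u : R => (u <= z.1)%R%:R%:E : \bar R) by exact: nnm_ler.
exact: (@sf_precomp _ _ (measurableTypeR R) (R * E)%type R _ (fun u => (u, z.2))
  (sf_weight (sf_integral leb) hw) (@pair2_measurable _ _ R E z.2)).
Qed.

(** [Qop] is a convolution in time, so it commutes with the primitive in time: Tonelli and a
    translation. *)
Lemma Iop_Qop G z : nnm G -> Iop (Qop G) z = Qop (Iop G) z.
Proof.
move=> G0; case: z => t x; rewrite QopE /Iop /=.
have m1 : nnm (fun w : R * R => Qwt w.2 x * \int[kap (phi w.2 x)]_y G (w.1 - w.2, y)%R).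
  exact: (nnm_Qint hs hr G0 (@measurable_snd _ _ R R) (@measurable_fst _ _ R R) (measurable_cst x)).
transitivity (\int[leb]_v \int[leb]_u ((v <= t)%R%:R%:E * (Qwt u x * \int[kap (phi u x)]_y G (v - u, y)%R))).
  apply: eq_integral => v _; rewrite QopE.
  have hv : nnm (fun u : R => Qwt u x * \int[kap (phi u x)]_y G (v - u, y)%R).
    by apply: (nnm_Qint (u := id) (t := fun=> v) (x := fun=> x) hs hr G0).
  by rewrite [RHS](sf_scale (sf_integral leb) _ hv).
rewrite tonelli; last first.
  apply: nnmM => //; apply: nnm_ler => //.
apply: eq_integral => u _.
have m2 : nnm (fun w : R * E => (w.1 <= t - u)%R%:R%:E * G (w.1, w.2)).
  apply: nnmM; first exact: nnm_ler.
  by apply: (nnm_comp G0); exact: measurable_fun_pair.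
have m3 : nnm (fun v : R => (v <= t)%R%:R%:E * \int[kap (phi u x)]_y G (v - u, y)%R).
  apply: nnmM; first exact: nnm_ler.
  have m4 : nnm (fun w : R * E => G (w.1 - u, w.2)%R).
    apply: (nnm_comp G0); apply: measurable_fun_pair => //; exact: measurable_funB.
  exact: (nnm_kap (F := fun (v : R) y => G (v - u, y)%R) hr (measurable_cst (phi u x)) m4).
transitivity (\int[leb]_v (Qwt u x * ((v <= t)%R%:R%:E * \int[kap (phi u x)]_y G (v - u, y)%R))).
  by apply: eq_integral => v _; rewrite muleCA.
have [u0|u0] := leP u 0%R.
  by rewrite (Qwt_le _ _ _ _ u0) mul0e integral0_eq// => v _; rewrite mul0e.
rewrite (Qwt_gt _ _ _ _ u0).
rewrite [LHS](sf_scale (sf_integral leb) (weight_ge0 _ _ _ _ _) m3).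
apply: (congr1 (fun z => (weight u x)%:E * z)).
rewrite -(lebesgue_shift u m3).
transitivity (\int[leb]_v \int[kap (phi u x)]_y ((v <= t - u)%R%:R%:E * G (v, y))).
  apply: eq_integral => v _; rewrite lerBrDr addrK.
  rewrite [RHS](sf_scale (sf_integral (kap (phi u x))))//.
  by apply: (nnm_comp G0); exact: measurable_fun_pair.
exact: (tonelli_fin leb (rt_fin hr (phi u x)) m2).
Qed.

End minimal_semigroup_theory.

(** * The forward equation of the minimal semigroup *)

Section forward_identity.
Context (R : realType).
Local Notation E := (posreal R).
Local Notation leb := (@lebesgue_measure R).
Context (s : E -> R) (kap : R.-ker E ~> E) (lam : E -> R) (b : R).
Hypothesis hs : scale s.
Hypothesis hr : rates kap lam b.
Local Notation phi := (phi s).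
Local Notation weight := (weight s lam b).
Local Notation Swt := (Swt s lam b).
Local Notation Qwt := (Qwt s lam b).
Local Notation Sop := (Sop s lam b).
Local Notation Qop := (Qop s kap lam b).
Local Notation Pn := (Pn s kap lam b).
Local Notation Poo := (Poo s kap lam b).
Local Open Scope ereal_scope.

Definition flow_bounded (g : E -> R) := measurable_fun setT g /\
  forall x (T : R), bnd_on 0%R T (fun u => g (phi u x)).

Definition flow_prim (g D : E -> R) := [/\ measurable_fun setT g, measurable_fun setT D &
  forall x (T : R), prim 0%R T (fun u => g (phi u x)) (fun u => D (phi u x))].

Lemma flow_bounded_loc g : measurable_fun setT g -> locally_bounded g -> flow_bounded g.
Proof.
move=> mg lg; split => // x T; split.
  apply: (measurableT_comp mg); exact: (measurable_phi_comp hs).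
have [M hM] := locally_boundedP (val (phi T x)) lg (val_gt0 x).
exists M => u /andP[u0 uT]; apply: hM.
by rewrite (le_phi (sc_incr hs) (sc_cont hs) (sc_lim hs))//=
  (le_phi2 (sc_incr hs) (sc_cont hs) (sc_lim hs)).
Qed.

Lemma flow_prim_bounded g D : flow_prim g D -> flow_bounded g.
Proof.
move=> [mg mD hp]; split => // x T.
apply: (prim_bnd_on _ (hp x T)).
apply: (measurableT_comp mg); exact: (measurable_phi_comp hs).
Qed.

Lemma flow_prim_sderive g : continuous g -> (forall y, sderivable s g y) ->
  locally_bounded (sderive s g) -> flow_prim g (sderive s g).
Proof.
move=> cg dg lg.
have mg := continuous_measurable_posreal cg.
have mD := measurable_sderive (sc_incr hs) (sc_cont hs) (sc_lim hs) mg dg.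
split => // x T.
apply: rderive_prim.
- apply: (phi_fun_continuous (sc_incr hs) (sc_cont hs) (sc_lim hs)) => //.
- move=> u /andP[u0 _].
  exact: (rderive_phi (sc_incr hs) (sc_cont hs) (sc_lim hs)).
- exact: (flow_bounded_loc mD lg).2.
Qed.

Lemma weight_bnd_on x (T : R) : bnd_on 0%R T (fun u => weight u x).
Proof.
exact: (prim_bnd_on (measurable_weight_t hs hr x) (weight_prim hs hr x T)).
Qed.

Lemma Iop_SopE (g : E -> R) (t : R) x : (0 <= t)%R -> flow_bounded g ->
  Iop (Sop (fun y => (g y)%:E)) (t, x) =
  (\int[leb]_(u in `[0%R, t]) (weight u x * g (phi u x)))%R%:E.
Proof.
move=> t0 [mg bg]; rewrite EFin_Rint; last exact: bnd_onM (weight_bnd_on x t) (bg x t).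
apply: eq_integral => u _; rewrite SopE.
have [u0|u0] := leP 0%R u; last by rewrite (Swt_lt _ _ _ _ u0) mul0e mule0 mul0r.
rewrite (Swt_ge _ _ _ _ u0) /= -!EFinM//.
Qed.

(** The product rule for [weight u x * g (phi u x)]. Its derivative is the weight times
    [D - lam * g], whose parts [p] and [n] are put on opposite sides for the later use with
    nonnegative ones. *)
Lemma Sop_forward (g D p n : E -> R) (t : R) x : (0 <= t)%R -> flow_prim g D ->
  flow_bounded p -> flow_bounded n -> (forall y, D y - lam y * g y = p y - n y)%R ->
  Sop (fun y => (g y)%:E) (t, x) + Iop (Sop (fun y => (n y)%:E)) (t, x) =
  (g x)%:E + Iop (Sop (fun y => (p y)%:E)) (t, x).
Proof.
move=> t0 [mg mD hp] bp bn e.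
rewrite !Iop_SopE// SopE (Swt_ge _ _ _ _ t0) -EFinM -!EFinD; congr EFin.
have mgp : measurable_fun setT (fun u => g (phi u x)).
  apply: (measurableT_comp mg); exact: (measurable_phi_comp hs).
have [_ h] := prim_M (measurable_weight_t hs hr x) mgp (weight_prim hs hr x t) (hp x t).
have := h 0%R t (lexx _) t0 (lexx _).
rewrite (phi0 (sc_incr hs)) (weight0 s lam b x) mul1r.
have -> : (\int[leb]_(u in `[0, t])
   (- lam (phi u x) * weight u x * g (phi u x) + weight u x * D (phi u x)) =
   \int[leb]_(u in `[0, t]) (weight u x * p (phi u x)) -
   \int[leb]_(u in `[0, t]) (weight u x * n (phi u x)))%R.
  rewrite -RintegralB//.
  - apply: eq_Rintegral => u _; rewrite -mulrBr -e; ring.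
  - exact: bnd_on_int (bnd_onM (weight_bnd_on x t) (bp.2 x t)).
  - exact: bnd_on_int (bnd_onM (weight_bnd_on x t) (bn.2 x t)).
lra.
Qed.

Lemma nnm_IQ f n : nnm f -> nnm (Iop (Pn n f)).
Proof. by move=> f0; exact/nnm_Iop/(nnm_Pn hs hr). Qed.

Lemma Iop_lt0 f n (t : R) x : nnm f -> (t < 0)%R -> Iop (Pn n f) (t, x) = 0.
Proof.
move=> f0 t0; apply: integral0_eq => u _ /=.
have [ut|ut] := leP u t; last by rewrite mul0e.
by rewrite Pn_lt0 ?mule0// (le_lt_trans ut).
Qed.

Lemma IopD (G H : R * E -> \bar R) z : nnm G -> nnm H -> Iop (fun z => G z + H z) z = Iop G z + Iop H z.
Proof. exact: (sf_add (sf_Iop z)). Qed.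

Lemma IopS n (f : E -> \bar R) z : nnm f -> Iop (Pn n.+1 f) z = Iop (Sop f) z + Qop (Iop (Pn n f)) z.
Proof.
move=> f0; have P0 := nnm_Pn hs hr n f0.
rewrite -(Iop_Qop hs hr _ P0) -(IopD _ (nnm_Sop hs hr f0) (nnm_Qop hs hr P0)).
by apply: sf_ext => z'; rewrite PnS.
Qed.

Definition kint (f : E -> \bar R) (x : E) := \int[kap x]_y f y.

Lemma nnm_kint f : nnm f -> nnm (kint f).
Proof.
move=> f0; apply: (nnm_kap (F := fun (_ : E) y => f y) hr) => //.
exact: nnm_comp.
Qed.

Definition extend0 (f : E -> \bar R) (z : R * E) := (0 <= z.1)%R%:R%:E * f z.2.

Lemma nnm_extend0 f : nnm f -> nnm (extend0 f).
Proof.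
move=> f0; apply: nnmM; first exact: nnm_ler.
exact: nnm_comp.
Qed.

(** After the jump nothing moves, which leaves [kint f] at the jump point, integrated over the jump
    times. [Qwt] and [Swt] differ at time 0 only. *)
Lemma Qop_extend0 f z : nnm f -> Qop (extend0 f) z = Iop (Sop (kint f)) z.
Proof.
move=> f0; case: z => t x; rewrite QopE.
have k0 := nnm_kint f0.
have h1 : nnm (fun u : R => Qwt u x * \int[kap (phi u x)]_y extend0 f (t - u, y)%R).
  exact: (nnm_Qint hs hr (nnm_extend0 f0) (@measurable_id _ R setT) (measurable_cst t) (measurable_cst x)).
have h2 : nnm (fun u : R => (u <= t)%R%:R%:E * Sop (kint f) (u, x)).
  apply: nnmM; first exact: nnm_ler.
  apply: (nnm_comp (nnm_Sop hs hr k0)); exact: pair2_measurable.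
apply: (@ge0_ae_eq_integral _ _ _ leb setT _ _ measurableT h1.1 h2.1 (fun u _ => h1.2 u) (fun u _ => h2.2 u)).
exists [set 0%R]; split => //; first exact: lebesgue_measure_set1.
move=> u /= h; apply: contrapT => u0; apply: h => _.
rewrite SopE /extend0 /= subr_ge0.
have [u_gt|u_le] := ltP 0%R u.
  rewrite (Qwt_gt _ _ _ _ u_gt) (Swt_ge _ _ _ _ (ltW u_gt)).
  rewrite (sf_scale (sf_integral (kap (phi u x))))// -/(kint f _).
  by rewrite muleCA.
have ult : (u < 0)%R by rewrite lt_neqAle u_le andbT; apply/eqP.
by rewrite (Qwt_le _ _ _ _ u_le) (Swt_lt _ _ _ _ ult) !mul0e mule0.
Qed.

(** Apply [Qop], which commutes with [Iop], to the identity of lower order and add [Sop_forward].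
    The term [extend0] turns into a part of the last one on the right; there [kint] already spends
    one jump, whence the order [k] instead of [k.+1]. *)
Lemma Pn_forward (g D p n : E -> R) k z : flow_prim g D ->
  flow_bounded p -> flow_bounded n -> (forall y, D y - lam y * g y = p y - n y)%R ->
  (forall y, (0 <= g y)%R) -> (forall y, (0 <= p y)%R) -> (forall y, (0 <= n y)%R) ->
  Pn k.+1 (fun y => (g y)%:E) z + Iop (Pn k.+1 (fun y => (n y)%:E)) z =
  extend0 (fun y => (g y)%:E) z + Iop (Pn k.+1 (fun y => (p y)%:E)) z +
  Iop (Pn k (kint (fun y => (g y)%:E))) z.
Proof.
move=> hg bp bn e g0 p0 n0.
set ge := fun y => (g y)%:E; set pe := fun y => (p y)%:E; set ne := fun y => (n y)%:E.
have mge : nnm ge by case: hg => mg _ _; exact: nnm_EFin.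
have mpe : nnm pe by case: bp => mp _; exact: nnm_EFin.
have mne : nnm ne by case: bn => mn _; exact: nnm_EFin.
have mk := nnm_kint mge.
have forwardS t x : (0 <= t)%R -> Sop ge (t, x) + Iop (Sop ne) (t, x) =
    ge x + Iop (Sop pe) (t, x).
  by move=> t0; exact: (Sop_forward x t0 hg bp bn e).
elim: k z => [|k ih] [t x].
  rewrite !IopS// !PnS.
  have I0 G z : Iop (Pn 0 G) z = 0.
    by rewrite /Iop integral0_eq// => u _; rewrite Pn0 mule0.
  have Q00 : Qop (fun=> 0) (t, x) = 0 by exact: (sf0 (sf_Qop hs hr (t, x))).
  have Q0 G : Qop (Iop (Pn 0 G)) (t, x) = 0.
    by rewrite (_ : Iop (Pn 0 G) = fun=> 0) ?Q00//; apply/funext => z; exact: I0.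
  have Q1 G : Qop (Pn 0 G) (t, x) = 0.
    by rewrite (_ : Pn 0 G = fun=> 0) ?Q00//; apply/funext => z; exact: Pn0.
  rewrite !Q0 Q1 I0 !adde0.
  have [t0|t0] := leP 0%R t.
    by rewrite forwardS// /extend0 /= t0 mul1e.
  rewrite /extend0 /= leNgt t0 mul0e SopE (Swt_lt _ _ _ _ t0) mul0e !add0e.
  rewrite /Iop !integral0_eq// => u _ /=.
  - have [ut|ut] := leP u t; last by rewrite mul0e.
    by rewrite SopE Swt_lt ?mul0e ?mule0// (le_lt_trans ut).
  - have [ut|ut] := leP u t; last by rewrite mul0e.
    by rewrite SopE Swt_lt ?mul0e ?mule0// (le_lt_trans ut).
have [t0|t0] := leP 0%R t; last first.
  rewrite !Iop_lt0// !Pn_lt0// /extend0 /= leNgt t0 mul0e !adde0//.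
rewrite (PnS _ _ _ _ k.+1) (IopS k.+1 (t, x) mne) (IopS k.+1 (t, x) mpe) (IopS k (t, x) mk).
rewrite addeACA (forwardS _ _ t0).
have QD G H : nnm G -> nnm H -> Qop G (t, x) + Qop H (t, x) = Qop (fun z => G z + H z) (t, x).
  by move=> hG hH; rewrite (sf_add (sf_Qop hs hr (t, x)) hG hH).
rewrite QD; [|exact: (nnm_Pn hs hr k.+1 mge)|exact: (nnm_IQ k.+1 mne)].
have ihE := funext ih.
rewrite ihE.
rewrite -QD; [|exact: nnmD (nnm_extend0 mge) (nnm_IQ k.+1 mpe)|exact: (nnm_IQ k mk)].
rewrite -QD; [|exact: (nnm_extend0 mge)|exact: (nnm_IQ k.+1 mpe)].
rewrite (Qop_extend0 (t, x) mge) [extend0 _ _]/extend0 t0 mul1e.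
set a1 := ge x; set a2 := Iop (Sop pe) _; set a3 := Iop (Sop (kint ge)) _.
set a4 := Qop _ _; set a5 := Qop _ _.
clearbody a1 a2 a3 a4 a5.
by rewrite -!addeA; do 2 congr (_ + _); rewrite addeCA.
Qed.

Lemma Poo_forward (g D p n : E -> R) z : flow_prim g D ->
  flow_bounded p -> flow_bounded n -> (forall y, D y - lam y * g y = p y - n y)%R ->
  (forall y, (0 <= g y)%R) -> (forall y, (0 <= p y)%R) -> (forall y, (0 <= n y)%R) ->
  Poo (fun y => (g y)%:E) z + Iop (Poo (fun y => (n y)%:E)) z =
  extend0 (fun y => (g y)%:E) z + Iop (Poo (fun y => (p y)%:E)) z +
  Iop (Poo (kint (fun y => (g y)%:E))) z.
Proof.
move=> hg bp bn e g0 p0 n0.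
set ge := fun y => (g y)%:E; set pe := fun y => (p y)%:E; set ne := fun y => (n y)%:E.
have mge : nnm ge by case: hg => mg _ _; exact: nnm_EFin.
have mpe : nnm pe by case: bp => mp _; exact: nnm_EFin.
have mne : nnm ne by case: bn => mn _; exact: nnm_EFin.
have mk := nnm_kint mge.
have I_lim f : nnm f -> Iop (Poo f) z = limn (fun k => Iop (Pn k f) z).
  move=> f0; rewrite -(sf_lim (sf_Iop z) (fun k => nnm_Pn hs hr k f0))//.
  by move=> z'; exact: (nd_Pn hs hr _ f0).
have ndI f : nnm f -> nondecreasing_seq (fun k => Iop (Pn k f) z).
  move=> f0 k l kl; apply: (sf_le (sf_Iop z) (nnm_Pn hs hr k f0) (nnm_Pn hs hr l f0)) => z'.
  exact: (nd_Pn hs hr _ f0).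
have I_ge0 f k : nnm f -> 0 <= Iop (Pn k f) z.
  by move=> f0; exact: (sf_ge0 (sf_Iop z) (nnm_Pn hs hr k f0)).
have limD (u v : (\bar R)^nat) : nondecreasing_seq u -> nondecreasing_seq v ->
    (forall k, 0 <= u k) -> (forall k, 0 <= v k) ->
    limn u + limn v = limn (fun k => u k + v k).
  move=> ndu ndv u0 v0; rewrite limeD//; try exact: ereal_nondecreasing_is_cvgn.
  by apply: ge0_adde_def; rewrite inE; apply: lime_ge;
    try exact: ereal_nondecreasing_is_cvgn; exact: nearW.
have ndS (u : (\bar R)^nat) : nondecreasing_seq u -> nondecreasing_seq (fun k => u k.+1).
  by move=> ndu k l kl; apply: ndu.
have ndP := nd_Pn hs hr z mge.
rewrite (I_lim _ mne) (I_lim _ mpe) (I_lim _ mk) /Poo.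
rewrite -(limn_S ndP) -(limn_S (ndI _ mne)) -(limn_S (ndI _ mpe)).
rewrite limD; [|exact: (ndS _ ndP)|exact: (ndS _ (ndI _ mne))|by move=> k; exact: (Pn_ge0 hs hr k.+1 z mge)|by move=> k; exact: (I_ge0 _ k.+1 mne)].
rewrite -(limn_addl ((nnm_extend0 mge).2 z) (fun k => I_ge0 _ k.+1 mpe) (ndS _ (ndI _ mpe))).
rewrite limD; first last.
- by move=> k; exact: (I_ge0 _ k mk).
- by move=> k; apply: adde_ge0; [exact: (nnm_extend0 mge).2|exact: (I_ge0 _ k.+1 mpe)].
- exact: (ndI _ mk).
- by move=> k l kl; apply: leeD2l; apply: (ndI _ mpe).
by congr (limn _); apply/funext => k; exact: (Pn_forward _ _ hg bp bn e).
Qed.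

End forward_identity.

(** * Forward equation for bounded functions *)

Section core_forward.
Context (R : realType).
Local Notation E := (posreal R).
Local Notation leb := (@lebesgue_measure R).
Context (s : E -> R) (kap : R.-ker E ~> E) (lam : E -> R) (b : R).
Hypothesis hs : scale s.
Hypothesis hr : rates kap lam b.
Local Notation phi := (phi s).
Local Notation Poo := (Poo s kap lam b).

Definition kreal (g : E -> R) (x : E) : R := fine (\int[kap x]_y (g y)%:E).
Definition gen (g D : E -> R) (x : E) : R := D x - lam x * g x + kreal g x.

Local Notation r := (kreal (fun=> 1)).

Lemma kap_integrable (g : E -> R) (C : R) x : measurable_fun setT g -> (forall y, `|g y| <= C) ->
  (kap x).-integrable setT (EFin \o g).
Proof.
move=> mg gC; apply: measurable_bounded_integrable => //; first exact: (rt_fin hr).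
exists C; split; first exact: num_real.
by move=> M CM y _ /=; rewrite (le_trans (gC y))// ltW.
Qed.

Lemma kreal1 x : r x = fine (kap x setT).
Proof. by rewrite /kreal integral_cst// mul1e. Qed.

Lemma kreal1_ge0 x : 0 <= r x.
Proof. by rewrite kreal1; exact: fine_ge0. Qed.

Lemma kreal_le (g : E -> R) (C : R) x : 0 <= C -> measurable_fun setT g -> (forall y, `|g y| <= C) ->
  `|kreal g x| <= C * r x.
Proof.
move=> C0 mg gC; have gi := kap_integrable x mg gC.
have := @le_normr_Rintegral _ _ _ (kap x) setT g measurableT gi.
move=> h; apply: (le_trans h); rewrite kreal1.
have -> : C * fine (kap x setT) = (\int[kap x]_y C)%R by rewrite Rintegral_cst.
apply: le_Rintegral => //; first exact: integrable_norm gi.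
apply: (@kap_integrable (fun=> C) C) => // y; by rewrite ger0_norm.
Qed.

Lemma measurable_kreal (g : E -> R) (C : R) : measurable_fun setT g -> (forall y, `|g y| <= C) ->
  measurable_fun setT (kreal g).
Proof.
move=> mg gC.
have C0 : 0 <= C by exact: le_trans (normr_ge0 _) (gC point).
have gC0 y : 0 <= g y + C by have := gC y; rewrite ler_norml => /andP[h _]; lra.
have mgC : measurable_fun setT (fun y => g y + C) by exact: measurable_funD.
have h x : kreal g x = kreal (fun y => g y + C) x - kreal (fun=> C) x.
  have gi := kap_integrable x mg gC.
  have ci : (kap x).-integrable setT (EFin \o (fun=> C)).
    by apply: (@kap_integrable (fun=> C) C) => // y; rewrite ger0_norm.
  have := @RintegralD _ _ _ (kap x) setT g (fun=> C) measurableT gi ci.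
  rewrite /Rintegral -!/(kreal _ _) => e.
  by rewrite e; ring.
rewrite (_ : kreal g = fun x => kreal (fun y => g y + C) x - kreal (fun=> C) x); last exact/funext.
apply: measurable_funB.
  apply: (measurableT_comp (@fine_measurable R _ measurableT)).
  by have [] := nnm_kint hr (nnm_EFin mgC gC0).
apply: (measurableT_comp (@fine_measurable R _ measurableT)).
have hC : nnm (fun _ : E => C%:E) by exact: nnm_cst.
by have [] := nnm_kint hr hC.
Qed.

Section at_point.
Variables (t : R) (x : E).
Hypothesis t0 : 0 <= t.
Variables (m M : {measure set E -> \bar R}).
Hypothesis mE : forall f, nnm f -> (\int[m]_y f y = Poo f (t, x))%E.
Hypothesis ME : forall f, nnm f -> (\int[M]_y f y = Iop (Poo f) (t, x))%E.

Let one : nnm (fun _ : E => 1%E : \bar R).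
Proof. by apply: nnm_cst; exact: lee01. Qed.

Let m_fin : (m setT < +oo)%E.
Proof.
have := mE one; rewrite integral_cst// mul1e => ->.
exact: le_lt_trans (Poo_le_exp hs hr x t0) (ltry _).
Qed.

Let Iop_fin (f : E -> \bar R) (c : R) : nnm f -> (forall u y, 0 <= u <= t -> s y <= s x + u -> (f y <= c%:E)%E) ->
  (Iop (Poo f) (t, x) < +oo)%E.
Proof.
move=> f0 fc.
have [c0|c0] := leP 0 c; last first.
  have := fc 0 x; rewrite lexx t0 addr0 lexx => /(_ isT isT) h.
  have := le_trans (f0.2 x) h; rewrite lee_fin => h'.
  by move: (lt_le_trans c0 h'); rewrite ltxx.
(* [f] is bounded only on the positions that can be reached; truncating it at [c] leaves
   [Poo f (u, x)] unchanged by [Poo_eq]. *)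
have fm : nnm (fun y => (mine (f y) c%:E)%E).
  split; first by apply: measurable_mine => //; exact: f0.1.
  by move=> y; rewrite le_min f0.2 lee_fin c0.
have /le_lt_trans : (Iop (Poo f) (t, x) <= \int[leb]_(u in `[0%R, t]) (c * expR (b * t))%:E)%E; last first.
  apply; rewrite integral_cst//= lte_mul_pinfty//; first by rewrite lee_fin mulr_ge0// expR_ge0.
  exact: leb_itv_lty.
rewrite [leRHS]integral_mkcond /Iop.
  apply: ge0_le_integral => //.
  - move=> u _; apply: mule_ge0; first by rewrite lee_fin.
    exact: (nnm_Poo hs hr f0).2.
  - apply: emeasurable_funM; first by apply/measurable_EFinP/measurable_natr; exact: measurable_fun_ler.
    exact: (measurableT_comp (nnm_Poo hs hr f0).1 (@pair2_measurable _ _ R E x)).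
  - by apply/(measurable_restrictT _ _).1 => //; exact: measurable_cst.
  - move=> u _; rewrite /patch mem_setE in_itv /=.
    have [u0|u0] /= := leP 0 u; last by rewrite (Poo_lt0 s kap lam b x u0 f0) mule0.
    have [ut|ut] := leP u t; last by rewrite mul0e.
    rewrite mul1e.
    have -> : Poo f (u, x) = Poo (fun y => (mine (f y) c%:E)%E) (u, x).
      apply: (Poo_eq hs hr f0 fm) => y sy; apply/esym/min_idPl.
      by apply: (fc u) => //; rewrite u0 ut.
    apply: (@le_trans _ _ (Poo (fun _ => c%:E * 1)%E (u, x))).
      apply: (sf_le (sf_Poo hs hr _) fm).
        by apply: nnm_cst; rewrite mule1 lee_fin.
      by move=> y; rewrite mule1 ge_min lexx orbT.
    rewrite (sf_scale (sf_Poo hs hr _) c0 one) EFinM lee_wpmul2l ?lee_fin//.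
    rewrite (le_trans (Poo_le_exp hs hr x u0))// lee_fin ler_expR ler_wpM2l//.
    exact: (rt_b0 hr).
Qed.

Let M_fin : (M setT < +oo)%E.
Proof.
have := ME one; rewrite integral_cst// mul1e => ->.
by apply: (@Iop_fin _ 1).
Qed.

Let r_nnm : nnm (fun y => (r y)%:E).
Proof.
apply: nnm_EFin kreal1_ge0; apply: (@measurable_kreal _ 1) => // y.
by rewrite normr1.
Qed.

Let M_r : (\int[M]_y (r y)%:E < +oo)%E.
Proof.
rewrite ME//.
have [C hC] := rt_bnd hr (val (phi t x)).
apply: (@Iop_fin _ C) => // u y /andP[u0 ut] sy; rewrite lee_fin kreal1; apply: hC.
rewrite -(s_le (sc_incr hs)) (s_phi (sc_incr hs) (sc_cont hs) (sc_lim hs))//.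
by rewrite (le_trans sy)// lerD2l.
Qed.

Let lamb_nnm : nnm (fun y => (lam y + b)%:E).
Proof.
apply: nnm_EFin; first by apply: measurable_funD => //; exact: (rt_meas hr).
by move=> y; have := rt_ge hr y; have := kreal1_ge0 y; rewrite kreal1; lra.
Qed.

Let flow_bounded_cst (c : R) : flow_bounded s (fun=> c).
Proof. by split => // *; exact: bnd_on_cst. Qed.

Let flow_lam : flow_bounded s lam.
Proof. exact: (flow_bounded_loc hs (rt_meas hr) (rt_lb hr)). Qed.

(** [lam] may be unbounded near 0, so its integrability under the occupation measure needs a reason.
    In the forward identity for [g = 1], with [p = b] and [n = lam + b], all terms on the right are
    finite. *)
Let M_lam : (\int[M]_y (lam y + b)%:E < +oo)%E.
Proof.
have h1 : flow_prim s (fun=> 1) (fun=> 0).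
  split => // y T; split; first exact: bnd_on_cst.
  by move=> u v _ _ _; rewrite subrr Rintegral_cst// mul0r.
have h3 : flow_bounded s (fun y => lam y + b).
  split; first by apply: measurable_funD => //; exact: (rt_meas hr).
  by move=> y T; apply: bnd_onD; [exact: flow_lam.2|exact: bnd_on_cst].
have h4 y : 0 - lam y * 1 = b - (lam y + b) by ring.
have h5 y : 0 <= lam y + b by have := lamb_nnm.2 y; rewrite lee_fin.
have := Poo_forward hs hr (t, x) h1 (flow_bounded_cst b) h3 h4 (fun=> ler01) (fun=> rt_b0 hr) h5.
rewrite -(ME lamb_nnm) => e.
have : (\int[M]_y (lam y + b)%:E <= Poo (fun=> 1%E) (t, x) + \int[M]_y (lam y + b)%:E)%E.
  by apply: leeDr; exact: (nnm_Poo hs hr one).2.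
move/le_lt_trans; apply; rewrite e.
have hb : nnm (fun _ : E => b%:E) by apply: nnm_cst; rewrite lee_fin (rt_b0 hr).
apply: lte_add_pinfty; first apply: lte_add_pinfty.
- by rewrite /extend0 /= t0 mul1e ltry.
- by apply: (@Iop_fin _ b).
- have -> : kint kap (fun _ : E => 1%:E) = fun y => (r y)%:E.
    apply/funext => y; rewrite /kint /kreal fineK// integral_cst// mul1e.
    by rewrite ge0_fin_numE// (rt_fin hr).
  by rewrite -(ME r_nnm); exact: M_r.
Qed.

Let M_int (f : E -> R) (c1 : R) : measurable_fun setT f -> 0 <= c1 ->
  (forall y, `|f y| <= c1 * (1 + r y + (lam y + b))) -> M.-integrable setT (EFin \o f).
Proof.
move=> mf c10 fc.
apply: (@le_integrable _ _ _ M _ measurableT _ (EFin \o (fun y => c1 * (1 + r y + (lam y + b))))).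
- exact/measurable_EFinP.
- move=> y _ /=; rewrite lee_fin (le_trans (fc y))// ler_norm//.
have i1 : M.-integrable setT (EFin \o (fun=> 1 : R)).
  apply: measurable_bounded_integrable => //; exists 1; split; first exact: num_real.
  by move=> z z1 y _ /=; rewrite normr1 ltW.
have i2 : M.-integrable setT (EFin \o r).
  apply/integrableP; split; first exact: r_nnm.1.
  apply: le_lt_trans M_r; rewrite le_eqVlt; apply/orP; left; apply/eqP.
  by apply: eq_integral => y _ /=; rewrite ger0_norm// kreal1_ge0.
have i3 : M.-integrable setT (EFin \o (fun y => lam y + b)).
  apply/integrableP; split; first exact: lamb_nnm.1.
  apply: le_lt_trans M_lam; rewrite le_eqVlt; apply/orP; left; apply/eqP.
  by apply: eq_integral => y _; rewrite gee0_abs//; exact: lamb_nnm.2.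
have := integrableZl measurableT c1 (integrableD measurableT (integrableD measurableT i1 i2) i3).
by apply: eq_integrable => // y _ /=; rewrite EFinM !EFinD.
Qed.

Let m_int (f : E -> R) (C : R) : measurable_fun setT f -> (forall y, `|f y| <= C) -> m.-integrable setT (EFin \o f).
Proof.
move=> mf fC; apply: measurable_bounded_integrable => //; exists C; split; first exact: num_real.
by move=> z Cz y _ /=; rewrite (le_trans (fC y))// ltW.
Qed.

Let one_le (y : E) : 1 <= 1 + r y + (lam y + b).
Proof.
have := kreal1_ge0 y; have := lamb_nnm.2 y; rewrite lee_fin; lra.
Qed.

Let lam_abs (y : E) : `|lam y| <= (1 + b) * (1 + r y + (lam y + b)).
Proof.
have := kreal1_ge0 y; have := lamb_nnm.2 y; rewrite lee_fin.
have := rt_b0 hr; rewrite ler_norml => b0 l0 r0; apply/andP; split; nra.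
Qed.

Section nonneg.
Variables (g D : E -> R) (C : R).
Hypothesis hg : flow_prim s g D.
Hypothesis gC : forall y, `|g y| <= C.
Hypothesis DC : forall y, `|D y| <= C.

Let C0 : 0 <= C. Proof. exact: le_trans (normr_ge0 _) (gC point). Qed.
Let mg : measurable_fun setT g. Proof. by case: hg. Qed.
Let mD : measurable_fun setT D. Proof. by case: hg. Qed.

Let d (y : E) : R := D y - lam y * g y.

Let md : measurable_fun setT d.
Proof.
apply: measurable_funB => //; apply: measurable_funM => //; exact: (rt_meas hr).
Qed.

Let d_abs (y : E) : `|d y| <= (C * (2 + b)) * (1 + r y + (lam y + b)).
Proof.
rewrite (le_trans (ler_normB _ _))// normrM.
have h1 := one_le y; have h2 := lam_abs y.
have h3 : `|lam y| * `|g y| <= ((1 + b) * (1 + r y + (lam y + b))) * C by rewrite ler_pM.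
have h4 := DC y.
rewrite (le_trans (lerD h4 h3))//.
rewrite (_ : C * (2 + b) * (1 + r y + (lam y + b)) =
  C * (1 + r y + (lam y + b)) + (1 + b) * (1 + r y + (lam y + b)) * C); last by ring.
by rewrite lerD2r ler_peMr.
Qed.

Let C2b : 0 <= C * (2 + b).
Proof. by rewrite mulr_ge0// addr_ge0//; exact: (rt_b0 hr). Qed.

Let id : M.-integrable setT (EFin \o d).
Proof. exact: M_int md C2b d_abs. Qed.

Let kg_abs (y : E) : `|kreal g y| <= C * (1 + r y + (lam y + b)).
Proof.
rewrite (le_trans (kreal_le y C0 mg gC))// ler_wpM2l//.
by have := lamb_nnm.2 y; rewrite lee_fin; lra.
Qed.

Let ikg : M.-integrable setT (EFin \o kreal g).
Proof. exact: M_int (measurable_kreal mg gC) C0 kg_abs. Qed.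

Lemma gen_integrable : M.-integrable setT (EFin \o gen g D).
Proof.
by have := integrableD measurableT id ikg; apply: eq_integrable => // y _ /=; rewrite -EFinD.
Qed.

Lemma gen_Rint : \int[M]_y gen g D y = \int[M]_y d y + \int[M]_y kreal g y.
Proof. by rewrite -RintegralD. Qed.

Hypothesis g0 : forall y, 0 <= g y.

(** Take for [p] and [n] the positive and negative parts of [D - lam * g]. All four integrals being
    finite, the identity of [Poo_forward] can be rearranged between real numbers. *)
Lemma core_forward_nonneg : \int[m]_y g y = g x + \int[M]_y gen g D y.
Proof.
pose p y := Num.max (d y) 0; pose n y := Num.max (- d y) 0.
have dpn y : d y = p y - n y by rewrite /p /n !maxEle; case: ifP; case: ifP; lra.
have p0 y : 0 <= p y by rewrite /p le_max lexx orbT.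
have n0 y : 0 <= n y by rewrite /n le_max lexx orbT.
have p_abs y : `|p y| <= (C * (2 + b)) * (1 + r y + (lam y + b)).
  rewrite ger0_norm// /p ge_max (le_trans (ler_norm _) (d_abs y)).
  exact: le_trans (normr_ge0 _) (d_abs y).
have n_abs y : `|n y| <= (C * (2 + b)) * (1 + r y + (lam y + b)).
  rewrite ger0_norm// /n ge_max; have := d_abs y; rewrite ler_norml => /andP[h1 h2].
  by apply/andP; split; lra.
have mp : measurable_fun setT p by exact: measurable_maxr.
have mn : measurable_fun setT n by apply: measurable_maxr => //; exact: measurableT_comp.
have ip := M_int mp C2b p_abs.
have i_n := M_int mn C2b n_abs.
have fd : flow_bounded s d.
  split => // y T; apply: bnd_onD; first by case: hg => _ _ /(_ y T) [].
  apply: bnd_onN; apply: bnd_onM; first exact: flow_lam.2.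
  exact: (flow_prim_bounded hs hg).2.
have fp : flow_bounded s p.
  split => // y T; have [h1 [c hc]] := fd.2 y T; split.
    by apply: (measurableT_comp mp); exact: (measurable_phi_comp hs).
  exists c => u uT; rewrite ger0_norm// ge_max (le_trans (ler_norm _) (hc u uT)).
  exact: le_trans (normr_ge0 _) (hc u uT).
have fn : flow_bounded s n.
  split => // y T; have [h1 [c hc]] := fd.2 y T; split.
    by apply: (measurableT_comp mn); exact: (measurable_phi_comp hs).
  exists c => u uT; rewrite ger0_norm// ge_max (le_trans (normr_ge0 _) (hc u uT)) andbT.
  by rewrite (le_trans (ler_norm _))// normrN; exact: hc.
have := Poo_forward hs hr (t, x) hg fp fn dpn g0 p0 n0.
rewrite /extend0 /= t0 mul1e -(mE (nnm_EFin mg g0)) -(ME (nnm_EFin mn n0)) -(ME (nnm_EFin mp p0)).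
rewrite -(ME (nnm_kint hr (nnm_EFin mg g0))).
have -> : (\int[M]_y kint kap (fun y0 => (g y0)%:E) y = \int[M]_y (kreal g y)%:E)%E.
  apply: eq_integral => y _; rewrite /kint /kreal fineK//.
  exact: (integrable_fin_num measurableT (kap_integrable y mg gC)).
have f1 := integrable_fin_num measurableT (m_int mg gC).
have f2 := integrable_fin_num measurableT ip.
have f3 := integrable_fin_num measurableT i_n.
have f4 := integrable_fin_num measurableT ikg.
rewrite /= in f1 f2 f3 f4.
rewrite -(fineK f1) -(fineK f2) -(fineK f3) -(fineK f4) -!EFinD => -[e].
have e' : \int[m]_y g y + \int[M]_y n y = g x + \int[M]_y p y + \int[M]_y kreal g y := e.
rewrite gen_Rint.
have -> : \int[M]_y d y = \int[M]_y p y - \int[M]_y n y.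
  by rewrite -RintegralB//; apply: eq_Rintegral => y _; rewrite dpn.
by rewrite -[LHS](addrK (\int[M]_y n y)) e'; ring.
Qed.

End nonneg.

Lemma core_forward (g D : E -> R) (C : R) : flow_prim s g D -> (forall y, `|g y| <= C) ->
  (forall y, `|D y| <= C) ->
  [/\ m.-integrable setT (EFin \o g), M.-integrable setT (EFin \o gen g D) &
   \int[m]_y g y = g x + \int[M]_y gen g D y].
Proof.
move=> hg gC DC.
have [mg mD hp] := hg.
have C0 : 0 <= C by exact: le_trans (normr_ge0 _) (gC point).
split; [exact: m_int mg gC|exact: (gen_integrable hg gC DC)|].
(* Both [g + C] and the constant [C] are nonnegative; subtracting their identities leaves the one
   for [g]. *)
have gc0 y : 0 <= g y + C by have := gC y; rewrite ler_norml => /andP[h _]; lra.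
have cC : `|C| <= 2 * C by rewrite ger0_norm//; lra.
have hc : flow_prim s (fun=> C) (fun=> 0).
  split => // y T; split; first exact: bnd_on_cst.
  by move=> u v _ _ _; rewrite subrr Rintegral_cst// mul0r.
have hgc : flow_prim s (fun y => g y + C) D.
  split => //; first exact: measurable_funD.
  move=> y T; have [h1 h2] := hp y T; split => // u v u0 uv vT.
  by rewrite -h2//; ring.
have gcC y : `|g y + C| <= 2 * C.
  by rewrite (le_trans (ler_normD _ _))// mulr_natl mulr2n lerD// ger0_norm.
have D2C y : `|D y| <= 2 * C by rewrite (le_trans (DC y))//; lra.
have zC : `|0 : R| <= 2 * C by rewrite normr0; lra.
have e1 := core_forward_nonneg hgc gcC D2C gc0.
have e2 := core_forward_nonneg hc (fun=> cC) (fun=> zC) (fun=> C0).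
have mc : m.-integrable setT (EFin \o (fun _ : E => C)).
  by apply: (@m_int _ (2 * C)).
have e3 : \int[m]_y (g y + C) = \int[m]_y g y + \int[m]_y C.
  by rewrite RintegralD//; exact: m_int mg gC.
have e4 : \int[M]_y gen (fun y => g y + C) D y =
    \int[M]_y gen g D y + \int[M]_y gen (fun=> C) (fun=> 0) y.
  rewrite -RintegralD//; first last.
  - exact: (gen_integrable hc (fun=> cC) (fun=> zC)).
  - exact: (gen_integrable hg gC DC).
  apply: eq_Rintegral => y _; rewrite /gen.
  have -> : kreal (fun y0 => g y0 + C) y = kreal g y + kreal (fun=> C) y.
    apply: (@RintegralD _ _ _ (kap y) setT g (fun=> C)) => //.
      exact: kap_integrable gC.
    by apply: (@kap_integrable (fun=> C) (2 * C)).
  by ring.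
move: e1; rewrite e3 e4 => e1.
by rewrite -[LHS](addrK (\int[m]_y C)) e1 e2; ring.
Qed.

End at_point.

End core_forward.

(** * Laplace transforms *)

Section rays.
Context (R : realType).
Local Notation E := (posreal R).

(** The closed ray for [c = true], the open one for [c = false]. Limits of test functions produce
    open rays, the indicators of [[B, C)] closed ones. *)
Definition ray (c : bool) (a : R) : set R := [set` Interval (BSide c a) +oo%O].

Lemma measurable_ray c a : measurable (ray c a).
Proof. exact: measurable_itv. Qed.

Lemma ray_unique (c : bool) (m1 m2 : {measure set (measurableTypeR R) -> \bar R}) :
  (forall a : R, m1 (ray c a) = m2 (ray c a)) ->
  (forall a : R, (m1 (ray c a) < +oo)%E) ->
  forall A, measurable A -> m1 A = m2 A.
Proof.
move=> e fin.
pose G : set (set R) := [set A | exists a, A = ray c a].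
have GE : @measurable _ (measurableTypeR R) = <<s G >>.
  rewrite /G /ray; case: c {e fin G} => /=; first exact: RGenCInfty.measurableE.
  exact: RGenOInfty.measurableE.
apply: (@measure_unique _ R (measurableTypeR R) G (fun n : nat => ray c (- n%:R))) => //.
- move=> _ _ [a ->] [a' ->]; exists (Num.max a a').
  apply/seteqP; split => z; rewrite /ray /= !in_itv /= !andbT.
    by case: c {e fin G GE}; rewrite /= ?ge_max ?gt_max => -[-> ->].
  by case: c {e fin G GE}; rewrite /= ?ge_max ?gt_max => /andP[].
- by move=> i; exists (- i%:R).
- apply/seteqP; split => // z _; exists (Num.truncn `|z|).+1 => //.
  rewrite /ray /= in_itv /= andbT.
  have h : - (Num.truncn `|z|).+1%:R < z.
    rewrite ltrNl (le_lt_trans (ler_norm _))// normrN; exact: truncnS_gt.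
  by case: (c) => //=; rewrite ltW.
- by move=> A [a ->].
Qed.

(** Rays form a generating family stable under intersection, so the uniqueness of measures applies
    through [sf_riesz]. Finiteness on the rays, which exhaust the line, replaces finiteness of the
    total mass. *)
Lemma sf_ray_unique (c : bool) (I J : (measurableTypeR R -> \bar R) -> \bar R) :
  sfunctional I -> sfunctional J ->
  (forall a : R, I (fun t => (\1_(ray c a) t)%:E) = J (fun t => (\1_(ray c a) t)%:E)) ->
  (forall a : R, (I (fun t => (\1_(ray c a) t)%:E) < +oo)%E) ->
  forall f, nnm f -> I f = J f.
Proof.
move=> sI sJ e fin f f0.
have [m [mE mI]] := sf_riesz sI; have [m' [mE' mI']] := sf_riesz sJ.
rewrite -(mI _ f0) -(mI' _ f0); apply: eq_measure_integral => A mA _.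
apply: (@ray_unique c) => // a.
- by rewrite mE ?mE' ?e//; exact: measurable_ray.
- by rewrite mE//; exact: measurable_ray.
Qed.

Lemma sf_ray_unique_scale (s : E -> R) (hs : scale s) (c : bool)
    (I J : (E -> \bar R) -> \bar R) :
  sfunctional I -> sfunctional J ->
  (forall a : R, I (fun y => (\1_(ray c a) (s y))%:E) = J (fun y => (\1_(ray c a) (s y))%:E)) ->
  (forall a : R, (I (fun y => (\1_(ray c a) (s y))%:E) < +oo)%E) ->
  forall f, nnm f -> I f = J f.
Proof.
move=> sI sJ e fin f f0.
have ms := continuous_measurable_posreal (sc_cont hs).
have sI' := @sf_precomp _ _ E (measurableTypeR R) R I s sI ms.
have sJ' := @sf_precomp _ _ E (measurableTypeR R) R J s sJ ms.
have fE : f = fun y => (f \o sinv s) (s y).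
  by apply/funext => y /=; rewrite (sinvK (sc_incr hs)).
rewrite fE; apply: (sf_ray_unique sI' sJ' e fin).
have msi := measurable_sinv (sc_incr hs) (sc_cont hs) (sc_lim hs).
by split; [exact: (measurableT_comp f0.1 msi)|move=> z; exact: f0.2].
Qed.

End rays.

Section laplace.
Context (R : realType).
Local Notation leb := (@lebesgue_measure R).
Implicit Types (al t u : R) (w : R -> \bar R).

Definition ew al t : \bar R := ((0 <= t)%R%:R * expR (- (al * t)))%:E.
Definition Lap al w : \bar R := (\int[leb]_t (ew al t * w t))%E.

Lemma nnm_ew al : nnm (ew al).
Proof.
apply: nnm_EFin; last by move=> t; rewrite mulr_ge0// expR_ge0.
apply: measurable_funM; first by apply: measurable_natr; exact: measurable_fun_ler.
by apply: (measurableT_comp (@measurable_expR R)); apply: measurableT_comp => //.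
Qed.

Lemma ew_lt0 al t : t < 0 -> ew al t = 0%E.
Proof. by move=> t0; rewrite /ew leNgt t0 mul0r. Qed.

Lemma ew_ge0 al t : 0 <= t -> ew al t = (expR (- (al * t)))%:E.
Proof. by move=> t0; rewrite /ew t0 mul1r. Qed.

Lemma sf_Lap al : @sfunctional _ (measurableTypeR R) R (Lap al).
Proof. exact: (sf_weight (sf_integral leb) (nnm_ew al)). Qed.

Lemma Lap_ext al w w' : (forall t, 0 <= t -> w t = w' t) -> Lap al w = Lap al w'.
Proof.
move=> ww'; apply: eq_integral => t _.
by have [t0|t0] := leP 0 t; [rewrite ww'|rewrite ew_lt0// !mul0e].
Qed.

Lemma nnm_le_ind u : nnm (fun t : R => (u <= t)%R%:R%:E : \bar R).
Proof. exact: nnm_ler. Qed.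

Lemma Lap_one al : 0 < al -> (al%:E * Lap al (fun=> 1) = 1)%E.
Proof.
move=> al0; rewrite -[RHS](integral_exponential_pdf al0).
rewrite -[LHS](sf_scale (sf_integral leb) (ltW al0)); last first.
  by apply: nnmM; [exact: nnm_ew|apply: nnm_cst; exact: lee01].
apply: eq_integral => t _; rewrite mule1 /exponential_pdf /patch.
have [t0|t0] := leP 0 t.
  by rewrite mem_set/= ?in_itv/= ?t0// ew_ge0// -EFinM mulNr.
by rewrite ew_lt0// mule0 memNset//= in_itv/= andbT; apply/negP; rewrite -ltNge.
Qed.

Lemma Lap_tail al u : 0 < al -> 0 <= u ->
  (al%:E * Lap al (fun t => (u <= t)%R%:R%:E) = ew al u)%E.
Proof.
move=> al0 u0.
have h0 : nnm (fun t : R => (ew al t * (u <= t)%R%:R%:E)%E).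
  by apply: nnmM; [exact: nnm_ew|exact: nnm_le_ind].
rewrite /Lap -(lebesgue_shift u h0).
transitivity (al%:E * \int[leb]_t (ew al u * (ew al t * 1)))%E.
  congr (_ * _)%E; apply: eq_integral => t _.
  rewrite lerDr mule1; have [t0|t0] := leP 0 t; last by rewrite [ew al t]ew_lt0// !mule0.
  by rewrite !ew_ge0// ?addr_ge0// mule1 -EFinM -expRD -opprD -mulrDr addrC.
rewrite (sf_scale (sf_integral leb)); first last.
- by apply: nnmM; [exact: nnm_ew|apply: nnm_cst; exact: lee01].
- by rewrite mulr_ge0// expR_ge0.
by rewrite muleCA Lap_one// mule1.
Qed.

(** Tonelli: for fixed [u] the integral of [ew al t] over [u <= t] is [ew al u / al] by
    [Lap_tail]. *)
Lemma Lap_int al w : 0 < al -> nnm w -> (forall u, u < 0 -> w u = 0%E) ->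
  (al%:E * Lap al (fun t => \int[leb]_u ((u <= t)%R%:R%:E * w u)) = Lap al w)%E.
Proof.
move=> al0 w0 wneg.
have h1 : nnm (fun z : R * R => ((z.2 <= z.1)%R%:R%:E * w z.2)%E).
  by apply: nnmM; [exact: nnm_ler|exact: nnm_comp].
have h2 : nnm (fun z : R * R => (ew al z.1 * ((z.2 <= z.1)%R%:R%:E * w z.2))%E).
  by apply: nnmM => //; apply: (nnm_comp (nnm_ew al)).
rewrite /Lap.
transitivity (al%:E * \int[leb]_t \int[leb]_u (ew al t * ((u <= t)%R%:R%:E * w u)))%E.
  congr (_ * _)%E; apply: eq_integral => t _.
  have e0 : 0 <= (0 <= t)%R%:R * expR (- (al * t)) by rewrite mulr_ge0// expR_ge0.
  have hh : nnm (fun u : R => ((u <= t)%R%:R%:E * w u)%E) by apply: nnmM => //; exact: nnm_ler.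
  by rewrite [RHS](sf_scale (sf_integral leb) e0 hh).
rewrite (tonelli leb leb h2) -[LHS](sf_scale (sf_integral leb) (ltW al0)); last first.
  exact: (nnm_int leb (F := fun u t => (ew al t * ((u <= t)%R%:R%:E * w u))%E)
     (nnm_comp h2 (measurable_fun_pair (@measurable_snd _ _ R R) (@measurable_fst _ _ R R)))).
apply: eq_integral => u _.
have [u0|u0] := leP 0 u; last first.
  rewrite wneg// mule0 integral0_eq ?mule0// => t _.
  by rewrite !mule0.
rewrite -(Lap_tail al0 u0) -muleA; congr (_ * _)%E.
have h3 : nnm (fun t : R => (ew al t * (u <= t)%R%:R%:E)%E).
  by apply: nnmM; [exact: nnm_ew|exact: nnm_le_ind].
rewrite /Lap -ge0_integralZr//; [|exact: h3.1|by move=> t _; exact: h3.2|exact: w0.2].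
by apply: eq_integral => t _; rewrite muleA.
Qed.

(** Transforming the hypothesis gives [(al - b) * Lap al m <= 1] once [Lap al m] is finite. Cutting
    [m] at [T] provides finiteness and keeps the inequality, and then [T] goes to infinity. *)
Lemma Lap_gronwall al b (m : R -> \bar R) : 0 <= b -> b < al -> nnm m ->
  (forall t, t < 0 -> m t = 0%E) ->
  (forall T, exists C : R, forall t, t <= T -> (m t <= C%:E)%E) ->
  (forall t, 0 <= t -> (m t <= 1 + b%:E * \int[leb]_u ((u <= t)%R%:R%:E * m u))%E) ->
  (Lap al m <= ((al - b)^-1)%:E)%E.
Proof.
move=> b0 bal m0 mneg mbnd mle.
have al0 : 0 < al by exact: le_lt_trans b0 bal.
have one0 : nnm (fun _ : R => 1%E : \bar R) by apply: nnm_cst; exact: lee01.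
pose w (T : nat) t := ((t <= T%:R)%R%:R%:E * m t)%E.
have w0 T : nnm (w T) by apply: nnmM => //; exact: nnm_ler.
have wneg T u : u < 0 -> w T u = 0%E by move=> u0; rewrite /w mneg// mule0.
have ndw t : nondecreasing_seq (w^~ t).
  move=> i j ij; rewrite /w lee_wpmul2r ?m0.2// lee_fin ler_nat.
  have [h|//] := leP t i%:R; by rewrite (le_trans h)// ler_nat.
have limw t : limn (w^~ t) = m t.
  apply/cvg_lim => //; apply: cvg_near_cst.
  exists (Num.truncn `|t|).+1 => // n /= hn; rewrite /w.
  suff -> : t <= n%:R by rewrite mul1e.
  rewrite (le_trans (ler_norm _))// (le_trans (ltW (truncnS_gt _)))//.
  by rewrite ler_nat.
rewrite -[X in (Lap al X <= _)%E](_ : (fun t => limn (w^~ t)) = m); last exact/funext.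
rewrite (sf_lim (sf_Lap al))//; apply: limn_le => [i j ij|T].
  by apply: (sf_le (sf_Lap al) (w0 i) (w0 j)) => t; exact: ndw.
have finw : (Lap al (w T) < +oo)%E.
  have [C hC] := mbnd T%:R.
  pose C' := Num.max C 0.
  have C'0 : 0 <= C' by rewrite le_max lexx orbT.
  apply: (@le_lt_trans _ _ (Lap al (fun=> C'%:E * 1)%E)).
    have hC' : nnm (fun _ : R => C'%:E * 1)%E by apply: nnm_cst; rewrite mule1 lee_fin.
    apply: (sf_le (sf_Lap al) (w0 T) hC') => t; rewrite /w mule1; have [h|h] := leP t T%:R; last by rewrite mul0e lee_fin.
    by rewrite mul1e (le_trans (hC t h))// lee_fin le_max lexx.
  rewrite (sf_scale (sf_Lap al))//.
  have h1 : Lap al (fun=> 1%E) \is a fin_num.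
    rewrite ge0_fin_numE ?(sf_ge0 (sf_Lap al))//.
    have := Lap_one al0; case: (Lap al _) => [r _||_ //]; first exact: ltry.
    by rewrite gt0_muley ?lte_fin.
  by rewrite lte_mul_pinfty// ?lee_fin// -ge0_fin_numE// (sf_ge0 (sf_Lap al)).
have hw : (al%:E * Lap al (w T) <= 1 + b%:E * Lap al (w T))%E.
  have hi : nnm (fun t : R => (\int[leb]_u ((u <= t)%R%:R%:E * w T u))%E).
    apply: (@nnm_int _ _ _ _ _ leb (fun t u => ((u <= t)%R%:R%:E * w T u)%E)).
    by apply: nnmM; [exact: nnm_ler|exact: (nnm_comp (w0 T))].
  have hb : nnm (fun t : R => (b%:E * \int[leb]_u ((u <= t)%R%:R%:E * w T u))%E).
    by apply: nnmM => //; apply: nnm_cst; rewrite lee_fin.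
  rewrite -{2}(Lap_int al0 (w0 T) (wneg T)) -{1}(Lap_one al0) muleCA -ge0_muleDr; first last.
  - by rewrite mule_ge0 ?lee_fin// (sf_ge0 (sf_Lap al)).
  - exact: (sf_ge0 (sf_Lap al)).
  rewrite lee_wpmul2l ?lee_fin ?(ltW al0)// -(sf_scale (sf_Lap al) b0 hi) -(sf_add (sf_Lap al) one0 hb).
  apply: (sf_le (sf_Lap al) (w0 T) (nnmD one0 hb)) => t; have [t0|t0] := leP 0 t; last by rewrite wneg// (nnmD one0 hb).2.
  rewrite {1}/w; have [h|h] := leP t T%:R; last by rewrite mul0e (nnmD one0 hb).2.
  rewrite mul1e (le_trans (mle t t0))// leeD2l// lee_wpmul2l ?lee_fin//.
  rewrite le_eqVlt; apply/orP; left; apply/eqP; apply: eq_integral => u _.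
  rewrite /w; have [ut|ut] := leP u t; last by rewrite !mul0e.
  by rewrite (le_trans ut h) !mul1e.
have fw : Lap al (w T) \is a fin_num by rewrite ge0_fin_numE ?(sf_ge0 (sf_Lap al) (w0 T)).
move: hw; rewrite -(fineK fw) -!EFinM -EFinD !lee_fin => hw.
have d0 : 0 < al - b by rewrite subr_gt0.
by rewrite -[leRHS]mul1r ler_pdivlMr// mulrBr; lra.
Qed.

(* The kernels of the Laplace inversion: they converge to the indicator of
   [t > tau] and are linear combinations of exponentials. *)
Lemma step_kernel (t tau : R) (j : nat) : 0 <= t -> 0 <= tau ->
  `|(1 - expR (- (j%:R * t))) ^+ Num.truncn (expR (j%:R * tau)) - (tau < t)%R%:R|
    <= expR (- (j%:R * `|t - tau|)).
Proof.
(* The power behaves like [exp (- exp (- j (t - tau)))], whose transition from 0 to 1 is at [tau].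
   Above [tau] Bernoulli's inequality is used, below it [1 - y <= exp (- y)]. *)
move=> t0 tau0; set n := Num.truncn _.
have jt0 : 0 <= j%:R * t by rewrite mulr_ge0.
have e0 := expR_ge0 (- (j%:R * t)).
have e1 : expR (- (j%:R * t)) <= 1 by rewrite expR_le1 oppr_le0.
have p0 : 0 <= 1 - expR (- (j%:R * t)) by rewrite subr_ge0.
have p1 : 1 - expR (- (j%:R * t)) <= 1 by lra.
have [tt|tt] := ltP tau t.
  have -> : true%:R = 1 :> R by [].
  rewrite distrC ger0_norm ?subr_ge0 ?exprn_ile1//.
  have bern : 1 - n%:R * expR (- (j%:R * t)) <= (1 - expR (- (j%:R * t))) ^+ n.
    elim: n => [|n ih]; first by rewrite mul0r subr0.
    rewrite exprS (le_trans _ (ler_wpM2l p0 ih))// -natr1 -subr_ge0.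
    set e := expR _; rewrite (_ : _ - _ = n%:R * (e * e)); last by ring.
    by rewrite mulr_ge0// mulr_ge0.
  have nle : n%:R <= expR (j%:R * tau) by rewrite truncn_le// expR_ge0.
  rewrite (@le_trans _ _ (n%:R * expR (- (j%:R * t))))//; first by lra.
  have dt : 0 <= t - tau by rewrite subr_ge0 ltW.
  by rewrite (le_trans (ler_wpM2r e0 nle))// -expRD (ger0_norm dt) mulrBr opprB.
rewrite subr0 ger0_norm ?exprn_ge0//.
have h1 : 1 - expR (- (j%:R * t)) <= expR (- expR (- (j%:R * t))).
  exact: expR_ge1Dx.
rewrite (le_trans (lerXn2r n p0 (expR_ge0 _) h1))// -expRM_natl ler_expR.
rewrite mulrN lerN2 distrC ger0_norm ?subr_ge0//.
(* The 1 lost in the truncation is recovered at the end from [1 + y <= exp y], because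
   [exp (- j t) <= 1]. *)
have nge : expR (j%:R * tau) - 1 <= n%:R.
  by rewrite lerBlDr natr1 ltW// truncnS_gt.
rewrite (le_trans _ (ler_wpM2r e0 nge))// mulrBl -expRD mul1r -mulrBr.
have h2 := expR_ge1Dx (j%:R * (tau - t)).
by lra.
Qed.

Lemma cvg_expRN_nat (d : R) : 0 < d -> expR (- (n%:R * d)) @[n --> \oo] --> (0 : R).
Proof.
move=> d0; have h : n%:R * d @[n --> \oo] --> +oo.
  apply/cvgryPge => A; exists (Num.truncn `|A / d|).+1 => // n /= hn.
  rewrite -ler_pdivrMr// (le_trans (ler_norm _))// (le_trans (ltW (truncnS_gt _)))//.
  by rewrite ler_nat.
exact: (cvg_comp _ _ h (@cvgr_expR R)).
Qed.

(** A factor [expR (- (j%:R * t))] shifts the Laplace parameter by [j], so the transform of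
    [p ^+ n.+1 * a] at [al] is the difference of those of [p ^+ n * a] at [al] and at [al + j]. They
    are finite, which permits the subtraction. *)
Lemma Lap_step al0 (a a' : R -> R) : 0 <= al0 -> measurable_fun setT a ->
  measurable_fun setT a' -> (forall t, 0 <= a t) -> (forall t, 0 <= a' t) ->
  (forall al, al0 < al -> Lap al (EFin \o a) = Lap al (EFin \o a')) ->
  (forall al, al0 < al -> (Lap al (EFin \o a) < +oo)%E) ->
  forall (j n : nat) al, al0 < al ->
    Lap al (fun t => ((1 - expR (- (j%:R * `|t|))) ^+ n * a t)%:E) =
    Lap al (fun t => ((1 - expR (- (j%:R * `|t|))) ^+ n * a' t)%:E).
Proof.
move=> al00 ma ma' a0 a'0 e fin j n al al1.
(* The absolute value keeps [p] in [[0, 1]] at negative times, which the transform does not see. *)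
pose p t : R := 1 - expR (- (j%:R * `|t|)).
have p0 t : 0 <= p t by rewrite subr_ge0 expR_le1 oppr_le0 mulr_ge0.
have p1 t : p t <= 1 by rewrite gerBl expR_ge0.
have mp : measurable_fun setT p.
  apply: measurable_funB => //; apply: (measurableT_comp (@measurable_expR R)).
  by apply: measurableT_comp => //; apply: measurable_funM.
have hn k (c : R -> R) : measurable_fun setT c -> (forall t, 0 <= c t) ->
    nnm (fun t => (p t ^+ k * c t)%:E).
  move=> mc c0; apply: nnm_EFin; last by move=> t; rewrite mulr_ge0// exprn_ge0.
  by apply: measurable_funM => //; exact: measurable_funX.
have key k (c : R -> R) be : measurable_fun setT c -> (forall t, 0 <= c t) ->
    (Lap be (fun t => (p t ^+ k.+1 * c t)%:E) + Lap (be + j%:R) (fun t => (p t ^+ k * c t)%:E)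
     = Lap be (fun t => (p t ^+ k * c t)%:E))%E.
  move=> mc c0; rewrite /Lap -(sf_add (sf_integral leb)); first last.
  - by apply: nnmM; [exact: nnm_ew|exact: hn].
  - by apply: nnmM; [exact: nnm_ew|exact: hn].
  apply: eq_integral => t _; have [t0|t0] := leP 0 t; last by rewrite !ew_lt0// !mul0e adde0.
  rewrite !ew_ge0// -!EFinM -EFinD mulrDl opprD expRD.
  have -> : expR (- (j%:R * t)) = 1 - p t by rewrite /p ger0_norm//; ring.
  by congr EFin; rewrite exprS; ring.
have kfin k be : al0 < be -> (Lap be (fun t => (p t ^+ k * a t)%:E) < +oo)%E.
  move=> be1; apply: le_lt_trans (fin be be1).
  apply: (sf_le (sf_Lap be)) => [||t]; [exact: hn|exact: nnm_EFin|].
  by rewrite lee_fin ler_piMl// exprn_ile1.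
elim: n al al1 => [|n ih] al al1.
  have := e al al1; congr (_ = _); apply: Lap_ext => t _; by rewrite /= mul1r.
have h1 := key n a al ma a0; have h2 := key n a' al ma' a'0.
have al2 : al0 < al + j%:R by rewrite (lt_le_trans al1)// lerDl.
have e1 := ih _ al1; have e2 := ih _ al2; rewrite -!/(p _) in e1 e2.
have f2 : Lap (al + j%:R) (fun t => (p t ^+ n * a t)%:E) \is a fin_num.
  by rewrite ge0_fin_numE ?kfin// (sf_ge0 (sf_Lap _))//; exact: hn.
move: h1; rewrite e1 -h2 -e2 => h1.
by have := congr1 (fun z => z - Lap (al + j%:R) (fun t => (p t ^+ n * a t)%:E))%E h1; rewrite !addeK.
Qed.

(** By dominated convergence along the step kernels, the measures with densities [ew al * a] and
    [ew al * a'] agree on every ray [t > tau], so they are equal. *)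
Lemma Lap_inj al0 (a a' : R -> R) : 0 <= al0 -> measurable_fun setT a ->
  measurable_fun setT a' -> (forall t, 0 <= a t) -> (forall t, 0 <= a' t) ->
  (forall t, t < 0 -> a t = 0) -> (forall t, t < 0 -> a' t = 0) ->
  (forall al, al0 < al -> Lap al (EFin \o a) = Lap al (EFin \o a')) ->
  (forall al, al0 < al -> (Lap al (EFin \o a) < +oo)%E) ->
  forall T, (\int[leb]_u ((u <= T)%R%:R%:E * (a u)%:E) =
             \int[leb]_u ((u <= T)%R%:R%:E * (a' u)%:E))%E.
Proof.
move=> al00 ma ma' a0 a'0 an a'n e fin T.
pose al := al0 + 1.
have al1 : al0 < al by rewrite ltrDl.
have hna : nnm (EFin \o a) by exact: nnm_EFin.
have hna' : nnm (EFin \o a') by exact: nnm_EFin.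
pose I (c : R -> R) (f : R -> \bar R) := Lap al (fun t => (c t)%:E * f t)%E.
have sI c : nnm (EFin \o c) -> @sfunctional _ (measurableTypeR R) R (I c).
  by move=> hc; exact: (sf_weight (sf_Lap al) hc).
have lim (c : R -> R) (tau : R) : 0 <= tau -> measurable_fun setT c -> (forall t, 0 <= c t) ->
    (Lap al (EFin \o c) < +oo)%E ->
    Lap al (fun t => ((1 - expR (- (j%:R * `|t|))) ^+ Num.truncn (expR (j%:R * tau)) * c t)%:E)
      @[j --> \oo] --> I c (fun t => (\1_(ray false tau) t)%:E).
  move=> tau0 mc c0 finc; rewrite /I /Lap.
  have hc : nnm (EFin \o c) by exact: nnm_EFin.
  have hec : nnm (fun t => ew al t * (EFin \o c) t)%E by apply: nnmM => //; exact: nnm_ew.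
  pose f_ j t := (ew al t * ((1 - expR (- (j%:R * `|t|))) ^+ Num.truncn (expR (j%:R * tau)) * c t)%:E)%E.
  have hf_ j : nnm (f_ j).
    apply: nnmM; first exact: nnm_ew.
    apply: nnm_EFin; last first.
      move=> t; rewrite mulr_ge0// exprn_ge0// subr_ge0 expR_le1 oppr_le0 mulr_ge0//.
    apply: measurable_funM => //; apply: measurable_funX; apply: measurable_funB => //.
    apply: (measurableT_comp (@measurable_expR R)).
    by apply: measurableT_comp => //; apply: measurable_funM.
  have hf : nnm (fun t => ew al t * ((c t)%:E * (\1_(ray false tau) t)%:E))%E.
    apply: nnmM; first exact: nnm_ew.
    by apply: nnmM => //; apply: nnm_indic; exact: measurable_ray.
  have [] := @dominated_convergence _ _ R leb setT measurableT f_ _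
    (fun t => ew al t * (EFin \o c) t)%E (fun j => (hf_ j).1) hf.1 => //.
  - exists [set tau]; split => //; first exact: lebesgue_measure_set1.
    move=> t /= ht; apply: contrapT => tt; apply: ht => _.
    have [t0|t0] := leP 0 t; last first.
      by rewrite /f_ ew_lt0// mul0e; under eq_fun do rewrite mul0e; exact: cvg_cst.
    rewrite /f_ ew_ge0// -!EFinM; apply: cvg_EFin.
      by apply: nearW => j; rewrite -EFinM.
    rewrite (_ : fine \o _ = fun j : nat => expR (- (al * t)) * ((1 - expR (- (j%:R * `|t|))) ^+ Num.truncn (expR (j%:R * tau)) * c t))//.
    apply: cvgMr; rewrite [X in _ --> X]mulrC; apply: cvgMl.
    rewrite (_ : \1_(ray false tau) t = (tau < t)%R%:R); last first.
      rewrite indicE /ray; congr (_%:R); congr nat_of_bool.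
      by apply/idP/idP => [/set_mem/=|h]; rewrite ?in_itv/= ?andbT//; apply/mem_set; rewrite /= in_itv/= h.
    rewrite ger0_norm//; apply/cvgrPdistC_le => eps eps0.
    have d0 : 0 < `|t - tau| by rewrite normr_gt0 subr_eq0; apply/eqP.
    have /cvgr_dist_le/(_ _ eps0) := cvg_expRN_nat d0.
    apply: filterS => j; rewrite sub0r normrN ger0_norm ?expR_ge0//.
    exact: le_trans (step_kernel j t0 tau0).
  - apply/integrableP; split; first exact: hec.1.
    apply: le_lt_trans finc; rewrite le_eqVlt; apply/orP; left; apply/eqP.
    by apply: eq_integral => t _; rewrite gee0_abs//; exact: hec.2.
  - apply: nearW => t j _; rewrite gee0_abs; last exact: (hf_ j).2.
    apply: lee_wpmul2l; first exact: (nnm_ew al).2.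
    have q0 : 0 <= 1 - expR (- (j%:R * `|t|)) by rewrite subr_ge0 expR_le1 oppr_le0 mulr_ge0.
    have q1 : 1 - expR (- (j%:R * `|t|)) <= 1 by rewrite gerBl expR_ge0.
    by rewrite lee_fin; apply: ler_piMl => //; exact: exprn_ile1.
have one c : I c (fun=> 1%E) = Lap al (EFin \o c).
  by apply: Lap_ext => t _; rewrite mule1.
have raye tau : I a (fun t => (\1_(ray false tau) t)%:E) = I a' (fun t => (\1_(ray false tau) t)%:E).
  have [tau0|tau0] := leP 0 tau; last first.
    have h c : I c (fun t => (\1_(ray false tau) t)%:E) = Lap al (EFin \o c).
      apply: Lap_ext => t t0; rewrite indicE mem_set ?mule1//.
      by rewrite /ray /= in_itv /= andbT (lt_le_trans tau0).
    by rewrite !h e.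
  have l1 := lim a tau tau0 ma a0 (fin al al1).
  have finc' : (Lap al (EFin \o a') < +oo)%E by rewrite -e// fin.
  have l2 := lim a' tau tau0 ma' a'0 finc'.
  pose A (c : R -> R) (j : nat) := Lap al (fun t => ((1 - expR (- (j%:R * `|t|))) ^+ Num.truncn (expR (j%:R * tau)) * c t)%:E).
  have ee : A a = A a' by apply/funext => j; exact: (@Lap_step al0).
  rewrite -/(A a) ee in l1.
  exact: (cvg_unique (@ereal_hausdorff R) l1 l2).
have rayf tau : (I a (fun t => (\1_(ray false tau) t)%:E) < +oo)%E.
  apply: le_lt_trans (fin al al1); rewrite -one; apply: (sf_le (sI a hna)).
  - by apply: nnm_indic; exact: measurable_ray.
  - by apply: nnm_cst; exact: lee01.
  - by move=> t; rewrite lee_fin indicE lern1 leq_b1.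
(* Integrating this [f] removes the weight [ew al] and cuts at [T]. *)
pose f t : \bar R := ((t <= T)%R%:R * expR (al * t))%:E.
have hf : nnm f.
  apply: nnm_EFin; last by move=> t; rewrite mulr_ge0// expR_ge0.
  apply: measurable_funM; first by apply: measurable_natr; exact: measurable_fun_ler.
  by apply: (measurableT_comp (@measurable_expR R)); exact: measurable_funM.
have If c : (forall t, t < 0 -> c t = 0) ->
    I c f = (\int[leb]_u ((u <= T)%R%:R%:E * (c u)%:E))%E.
  move=> cn; apply: eq_integral => t _; have [t0|t0] := leP 0 t; last first.
    by rewrite cn// mul0e !mule0.
  rewrite ew_ge0// /f -!EFinM; congr EFin.
  have e1 : expR (- (al * t)) * expR (al * t) = 1 by rewrite -expRD addNr expR0.
  by rewrite -[RHS]mulr1 -e1; ring.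
by rewrite -!If//; exact: (sf_ray_unique (sI a hna) (sI a' hna') raye rayf hf).
Qed.

End laplace.

(** * Test functions *)

Section right_derivatives.
Context (R : realType).
Implicit Types F G : R -> R.

Lemma rderive_affine F x l d : 0 < d -> (forall e, 0 < e < d -> F (x + e) = F x + l * e) ->
  rderive_at F x l.
Proof.
move=> d0 h; apply: cvg_near_cst; near=> e.
have e0 : 0 < e by near: e; exact: nbhs_right_gt.
rewrite h; last by rewrite e0; near: e; exact: nbhs_right_lt.
by rewrite addrAC subrr add0r mulfK// gt_eqF.
Unshelve. all: by end_near. Qed.

Lemma cvg_id_right : (fun e : R => e) e @[e --> 0^'+] --> (0 : R).
Proof. by apply: cvg_at_right_filter; exact: cvg_id. Qed.

Lemma rderive_at_cvg F x l : rderive_at F x l -> F (x + e) @[e --> 0^'+] --> F x.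
Proof.
move=> h; have h1 : F x + e * ((F (x + e) - F x) / e) @[e --> 0^'+] --> F x + 0 * l.
  by apply: cvgD; [exact: cvg_cst|apply: cvgM => //; exact: cvg_id_right].
rewrite mul0r addr0 in h1; apply: cvg_trans h1; apply: near_eq_cvg; near=> e.
have e0 : e != 0 by rewrite gt_eqF//; near: e; exact: nbhs_right_gt.
by rewrite /= mulrC divfK// addrC subrK.
Unshelve. all: by end_near. Qed.

Lemma rderive_at_mul F G x l m : rderive_at F x l -> rderive_at G x m ->
  rderive_at (fun z => F z * G z) x (l * G x + F x * m).
Proof.
move=> hF hG.
have h1 : (F (x + e) - F x) / e * G (x + e) + F x * ((G (x + e) - G x) / e) @[e --> 0^'+]
    --> l * G x + F x * m.
  apply: cvgD; first by apply: cvgM => //; exact: rderive_at_cvg hG.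
  by apply: cvgM => //; exact: cvg_cst.
apply: cvg_trans h1; apply: near_eq_cvg; near=> e => /=.
by rewrite -!mulrA [e^-1 * _]mulrC !mulrA -mulrDl; congr (_ / _); ring.
Unshelve. all: by end_near. Qed.

Lemma rderive_at_inv F x l : (forall z, 0 < F z) -> rderive_at F x l ->
  rderive_at (fun z => (F z)^-1) x (- l / (F x * F x)).
Proof.
move=> F0 hF; have Fx : F x != 0 by rewrite gt_eqF.
have h0 : (F (x + e))^-1 @[e --> 0^'+] --> (F x)^-1 by apply: cvgV => //; exact: rderive_at_cvg hF.
have h1 : - (F x)^-1 * ((F (x + e) - F x) / e * (F (x + e))^-1) @[e --> 0^'+]
    --> - (F x)^-1 * (l * (F x)^-1).
  by apply: cvgM; [exact: cvg_cst|exact: cvgM].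
have -> : - l / (F x * F x) = - (F x)^-1 * (l * (F x)^-1) by rewrite invfM; ring.
apply: cvg_trans h1; apply: near_eq_cvg; near=> e => /=.
have e0 : e != 0 by rewrite gt_eqF//; near: e; exact: nbhs_right_gt.
have Fe : F (x + e) != 0 by rewrite gt_eqF.
by field; rewrite ?e0 ?Fe ?Fx.
Unshelve. all: by end_near. Qed.

(** A ramp from 0 at [A] to 1 at [A + n^-1]; [chi'] is its right derivative. *)
Definition chi (n A z : R) : R := Num.min 1 (Num.max 0 (n * (z - A))).
Definition chi' (n A z : R) : R := if A <= z < A + n^-1 then n else 0.
(** The length of the part of [[B, C)] above [z], that is [VF] in the coordinate [s]; see
    [Vz_itv]. *)
Definition cap (B C z : R) : R := Num.max 0 (C - Num.max z B).

Lemma chi_ge0 n A z : 0 <= chi n A z.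
Proof. by rewrite /chi le_min ler01 le_max lexx. Qed.

Lemma chi_le1 n A z : chi n A z <= 1.
Proof. by rewrite /chi ge_min lexx. Qed.

Lemma chi_eq0 n A z : 0 <= n -> z <= A -> chi n A z = 0.
Proof.
move=> n0 zA; have h : n * (z - A) <= 0 by rewrite mulr_ge0_le0// subr_le0.
by rewrite /chi (max_idPl h) (min_idPr ler01).
Qed.

Lemma chi_eq1 n A z : 0 < n -> A + n^-1 <= z -> chi n A z = 1.
Proof.
move=> n0 zA; have h : 1 <= n * (z - A).
  by rewrite mulrC -ler_pdivrMr// mul1r; lra.
by rewrite /chi; apply/min_idPl; rewrite le_max h orbT.
Qed.

Lemma chi_mid n A z : 0 < n -> A <= z <= A + n^-1 -> chi n A z = n * (z - A).
Proof.
move=> n0 /andP[Az zA]; have h : n * (z - A) <= 1.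
  by rewrite mulrC -ler_pdivlMr// mul1r; lra.
have h0 : 0 <= n * (z - A) by rewrite mulr_ge0 ?subr_ge0// ltW.
by rewrite /chi (max_idPr h0) (min_idPr h).
Qed.

Lemma rderive_chi n A z : 0 < n -> rderive_at (chi n A) z (chi' n A z).
Proof.
move=> n0; rewrite /chi'; have ni : 0 < n^-1 by rewrite invr_gt0.
have [Az|zA] /= := leP A z; last first.
  apply: (@rderive_affine _ _ _ (A - z)); rewrite ?subr_gt0// => e /andP[e0 eA].
  by rewrite !chi_eq0 ?(ltW n0) ?(ltW zA)//; lra.
have [zA|Az'] := ltP z (A + n^-1).
  apply: (@rderive_affine _ _ _ (A + n^-1 - z)); rewrite ?subr_gt0// => e /andP[e0 eA].
  by rewrite !chi_mid//; [ring|rewrite Az ltW|lra].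
apply: (@rderive_affine _ _ _ 1) => // e /andP[e0 eA].
by rewrite !chi_eq1//; lra.
Qed.

Lemma cap_ge0 B C z : 0 <= cap B C z.
Proof. by rewrite /cap le_max lexx. Qed.

Lemma cap_le B C z : cap B C z <= `|C - B|.
Proof.
rewrite /cap ge_max normr_ge0/= (le_trans _ (ler_norm _))// lerD2l lerN2.
by rewrite le_max lexx orbT.
Qed.

Lemma cap_eq0 B C z : C <= z -> cap B C z = 0.
Proof. by move=> Cz; apply/max_idPl; rewrite subr_le0 le_max Cz. Qed.

Lemma rderive_cap B C z : rderive_at (cap B C) z (- (B <= z < C)%R%:R).
Proof.
have [Bz|zB] /= := leP B z; last first.
  apply: (@rderive_affine _ _ _ (B - z)); rewrite ?subr_gt0// => e /andP[e0 eA].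
  rewrite oppr0 mul0r addr0 /cap (max_idPr (ltW zB)) (_ : Num.max _ B = B)//.
  by apply/max_idPr; lra.
have [zC|Cz] /= := ltP z C.
  apply: (@rderive_affine _ _ _ (C - z)); rewrite ?subr_gt0// => e /andP[e0 eA].
  have h1 : B <= z + e by lra.
  rewrite /cap (max_idPl Bz) (max_idPl h1).
  have h2 : 0 <= C - z by lra.
  have h3 : 0 <= C - (z + e) by lra.
  by rewrite (max_idPr h2) (max_idPr h3); ring.
apply: (@rderive_affine _ _ _ 1) => // e /andP[e0 eA].
by rewrite !cap_eq0//; [ring|lra].
Qed.

End right_derivatives.

Section tests.
Context (R : realType).
Local Notation E := (posreal R).
Context (s : E -> R).
Hypothesis hs : scale s.
Local Notation phi := (phi s).

Lemma sderive_rderive (p : R -> R) (l : R) y : rderive_at p (s y) l ->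
  sderivable s (p \o s) y /\ sderive s (p \o s) y = l.
Proof.
move=> h; apply: (sderiveE (sc_incr hs) (sc_cont hs) (sc_lim hs)).
apply: cvg_trans h; apply: near_eq_cvg; near=> e => /=.
have e0 : 0 <= e by rewrite ltW//; near: e; exact: nbhs_right_gt.
by rewrite (s_phi (sc_incr hs) (sc_cont hs) (sc_lim hs)).
Unshelve. all: by end_near. Qed.

Lemma rderive_phi0 (f : E -> R) y : sderivable s f y ->
  rderive_at (fun u => f (phi u y)) 0 (sderive s f y).
Proof.
move=> /(sderive_cvg (sc_incr hs) (sc_cont hs) (sc_lim hs)); rewrite /rderive_at.
under [X in _ -> X @ _ --> _]eq_fun do rewrite add0r.
by rewrite (phi0 (sc_incr hs)).
Qed.

Lemma sderive_phi0 (f : E -> R) y l : rderive_at (fun u => f (phi u y)) 0 l ->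
  sderivable s f y /\ sderive s f y = l.
Proof.
move=> h; apply: (sderiveE (sc_incr hs) (sc_cont hs) (sc_lim hs)); move: h; rewrite /rderive_at.
under [X in X @ _ --> _ -> _]eq_fun do rewrite add0r.
by rewrite (phi0 (sc_incr hs)).
Qed.

Lemma sderive_mul (f g : E -> R) y : sderivable s f y -> sderivable s g y ->
  sderivable s (fun y => f y * g y) y /\
  sderive s (fun y => f y * g y) y = sderive s f y * g y + f y * sderive s g y.
Proof.
move=> hf hg; apply: sderive_phi0.
by have := rderive_at_mul (rderive_phi0 hf) (rderive_phi0 hg); rewrite (phi0 (sc_incr hs)).
Qed.

Lemma sderive_inv (f : E -> R) y : (forall y, 0 < f y) -> sderivable s f y ->
  sderivable s (fun y => (f y)^-1) y /\
  sderive s (fun y => (f y)^-1) y = - sderive s f y / (f y * f y).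
Proof.
move=> f0 hf; apply: sderive_phi0.
have := rderive_at_inv (fun u => f0 (phi u y)) (rderive_phi0 hf).
by rewrite (phi0 (sc_incr hs)).
Qed.

Lemma locally_bounded_continuous (f : E -> R) : continuous f -> locally_bounded f.
Proof.
move=> cf; apply: locally_bounded_of => a b a0.
have [M hM] := compact_bounded_fun cf (compact_posreal_itv (b := b) a0).
by exists M => y hy; exact: hM.
Qed.

Lemma Cs_loc_inv (f : E -> R) : (forall y, 0 < f y) -> Cs_loc s f ->
  Cs_loc s (fun y => (f y)^-1).
Proof.
move=> f0 [[cf df] lf].
have ci : continuous (fun y => (f y)^-1).
  by move=> y; apply: continuousV; [rewrite gt_eqF|exact: cf].
split; first by split => // y; have [] := sderive_inv f0 (df y).
apply: locally_bounded_of => a b a0.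
have [M hM] := locally_boundedP b lf a0.
have [M' hM'] := locally_boundedP b (locally_bounded_continuous ci) a0.
exists (M * (M' * M')) => y hy; have [_ ->] := sderive_inv f0 (df y).
rewrite invfM normrM normrN normrM.
by apply: ler_pM; rewrite ?mulr_ge0 ?hM//; apply: ler_pM; rewrite ?hM'.
Qed.

(** Off the support [g] vanishes in a neighbourhood, which the flow does not leave at once. *)
Lemma sderive_eq0 (g : E -> R) y : ~ closure [set y | g y != 0] y -> sderive s g y = 0.
Proof.
move=> hy; apply: (sderive_phi0 _).2; apply: cvg_near_cst.
have op : open (~` closure [set y | g y != 0]) by apply/closed_openC; exact: closed_closure.
have nb : nbhs y (~` closure [set y | g y != 0]) by apply: open_nbhs_nbhs.
have := phi_continuous (sc_incr hs) (sc_cont hs) (sc_lim hs) (x := y) (lexx 0).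
rewrite (phi0 (sc_incr hs)) => /(_ _ nb) nb'.
have g0 z : ~ closure [set y | g y != 0] z -> g z = 0.
  by move=> hz; apply/eqP; apply: contra_notT hz => gz; exact: subset_closure.
have := @cvg_id_right R _ nb'; apply: filterS => e he.
by rewrite add0r (g0 _ he) (g0 _ hy) subrr mul0r.
Qed.

Lemma Cs_c_mul (f g : E -> R) : Cs_loc s f -> Cs_c s g -> Cs_c s (fun y => f y * g y).
Proof.
move=> [[cf df] lf] [[cg dg] cK [M [_ hM]]].
have df' y := sderive_mul (df y) (dg y).
have sub : closure [set y | f y * g y != 0] `<=` closure [set y | g y != 0].
  apply: closure_subset => y /=; apply: contra_neq => ->; exact: mulr0.
split.
- split; last by move=> y; have [] := df' y.
  by move=> y; apply: continuousM; [exact: cf|exact: cg].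
- exact: (subclosed_compact (@closed_closure _ _) cK sub).
- have [a [b [a0 ab]]] := compact_posreal_sub cK.
  have [M1 h1] := locally_boundedP b lf a0.
  have [M2 h2] := locally_boundedP b (locally_bounded_continuous cf) a0.
  have [M3 h3] := locally_boundedP b (locally_bounded_continuous cg) a0.
  have hM1 y : `|sderive s g y| <= `|M| + 1.
    by apply: hM => //; rewrite (le_lt_trans (ler_norm _))// ltrDl.
  exists (`|M1| * `|M3| + `|M2| * (`|M| + 1)); split; first exact: num_real.
  move=> T MT y _; apply: le_trans (ltW MT).
  have [hy|hy] := pselect (closure [set y | g y != 0] y).
    have [_ ->] := df' y; rewrite (le_trans (ler_normD _ _))// !normrM lerD// ler_pM//.
    + exact: le_trans (h1 y (ab _ hy)) (ler_norm _).
    + exact: le_trans (h3 y (ab _ hy)) (ler_norm _).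
    + exact: le_trans (h2 y (ab _ hy)) (ler_norm _).
  rewrite sderive_eq0; last by move/sub.
  by rewrite normr0 addr_ge0// mulr_ge0// addr_ge0.
Qed.

(** [chi] cuts below the level [s a] and [cap] above [C]; the support is compact because [s] reaches
    every level above [s a]. *)
Definition tst (n : R) (a : E) (B C : R) (y : E) : R := chi n (s a) (s y) * cap B C (s y).
Definition tst' (n : R) (a : E) (B C : R) (y : E) : R :=
  chi' n (s a) (s y) * cap B C (s y) - chi n (s a) (s y) * (B <= s y < C)%R%:R.

Lemma tst_sderive n a B C y : 0 < n ->
  sderivable s (tst n a B C) y /\ sderive s (tst n a B C) y = tst' n a B C y.
Proof.
move=> n0; have := sderive_rderive (rderive_at_mul (@rderive_chi _ n (s a) (s y) n0) (@rderive_cap _ B C (s y))).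
by rewrite /tst' mulrN.
Qed.

Lemma tst_ge0 n a B C y : 0 <= tst n a B C y.
Proof. by rewrite mulr_ge0 ?chi_ge0 ?cap_ge0. Qed.

Lemma tst_le n a B C y : `|tst n a B C y| <= `|C - B|.
Proof.
rewrite ger0_norm ?tst_ge0// (le_trans _ (cap_le B C (s y)))// ler_piMl ?cap_ge0//.
exact: chi_le1.
Qed.

Lemma tst'_le n a B C y : 0 < n -> `|tst' n a B C y| <= n * `|C - B| + 1.
Proof.
move=> n0; rewrite (le_trans (ler_normB _ _))// !normrM lerD//.
  rewrite ler_pM//; last by rewrite ger0_norm ?cap_ge0// cap_le.
  by rewrite /chi'; case: ifP => _; rewrite ?normr0 ?(ltW n0)// gtr0_norm.
rewrite (ger0_norm (chi_ge0 _ _ _)) -[leRHS]mulr1 ler_pM ?chi_ge0 ?chi_le1//.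
by rewrite ger0_norm ?lern1 ?leq_b1.
Qed.

Lemma tst_continuous n a B C : continuous (tst n a B C).
Proof.
have -> : tst n a B C = (cst 1 \min (cst 0 \max (fun y : E => n * (s y - s a)))) \*
    (cst 0 \max (fun y : E => C - (s \max cst B) y)) by [].
have cs := sc_cont hs; move=> y; apply: continuousM.
  apply: continuous_min; first exact: cst_continuous.
  apply: continuous_max; first exact: cst_continuous.
  exact: (cvgM (cvg_cst n) (cvgB (cs y) (cvg_cst (s a)))).
apply: continuous_max; first exact: cst_continuous.
have cm : {for y, continuous (s \max cst B)}.
  by apply: continuous_max; [exact: cs|exact: cst_continuous].
exact: (cvgB (cvg_cst C) cm).
Qed.

Lemma tst_Cs_c n a B C : 0 < n -> Cs_c s (tst n a B C).
Proof.
move=> n0; split.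
- split; first exact: tst_continuous.
  by move=> y; have [] := tst_sderive a B C y n0.
- pose c := Num.max C (s a).
  have [c0 sc] : exists c0, s c0 = c.
    by apply: (s_surj (sc_cont hs) (sc_lim hs) (x := a)); rewrite le_max lexx orbT.
  have cl : closed [set y : E | val a <= val y <= val c0].
    have -> : [set y : E | val a <= val y <= val c0] = val @^-1` `[val a, val c0].
      by apply/seteqP; split => y; rewrite /= in_itv.
    by move/continuous_closedP: (@pval_continuous R); apply; exact: interval_closed.
  apply: (subclosed_compact (@closed_closure _ _) (compact_posreal_itv (b := val c0) (val_gt0 a))).
  rewrite [X in _ `<=` X](closure_id _).1//; apply: closure_subset => y /=.
  rewrite /tst mulf_eq0 negb_or => /andP[h1 h2]; apply/andP; split.
    rewrite -(s_le (sc_incr hs)); apply: contraNT h1; rewrite -ltNge => /ltW h.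
    by rewrite chi_eq0// ltW.
  rewrite -(s_le (sc_incr hs)) sc le_max; apply/orP; left.
  by apply: contraNT h2; rewrite -ltNge => /ltW h; rewrite cap_eq0.
- exists (n * `|C - B| + 1); split; first exact: num_real.
  move=> M hM y _ /=; have [_ ->] := tst_sderive a B C y n0.
  exact: le_trans (tst'_le a B C y n0) (ltW hM).
Qed.

(** A trapezoid in the coordinate [s], for large [k]: it rises from [s a] with slope [k + 1], stays
    at 1 up to [k + 1] and falls to 0 at [2 (k + 1)]. It increases to the indicator of an open ray,
    which carries statements from test functions to measures. *)
Definition trap (a : E) (k : nat) (y : E) : R := k.+1%:R^-1 * tst k.+1%:R a k.+1%:R (k.+1%:R * 2) y.

Lemma trapE a k y : trap a k y =
  chi k.+1%:R (s a) (s y) * Num.max 0 (2 - Num.max (s y / k.+1%:R) 1).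
Proof.
have k0 : 0 < k.+1%:R :> R by [].
rewrite /trap /tst mulrCA; congr (_ * _); rewrite /cap.
rewrite maxr_pMr ?invr_ge0// mulr0; congr Num.max.
by rewrite mulrBr mulKf ?gt_eqF// maxr_pMr ?invr_ge0// mulVf ?gt_eqF// [_^-1 * _]mulrC.
Qed.

Lemma trap_ge0 a k y : 0 <= trap a k y.
Proof. by rewrite mulr_ge0 ?invr_ge0 ?tst_ge0. Qed.

Lemma nd_trap a y : nondecreasing_seq (fun k => trap a k y).
Proof.
apply/nondecreasing_seqP => k; rewrite !trapE.
have k0 : 0 < k.+1%:R :> R by [].
have k1 : k.+1%:R <= k.+2%:R :> R by rewrite ler_nat.
have m0 : forall r : R, 0 <= Num.max 0 r by move=> r; rewrite le_max lexx.
have [sy|sy] := leP (s y) (s a); first by rewrite !chi_eq0// !mul0r.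
apply: ler_pM => //; rewrite ?chi_ge0//.
  rewrite /chi le_min !ge_min lexx /=; apply/orP; right.
  rewrite ge_max !le_max lexx /=; apply/orP; right.
  by rewrite ler_wpM2r// subr_ge0 ltW.
rewrite ge_max !le_max lexx /=; apply/orP; right.
rewrite lerD2l lerN2 ge_max !le_max lexx orbT andbT.
have [s0|s0] := leP 0 (s y).
  by apply/orP; left; rewrite ler_wpM2l// lef_pV2 ?posrE.
by apply/orP; right; rewrite (@le_trans _ _ 0)// mulr_le0_ge0 ?invr_ge0// ltW.
Qed.

Lemma cvg_trap a y : trap a k y @[k --> \oo] --> ((\1_(ray false (s a)) (s y)) : R).
Proof.
have -> : \1_(ray false (s a)) (s y) = (s a < s y)%R%:R :> R.
  rewrite indicE /ray; congr (_%:R); congr nat_of_bool.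
  by apply/idP/idP => [/set_mem/=|h]; rewrite ?in_itv/= ?andbT//; apply/mem_set; rewrite /= in_itv/= h.
apply: cvg_near_cst; have [sy|sy] := leP (s y) (s a).
  by apply: nearW => k; rewrite trapE chi_eq0// mul0r.
exists (Num.truncn (`|s y| + (s y - s a)^-1)).+1 => // k /= hk; rewrite trapE.
have d0 : 0 < s y - s a by rewrite subr_gt0.
have k0 : 0 < k.+1%:R :> R by [].
have hk' : `|s y| + (s y - s a)^-1 <= k.+1%:R.
  rewrite (le_trans (ltW (truncnS_gt _)))// ler_nat; exact: leqW.
have di : 0 <= (s y - s a)^-1 by rewrite invr_ge0 ltW.
have h1 : s y <= k.+1%:R by rewrite (le_trans (ler_norm _))//; apply: le_trans hk'; rewrite lerDl.
have h2 : k.+1%:R^-1 <= s y - s a.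
  rewrite -[leRHS]invrK lef_pV2 ?posrE ?invr_gt0//; apply: le_trans hk'; by rewrite lerDr.
rewrite chi_eq1//; last by rewrite addrC -lerBrDr.
have h3 : s y / k.+1%:R <= 1 by rewrite ler_pdivrMr// mul1r.
rewrite (max_idPr h3) mul1r (_ : 2 - 1 = 1); last by ring.
exact/max_idPr.
Qed.

End tests.

Lemma adde_cancel (R : realType) (c A B W : \bar R) : A \is a fin_num -> B \is a fin_num ->
  (c + (A - B) + (B + W) = c + (A + W))%E.
Proof.
move=> /fineK <- /fineK <-; rewrite -EFinB -addeA; congr (_ + _)%E.
by rewrite addeA -EFinD subrK.
Qed.

(** * Families of measures solving the forward equation *)

Section families.
Context (R : realType).
Local Notation E := (posreal R).
Local Notation leb := (@lebesgue_measure R).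
Context (s : E -> R).
Hypothesis hs : scale s.
Implicit Types (f g p : E -> R) (t u T : R) (x y : E).

(* The clauses of [forward_equation] after division by [h]; measurability of
   [t |-> m t A] is not assumed but deduced from these clauses for the functions
   [tst] and 1. *)
Definition fwd (m : R -> {measure set E -> \bar R}) x g f := forall t, 0 <= t ->
  [/\ measurable_fun `[0, t] (fun u : R => \int[m u]_y `|f y|%:E)%E,
      measurable_fun `[0, t] (fun u : R => \int[m u]_y (f y)%:E)%E,
      (\int[leb]_(u in `[0%R, t]) \int[m u]_y `|f y|%:E < +oo)%E &
      (\int[m t]_y (g y)%:E =
        (g x)%:E + \int[leb]_(u in `[0%R, t]) \int[m u]_y (f y)%:E)%E].

Lemma abse_integral_le (m : {measure set E -> \bar R}) f : measurable_fun setT f ->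
  (`|\int[m]_y (f y)%:E| <= \int[m]_y `|f y|%:E)%E.
Proof.
by move=> mf; apply: le_abse_integral => //; exact/measurable_EFinP.
Qed.

Lemma fwd_integrable m x g f t : measurable_fun setT f -> fwd m x g f -> 0 <= t ->
  leb.-integrable `[0, t] (fun u : R => \int[m u]_y (f y)%:E)%E.
Proof.
move=> mf hf t0; have [m1 m2 fin _] := hf t t0.
apply/integrableP; split => //; apply: le_lt_trans fin.
apply: ge0_le_integral => //; first exact: measurableT_comp.
by move=> u _; exact: abse_integral_le.
Qed.

Lemma int_itv_fin (w : R -> \bar R) t : leb.-integrable `[0, t] w ->
  (\int[leb]_(u in `[0%R, t]) w u)%E \is a fin_num.
Proof. by move=> h; apply: integrable_fin_num. Qed.

Lemma measurable_fun_nonneg (w : R -> \bar R) : (forall T, 0 <= T -> measurable_fun `[0, T] w) ->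
  measurable_fun setT (w \_ [set t | 0 <= t]).
Proof.
move=> h.
apply: (@emeasurable_fun_cvg _ _ _ setT (fun k => w \_ `[0, k%:R])).
  by move=> k; apply/(measurable_restrictT _ _).1 => //; exact: h.
move=> t _; apply: cvg_near_cst; exists (Num.truncn `|t|).+1 => // k /= hk.
have tk : t <= k%:R.
  by rewrite (le_trans (ler_norm _))// (le_trans (ltW (truncnS_gt _)))// ler_nat.
rewrite /patch mem_setE in_itv /= tk andbT.
by have [t0|t0] := leP 0 t; [rewrite mem_set|rewrite memNset//= leNgt t0].
Qed.

Lemma int_patch (w : R -> \bar R) t :
  (\int[leb]_(u in `[0%R, t]) w u = \int[leb]_u ((u <= t)%R%:R%:E * (w \_ [set t | (0 <= t)%R]) u))%E.
Proof.
rewrite integral_mkcond; apply: eq_integral => u _; rewrite /patch mem_setE in_itv /=.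
have [u0|u0] /= := leP 0 u; last by rewrite memNset ?mule0//= leNgt u0.
by rewrite mem_set//; case: leP => _ /=; rewrite ?mul1e ?mul0e.
Qed.

(** The forward equation expresses the integral of [g] as a constant plus a difference of two
    primitives in time, and primitives are measurable by Tonelli. *)
Lemma measurable_test m x g f : measurable_fun setT f -> fwd m x g f ->
  (forall t, t < 0 -> m t setT = 0%E) -> measurable_fun setT g ->
  measurable_fun setT (fun t : R => \int[m t]_y (g y)%:E)%E.
Proof.
move=> mf hf m0 mg.
pose psi u : \bar R := (\int[m u]_y (f y)%:E)%E.
pose psi0 := psi \_ [set t | 0 <= t].
have mpsi0 : measurable_fun setT psi0.
  by apply: measurable_fun_nonneg => T T0; have [] := hf T T0.
have nI (w : R -> \bar R) : nnm w -> measurable_fun setT (fun t => \int[leb]_u ((u <= t)%R%:R%:E * w u))%E.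
  move=> w0; apply: (proj1 (@nnm_int _ _ _ _ _ leb (fun t u => ((u <= t)%R%:R%:E * w u)%E) _)).
  by apply: nnmM; [exact: nnm_ler|exact: (nnm_comp w0)].
have np : nnm (psi0^\+)%E by split => //; exact: measurable_funepos.
have nn : nnm (psi0^\-)%E by split => //; exact: measurable_funeneg.
have -> : (fun t => \int[m t]_y (g y)%:E)%E = fun t => if 0 <= t then
   ((g x)%:E + ((\int[leb]_u ((u <= t)%R%:R%:E * psi0^\+ u)) - (\int[leb]_u ((u <= t)%R%:R%:E * psi0^\- u))))%E else 0%E.
  apply/funext => t; have [t0|t0] := leP 0 t; last first.
    have := @abse_integral_le (m t) g mg.
    have -> : (\int[m t]_y `|g y|%:E = 0)%E.
      apply: null_set_integral => //; last exact: m0.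
      by apply/measurable_EFinP; exact: measurableT_comp.
    by move=> h; apply/eqP; rewrite -abse_eq0 eq_le h abse_ge0.
  have [_ _ _ ->] := hf t t0; congr (_ + _)%E; rewrite int_patch integralE.
  by congr (_ - _)%E; apply: eq_integral => u _; rewrite ?(funeposE, funenegE);
    (case: leP => _ /=; rewrite ?mul1e ?mul0e ?oppe0 ?maxxx ?joinxx).
apply: measurable_fun_ifT => //; first exact: measurable_fun_ler.
by apply: emeasurable_funD => //; apply: emeasurable_funB; exact: nI.
Qed.

(** [L] is kept abstract: the results of this section use of the generator only that its values are
    measurable functions. *)
Definition tests m x (L : (E -> R) -> (E -> R) -> E -> R) :=
  fwd m x (fun=> 1) (L (fun=> 1) (fun=> 0)) /\
  forall (n : R) (a : E) (B C : R), 0 < n -> fwd m x (tst s n a B C) (L (tst s n a B C) (tst' s n a B C)).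

Section kernel.
Variables (m : R -> {measure set E -> \bar R}) (x : E).
Variable L : (E -> R) -> (E -> R) -> E -> R.
Hypothesis mL : forall (g D : E -> R) (M : R), measurable_fun setT g -> measurable_fun setT D ->
  (forall y, `|g y| <= M) -> measurable_fun setT (L g D).
Hypothesis m0 : forall t, t < 0 -> m t setT = 0%E.
Hypothesis hm : tests m x L.

Lemma measurable_tst (n : R) (a : E) (B C : R) : measurable_fun setT (tst s n a B C).
Proof. exact/continuous_measurable_posreal/(tst_continuous hs). Qed.

Lemma measurable_tst' (n : R) (a : E) (B C : R) : 0 < n -> measurable_fun setT (tst' s n a B C).
Proof.
move=> n0; have := measurable_sderive (sc_incr hs) (sc_cont hs) (sc_lim hs) (measurable_tst n a B C)
  (fun y => (tst_sderive hs a B C y n0).1).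
by rewrite (_ : sderive s _ = tst' s n a B C)//; apply/funext => y; exact: (tst_sderive hs a B C y n0).2.
Qed.

Lemma measurable_L1 : measurable_fun setT (L (fun=> 1) (fun=> 0)).
Proof. by apply: (@mL _ _ 1) => // y; rewrite normr1. Qed.

Lemma measurable_Ltst (n : R) (a : E) (B C : R) : 0 < n -> measurable_fun setT (L (tst s n a B C) (tst' s n a B C)).
Proof.
move=> n0; apply: (@mL _ _ `|C - B|); [exact: measurable_tst|exact: measurable_tst'|].
by move=> y; exact: tst_le.
Qed.

Lemma family_fin t : (m t setT < +oo)%E.
Proof.
have [t0|t0] := leP 0 t; last by rewrite m0.
have [_ _ _] := hm.1 t t0; rewrite integral_cst// mul1e => ->.
have := int_itv_fin (fwd_integrable measurable_L1 hm.1 t0).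
by rewrite fin_numElt => /andP[_ h]; rewrite lte_add_pinfty// ltry.
Qed.

Lemma measurable_mass : measurable_fun setT (fun t => m t setT).
Proof.
have := measurable_test measurable_L1 hm.1 m0 (measurable_cst (1 : R)).
by apply: eq_measurable_fun => t _; rewrite integral_cst// mul1e.
Qed.

Lemma trap_lim t a :
  (limn (fun k => \int[m t]_y (trap s a k y)%:E) = m t (s @^-1` ray false (s a)))%E.
Proof.
have ntr k : nnm (fun y => (trap s a k y)%:E).
  apply: nnm_EFin; last exact: trap_ge0.
  by apply: measurable_funM => //; exact: measurable_tst.
have mr : measurable (s @^-1` ray false (s a)).
  rewrite -[X in measurable X]setTI.
  exact: (continuous_measurable_posreal (sc_cont hs) measurableT (measurable_ray _ _)).
rewrite -(sf_lim (sf_integral (m t)) ntr); last first.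
  by move=> y i j ij; rewrite lee_fin; exact: nd_trap.
transitivity (\int[m t]_y (\1_(s @^-1` ray false (s a)) y)%:E)%E; last by rewrite integral_indic// setIT.
apply: eq_integral => y _.
by apply/cvg_lim => //; apply: cvg_EFin; [exact: nearW|exact: cvg_trap].
Qed.

Lemma measurable_family A : measurable A -> measurable_fun setT (fun t => m t A).
Proof.
move=> mA.
pose P : set (set R) := [set B | measurable_fun setT (fun t => m t (s @^-1` B))].
have mpre B : measurable B -> measurable (s @^-1` B).
  move=> mB; rewrite -[X in measurable X]setTI.
  exact: (continuous_measurable_posreal (sc_cont hs) measurableT mB).
have ray_P a : P (ray false a).
  rewrite /P /=.
  (* A level [a] that [s] does not take lies below its whole range, and the preimage of the ray is
     then everything. *)
  have [[a' <-]|na] := pselect (exists a', s a' = a); last first.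
    have -> : s @^-1` ray false a = setT.
      apply/seteqP; split => // y _; rewrite /ray /= in_itv /= andbT ltNge.
      apply/negP => ya; apply: na; exact: (s_surj (sc_cont hs) (sc_lim hs) ya).
    exact: measurable_mass.
  rewrite (_ : (fun t => _) = fun t => limn (fun k => \int[m t]_y (trap s a' k y)%:E)%E); last first.
    by apply/funext => t; rewrite trap_lim.
  apply: (@nnm_lim _ (measurableTypeR R) R (fun k t => \int[m t]_y (trap s a' k y)%:E)%E _ _).1.
    move=> k; split; last by move=> t; apply: integral_ge0 => y _; rewrite lee_fin trap_ge0.
    have k0 : 0 < k.+1%:R :> R by [].
    rewrite (_ : (fun t => _) = fun t => ((k.+1%:R^-1)%:E *
        \int[m t]_y (tst s k.+1%:R a' k.+1%:R (k.+1%:R * 2) y)%:E)%E).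
      apply: emeasurable_funM; first exact: measurable_cst.
      exact: (measurable_test (measurable_Ltst a' _ _ k0) (hm.2 _ a' _ _ k0) m0 (measurable_tst _ _ _ _)).
    apply/funext => t; rewrite -(sf_scale (sf_integral (m t))) ?invr_ge0//.
    by apply: nnm_EFin; [exact: measurable_tst|exact: tst_ge0].
  move=> t i j ij; apply: ge0_le_integral => //.
  - by move=> y _; rewrite lee_fin trap_ge0.
  - by apply/measurable_EFinP/measurable_funM => //; exact: measurable_tst.
  - by apply/measurable_EFinP/measurable_funM => //; exact: measurable_tst.
  - by move=> y _; rewrite lee_fin; exact: nd_trap.
have mE : @measurable _ (measurableTypeR R) = <<s @RGenOInfty.G R >>.
  exact: RGenOInfty.measurableE.
have PB B : measurable B -> P B.
  move=> mB; have mB' : <<s @RGenOInfty.G R >> B by rewrite -mE.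
  apply: (dynkin_induction (P := P) mE _ _ _ _ _ mB').
  - move=> _ _ [a ->] [b ->]; exists (Num.max a b).
    apply/seteqP; split => z; rewrite /= !in_itv /= !andbT gt_max; first by case=> -> ->.
    by case/andP.
  - by rewrite /P /= preimage_setT; exact: measurable_mass.
  - by move=> _ [a ->]; exact: (ray_P a).
  - move=> S mS PS; rewrite /P /=.
    rewrite (_ : (fun t => _) = fun t => (m t setT - m t (s @^-1` S))%E).
      by apply: emeasurable_funB => //; exact: measurable_mass.
    apply/funext => t; have -> : s @^-1` (~` S) = setT `\` (s @^-1` S) by rewrite setTD.
    by rewrite measureD ?setTI; [|exact: measurableT|exact: mpre|exact: family_fin].
  - move=> F mF tF PF; rewrite /P /= preimage_bigcup.
    rewrite (_ : (fun t => _) = fun t => (\sum_(0 <= k <oo) m t (s @^-1` F k))%E).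
      apply: (@nnm_lim _ (measurableTypeR R) R (fun n t => \sum_(0 <= k < n) m t (s @^-1` F k))%E _ _).1.
        by move=> n; apply: nnm_sum => k; split; [exact: PF|move=> t; exact: measure_ge0].
      by move=> t; apply/nondecreasing_seqP => n; rewrite big_nat_recr//= leeDl.
    apply/funext => t; apply/esym/cvg_lim => //; apply: measure_semi_sigma_additive.
    + by move=> k; exact: mpre.
    + apply/trivIsetP => i j _ _ ij; move/trivIsetP: tF => /(_ i j I I ij).
      move=> e; apply/seteqP; split => // y [h1 h2].
      by have : (F i `&` F j) (s y) by []; rewrite e.
    + by apply: bigcup_measurable => k _; exact: mpre.
have -> : A = s @^-1` (sinv s @^-1` A).
  by apply/seteqP; split => y; rewrite /= (sinvK (sc_incr hs)).
apply: PB; rewrite -[X in measurable X]setTI.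
exact: (measurable_sinv (sc_incr hs) (sc_cont hs) (sc_lim hs) measurableT mA).
Qed.

Lemma nnm_family (f : E -> \bar R) : nnm f -> nnm (fun t => \int[m t]_y f y)%E.
Proof.
move=> [mf f0]; split; last by move=> t; exact: integral_ge0.
exact: (measurable_fun_integral_kernel measurable_family).
Qed.

Lemma family0 (f : E -> \bar R) t : nnm f -> t < 0 -> (\int[m t]_y f y = 0)%E.
Proof.
by move=> [mf f0] t0; apply: null_set_integral => //; exact: m0.
Qed.

Definition occ t (f : E -> \bar R) : \bar R :=
  (\int[leb]_u ((u <= t)%R%:R%:E * \int[m u]_y f y))%E.

Lemma sf_occ t : sfunctional (occ t).
Proof.
have h1 : @sfunctional _ (measurableTypeR R) R (fun w : R -> \bar R => \int[leb]_u ((u <= t)%R%:R%:E * w u))%E.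
  by apply: (sf_weight (sf_integral leb)); exact: nnm_ler.
have h2 := (@sf_comp _ _ (measurableTypeR R) E R _ (fun u (f : E -> \bar R) => \int[m u]_y f y)%E h1
  (fun u => sf_integral (m u)) (fun (f : E -> \bar R) hq => (nnm_family hq).1)).
rewrite /occ; exact: h2.
Qed.

(** Any decomposition [f = p - n] exceeds the minimal one by the same [w] in both parts. The minimal
    parts have finite occupation integrals and can be moved across; that of [w] may be infinite, but
    it appears on both sides. *)
Lemma fwd_occ g f p (n : E -> R) t : measurable_fun setT f -> fwd m x g f ->
  measurable_fun setT p -> measurable_fun setT n ->
  (forall y, 0 <= p y) -> (forall y, 0 <= n y) -> (forall y, f y = p y - n y) -> 0 <= t ->
  (\int[m t]_y (g y)%:E + occ t (EFin \o n) = (g x)%:E + occ t (EFin \o p))%E.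
Proof.
move=> mf hf mp mn p0 n0 fE t0; have [_ _ fin ->] := hf t t0.
pose fp y := Num.max (f y) 0; pose fn y := Num.max (- f y) 0; pose w y := p y - fp y.
have fp0 y : 0 <= fp y by rewrite /fp le_max lexx orbT.
have fn0 y : 0 <= fn y by rewrite /fn le_max lexx orbT.
have fpn y : f y = fp y - fn y by rewrite /fp /fn !maxEle; case: ifP; case: ifP; lra.
have w0 y : 0 <= w y.
  rewrite /w subr_ge0 /fp ge_max p0 fE andbT; have := n0 y; lra.
have nw y : n y = fn y + w y.
  by rewrite /w; have := fE y; have := fpn y; lra.
have pw y : p y = fp y + w y by rewrite /w addrC subrK.
have mfp : measurable_fun setT fp by exact: measurable_maxr.
have mfn : measurable_fun setT fn by apply: measurable_maxr => //; exact: measurableT_comp.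
have mw : measurable_fun setT w by exact: measurable_funB.
have hfp := nnm_EFin mfp fp0; have hfn := nnm_EFin mfn fn0; have hw := nnm_EFin mw w0.
have afn y : `|f y| = fp y + fn y.
  rewrite /fp /fn; case/orP: (le_total 0 (f y)) => h.
    have h' : - f y <= 0 by rewrite oppr_le0.
    by rewrite ger0_norm// (max_idPl h) (max_idPr h') addr0.
  have h' : 0 <= - f y by rewrite oppr_ge0.
  by rewrite ler0_norm// (max_idPr h) (max_idPl h') add0r.
have occE (q : E -> R) : nnm (EFin \o q) -> occ t (EFin \o q) = (\int[leb]_(u in `[0%R, t]) \int[m u]_y (q y)%:E)%E.
  move=> hq; rewrite int_patch; apply: eq_integral => u _; rewrite /patch.
  have [u0|u0] := leP 0 u; first by rewrite mem_set.
  by rewrite family0// memNset//= leNgt u0.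
have iabs u : (\int[m u]_y `|f y|%:E = \int[m u]_y (fp y)%:E + \int[m u]_y (fn y)%:E)%E.
  rewrite -(sf_add (sf_integral (m u)) hfp hfn); apply: eq_integral => y _.
  by rewrite afn EFinD.
have Ip : leb.-integrable `[0, t] (fun u : R => \int[m u]_y (fp y)%:E)%E.
  have mI : measurable_fun `[0, t] (fun u : R => \int[m u]_y (fp y)%:E)%E.
    by apply: measurable_funTS; exact: (nnm_family hfp).1.
  apply/integrableP; split => //; apply: le_lt_trans fin; apply: ge0_le_integral => //.
  - exact: measurableT_comp.
  - by have [] := hf t t0.
  - move=> u _; rewrite gee0_abs ?(nnm_family hfp).2// iabs leeDl//; exact: (nnm_family hfn).2.
have In : leb.-integrable `[0, t] (fun u : R => \int[m u]_y (fn y)%:E)%E.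
  have mI : measurable_fun `[0, t] (fun u : R => \int[m u]_y (fn y)%:E)%E.
    by apply: measurable_funTS; exact: (nnm_family hfn).1.
  apply/integrableP; split => //; apply: le_lt_trans fin; apply: ge0_le_integral => //.
  - exact: measurableT_comp.
  - by have [] := hf t t0.
  - move=> u _; rewrite gee0_abs ?(nnm_family hfn).2// iabs leeDr//; exact: (nnm_family hfp).2.
have fIp := int_itv_fin Ip.
have fIn := int_itv_fin In.
have -> : (\int[leb]_(u in `[0%R, t]) \int[m u]_y (f y)%:E =
   \int[leb]_(u in `[0%R, t]) \int[m u]_y (fp y)%:E - \int[leb]_(u in `[0%R, t]) \int[m u]_y (fn y)%:E)%E.
  rewrite -integralB//; apply: eq_integral => u _.
  rewrite integralE; congr (_ - _)%E; apply: eq_integral => y _.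
    by rewrite funeposE /fp EFin_max.
  by rewrite funenegE /fn EFin_max EFinN.
rewrite [X in occ t X](_ : _ = fun y => (fn y)%:E + (w y)%:E)%E; last first.
  by apply/funext => y /=; rewrite nw EFinD.
rewrite [in RHS](_ : EFin \o p = fun y => (fp y)%:E + (w y)%:E)%E; last first.
  by apply/funext => y /=; rewrite pw EFinD.
rewrite (sf_add (sf_occ t) hfn hw) (sf_add (sf_occ t) hfp hw) (occE fp hfp) (occE fn hfn).
exact: adde_cancel.
Qed.

End kernel.

End families.

(** * Resolvents *)

Section resolvent.
Context (R : realType).
Local Notation E := (posreal R).
Local Notation leb := (@lebesgue_measure R).
Context (s : E -> R) (kap : R.-ker E ~> E) (lam : E -> R) (b al : R).
Hypothesis hs : scale s.
Hypothesis hr : rates kap lam b.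
Hypothesis b_al : b < al.
Local Notation phi := (phi s).
Local Notation weight := (weight s lam b).
Local Notation Swt := (Swt s lam b).
Local Notation Qwt := (Qwt s lam b).
Local Notation Sop := (Sop s lam b).
Local Notation Qop := (Qop s kap lam b).
Local Notation Pn := (Pn s kap lam b).
Local Notation Poo := (Poo s kap lam b).
Local Notation kint := (kint kap).
Local Notation Lap := (Lap al).
Local Notation ew := (ew al).
Local Open Scope ereal_scope.

Let mphi d (T : measurableType d) (p : T -> R) (q : T -> E) mp mq :=
  @measurable_phi_comp R s hs d T p q mp mq.

Lemma lamb_ge0 y : (0 <= lam y + b)%R.
Proof.
have h : (0 <= fine (kap y setT))%R by exact: fine_ge0.
by have := rt_ge hr y; lra.
Qed.

Lemma alam_ge0 y : (0 <= al + lam y)%R.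
Proof. by rewrite (le_trans (lamb_ge0 y))// [leRHS]addrC lerD2l ltW. Qed.

Lemma nnm_slice (F : R * E -> \bar R) y : nnm F -> nnm (fun t : R => F (t, y)).
Proof. by move=> F0; apply: (nnm_comp F0); exact: pair2_measurable. Qed.

Definition Vop (f : E -> \bar R) (y : E) := Lap (fun t => Sop f (t, y)).

Lemma nnm_LapF (F : R * E -> \bar R) : nnm F -> nnm (fun y => Lap (fun t => F (t, y))).
Proof.
move=> F0; apply: (@nnm_int _ _ _ _ _ leb (fun y t => ew t * F (t, y))).
apply: nnmM; first exact: (nnm_comp (nnm_ew al)).
by apply: (nnm_comp F0); exact: measurable_fun_pair.
Qed.

Lemma nnm_Vop f : nnm f -> nnm (Vop f).
Proof. by move=> f0; exact: (nnm_LapF (nnm_Sop hs hr f0)). Qed.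

Lemma sf_Vop y : sfunctional (Vop^~ y).
Proof.
apply: (@sf_comp _ _ (measurableTypeR R) E R Lap (fun t (f : E -> \bar R) => Sop f (t, y)) (sf_Lap al)).
  by move=> t; exact: (sf_Sop s lam b (t, y)).
by move=> f f0; exact: (nnm_slice y (nnm_Sop hs hr f0)).1.
Qed.

Fixpoint Rn (n : nat) (f : E -> \bar R) (y : E) : \bar R :=
  if n is m.+1 then Vop f y + Vop (kint (Rn m f)) y else 0.

Lemma nnm_Rn n f : nnm f -> nnm (Rn n f).
Proof.
move=> f0; elim: n => [|n ih]; first exact: nnm_cst.
by apply: nnmD; apply: nnm_Vop => //; exact: (nnm_kint hr ih).
Qed.

Lemma kintD f g y : nnm f -> nnm g -> kint (fun y => f y + g y) y = kint f y + kint g y.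
Proof. exact: (sf_add (sf_integral (kap y))). Qed.

(** [Rn n f] is the sum of [(V kint)^j (V f)] over [j < n], so a factor can be peeled off next to
    [f] instead of outside. This is the form needed in [Rn_le_U], where [min_ineq] is known at the
    single point [x]. *)
Lemma Rn_comm n f y : nnm f -> Rn n.+1 f y = Vop f y + Rn n (kint (Vop f)) y.
Proof.
move=> f0; have V0 := nnm_Vop f0; have k0 := nnm_kint hr V0.
elim: n y => [|n ih] y.
  rewrite /=; apply: adde_eq => //.
  have -> : kint (fun=> 0) = (fun=> 0) by apply/funext => z; exact: integral0.
  exact: (sf0 (sf_Vop y)).
rewrite [LHS]/= [in RHS]/=; apply: adde_eq => //.
have R0 := nnm_Rn n k0.
rewrite -(sf_add (sf_Vop y) k0 (nnm_kint hr R0)).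
apply: (congr1 (fun F => Vop F y)); apply/funext => z.
transitivity (kint (fun w => Vop f w + Rn n (kint (Vop f)) w) z).
  by apply: eq_integral => w _; exact: ih.
exact: (kintD z V0 R0).
Qed.

(** The transform of a convolution is a product: after Tonelli, the shift by [u] splits [ew (t + u)]
    into [ew u * ew t]. [Qwt] and [Swt] differ at time 0 only. *)
Lemma Lap_Qop (G : R * E -> \bar R) y : nnm G -> (forall t z, (t < 0)%R -> G (t, z) = 0) ->
  Lap (fun t => Qop G (t, y)) = Vop (kint (fun z => Lap (fun t => G (t, z)))) y.
Proof.
move=> G0 Gn.
have m1 : nnm (fun w : R * R => Qwt w.2 y * \int[kap (phi w.2 y)]_z G (w.1 - w.2, z)%R).
  exact: (nnm_Qint hs hr G0 (@measurable_snd _ _ R R) (@measurable_fst _ _ R R) (measurable_cst y)).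
have m1' : nnm (fun w : R * R => ew w.1 * (Qwt w.2 y * \int[kap (phi w.2 y)]_z G (w.1 - w.2, z)%R)).
  by apply: nnmM => //; exact: (nnm_comp (nnm_ew al)).
have LG0 := nnm_LapF G0; have kL0 := nnm_kint hr LG0.
transitivity (\int[leb]_t \int[leb]_u (ew t * (Qwt u y * \int[kap (phi u y)]_z G (t - u, z)%R))).
  apply: eq_integral => t _; rewrite QopE.
  have e0 : (0 <= (0 <= t)%R%:R * expR (- (al * t)))%R by rewrite mulr_ge0// expR_ge0.
  have hv : nnm (fun u : R => Qwt u y * \int[kap (phi u y)]_z G (t - u, z)%R).
    by apply: (nnm_Qint (u := id) (t := fun=> t) (x := fun=> y) hs hr G0).
  by rewrite [RHS](sf_scale (sf_integral leb) e0 hv).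
rewrite (tonelli leb leb m1').
have m2 : nnm (fun u : R => \int[leb]_t (ew t * (Qwt u y * \int[kap (phi u y)]_z G (t - u, z)%R))).
  exact: (nnm_int leb (F := fun u t => ew t * (Qwt u y * \int[kap (phi u y)]_z G (t - u, z)%R))
     (nnm_comp m1' (measurable_fun_pair (@measurable_snd _ _ R R) (@measurable_fst _ _ R R)))).
have m3 : nnm (fun u : R => ew u * Sop (kint (fun z => Lap (fun t => G (t, z)))) (u, y)).
  by apply: nnmM; [exact: nnm_ew|exact: (nnm_slice y (nnm_Sop hs hr kL0))].
apply: (@ge0_ae_eq_integral _ _ _ leb setT _ _ measurableT m2.1 m3.1 (fun u _ => m2.2 u) (fun u _ => m3.2 u)).
exists [set 0%R]; split => //; first exact: lebesgue_measure_set1.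
move=> u /= h; apply: contrapT => u0; apply: h => _.
have [ug|ul] := ltP 0%R u; last first.
  have ult : (u < 0)%R by rewrite lt_neqAle ul andbT; apply/eqP.
  rewrite ew_lt0// mul0e; apply: integral0_eq => t _.
  by rewrite (Qwt_le _ _ _ _ ul) mul0e mule0.
rewrite SopE (Swt_ge _ _ _ _ (ltW ug)) (Qwt_gt _ _ _ _ ug).
set w := (weight u y)%:E; set K := kap (phi u y).
have w0 : (0 <= weight u y)%R by exact: weight_ge0.
have m4 : nnm (fun z : R * E => ew z.1 * G (z.1, z.2)).
  by apply: nnmM; [exact: (nnm_comp (nnm_ew al))|exact: (nnm_comp G0 (measurable_fun_pair (@measurable_fst _ _ R E) (@measurable_snd _ _ R E)))].
have m5 : nnm (fun t : R => ew t * \int[K]_z G (t - u, z)%R).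
  apply: nnmM; first exact: nnm_ew.
  have m6 : nnm (fun w : R * E => G (w.1 - u, w.2)%R).
    by apply: (nnm_comp G0); apply: measurable_fun_pair => //; exact: measurable_funB.
  exact: (nnm_kap (F := fun (v : R) y => G (v - u, y)%R) hr (measurable_cst (phi u y)) m6).
transitivity (w * \int[leb]_t (ew t * \int[K]_z G (t - u, z)%R)).
  rewrite -[RHS](sf_scale (sf_integral leb) w0 m5); apply: eq_integral => t _.
  by rewrite muleCA.
rewrite muleCA; apply: (congr1 (fun z => w * z)).
rewrite -(lebesgue_shift u m5).
have m7 : nnm (fun t : R => \int[K]_z (ew t * G (t, z))).
  exact: (nnm_kap (F := fun (v : R) y => ew v * G (v, y)) hr (measurable_cst (phi u y)) m4).
transitivity (ew u * \int[leb]_t \int[K]_z (ew t * G (t, z))).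
  have e0 : (0 <= (0 <= u)%R%:R * expR (- (al * u)))%R by rewrite mulr_ge0// expR_ge0.
  rewrite -[RHS](sf_scale (sf_integral leb) e0 m7); apply: eq_integral => t _.
  have Gt : nnm (fun z => G (t, z)) by apply: (nnm_comp G0); exact: pair1_measurable.
  rewrite addrK; have [t0|t0] := leP 0%R t; last first.
    rewrite (_ : (fun z => G (t, z)) = fun=> 0); last by apply/funext => z; rewrite Gn.
    rewrite integral0 mule0 integral0_eq ?mule0// => z _.
    by rewrite Gn// mule0.
  have e1 : (0 <= (0 <= t)%R%:R * expR (- (al * t)))%R by rewrite mulr_ge0// expR_ge0.
  rewrite (sf_scale (sf_integral K) e1 Gt) muleA; congr (_ * _).
  rewrite ew_ge0 ?addr_ge0 ?(ltW ug)// ?(ltW ug) ?t0 !mul1r -EFinM -expRD.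
  by congr (expR _)%:E; ring.
by congr (_ * _); exact: (tonelli_fin leb (rt_fin hr (phi u y)) m4).
Qed.

Lemma Lap_Pn n f y : nnm f -> Lap (fun t => Pn n f (t, y)) = Rn n f y.
Proof.
move=> f0; elim: n y => [|n ih] y.
  rewrite [RHS]/= -[RHS](sf0 (sf_Lap al)); apply: Lap_ext => t _; exact: Pn0.
have P0 := nnm_Pn hs hr n f0.
have hS := nnm_slice y (nnm_Sop hs hr f0).
have hQ := nnm_slice y (nnm_Qop hs hr P0).
transitivity (Lap (fun t => Sop f (t, y)) + Lap (fun t => Qop (Pn n f) (t, y))).
  by rewrite -(sf_add (sf_Lap al) hS hQ); apply: Lap_ext => t _; exact: PnS.
rewrite [RHS]/=; apply: adde_eq; first by [].
rewrite (Lap_Qop _ P0); last by move=> t z t0; exact: (Pn_lt0 s kap lam b n z t0 f0).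
by apply: sf_ext => z; rewrite (_ : (fun z => Lap (fun t => Pn n f (t, z))) = Rn n f)//; exact/funext.
Qed.

Lemma Lap_Poo f y : nnm f -> Lap (fun t => Poo f (t, y)) = limn (fun n => Rn n f y).
Proof.
move=> f0; transitivity (limn (fun n => Lap (fun t => Pn n f (t, y)))).
  apply: (sf_lim (sf_Lap al) (F := fun n t => Pn n f (t, y))) => [n|t].
    exact: (nnm_slice y (nnm_Pn hs hr n f0)).
  exact: (nd_Pn hs hr (t, y) f0).
by congr (limn _); apply/funext => n; exact: Lap_Pn.
Qed.

Definition Vz (f : E -> \bar R) (y : E) := \int[leb]_t ((0 <= t)%R%:R%:E * f (phi t y)).

Lemma nnm_Vzint f : nnm f -> nnm (fun z : E * R => ((0 <= z.2)%R%:R%:E : \bar R) * f (phi z.2 z.1)).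
Proof.
by move=> f0; apply: nnmM; [exact: nnm_ler|apply: (nnm_comp f0); exact: mphi].
Qed.

Lemma nnm_Vz f : nnm f -> nnm (Vz f).
Proof.
move=> f0; exact: (nnm_int leb (F := fun y t => (0 <= t)%R%:R%:E * f (phi t y)) (nnm_Vzint f0)).
Qed.

Lemma sf_Vz y : sfunctional (Vz^~ y).
Proof.
have h : nnm (fun t : R => (0 <= t)%R%:R%:E : \bar R) by exact: nnm_ler.
have mp : measurable_fun setT (fun t : R => phi t y).
  exact: (measurable_phi_l (sc_incr hs) (sc_cont hs) (sc_lim hs)).
exact: (@sf_precomp _ _ (measurableTypeR R) E R _ (fun t => phi t y) (sf_weight (sf_integral leb) h) mp).
Qed.

Lemma Vz_itv (B C : R) y :
  Vz (fun z => (B <= s z < C)%R%:R%:E) y = (cap B C (s y))%:E.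
Proof.
rewrite /cap; set m := Num.max (s y) B.
transitivity (leb `[m - s y, C - s y[%classic)%R.
  transitivity (\int[leb]_t (\1_(`[m - s y, C - s y[%classic)%R t)%:E); last first.
    by rewrite integral_indic// setIT.
  apply: eq_integral => t _.
  rewrite indicE; have [t0|t0] := leP 0%R t; last first.
    rewrite mul0e memNset//= in_itv/= => /andP[h _].
    have : (0 <= m - s y)%R by rewrite subr_ge0 le_max lexx.
    by move/(le_lt_trans)/(_ (le_lt_trans h t0)); rewrite ltxx.
  rewrite mul1e (s_phi (sc_incr hs) (sc_cont hs) (sc_lim hs))//.
  congr (_%:R%:E); congr nat_of_bool; apply/idP/idP => [h|/set_mem/=].
    apply/mem_set; rewrite /= in_itv /= lerBlDr ge_max lerDr t0 ltrBrDr [(t + _)%R]addrC.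
    by [].
  by rewrite in_itv /= lerBlDr ge_max ltrBrDr [(t + _)%R]addrC => /andP[/andP[_ ->] ->].
rewrite lebesgue_measure_itv /= lte_fin ltrD2r; have [mC|Cm] := ltP m C.
  rewrite -EFinB; congr EFin; rewrite (_ : C - s y - (m - s y) = C - m)%R; last by ring.
  by apply/esym/max_idPr; rewrite subr_ge0 ltW.
by congr EFin; apply/esym/max_idPl; rewrite subr_le0.
Qed.

Definition Wt (t : R) y : R := (expR (- (al * t)) * weight t y)%R.

Lemma Wt_ge0 t y : (0 <= Wt t y)%R.
Proof. by rewrite mulr_ge0// ?expR_ge0// weight_ge0. Qed.

Lemma measurable_Wt d (T : measurableType d) (p : T -> R) (q : T -> E) :
  measurable_fun setT p -> measurable_fun setT q -> measurable_fun setT (fun z => Wt (p z) (q z)).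
Proof.
move=> mp mq; apply: measurable_funM.
  apply: (measurableT_comp (@measurable_expR R)); apply: measurableT_comp => //.
  exact: measurable_funM.
exact: (measurableT_comp (measurable_weight hs hr) (measurable_fun_pair mp mq)).
Qed.

Lemma Wt_int v y : (0 <= v)%R ->
  \int[leb]_u ((0 <= u <= v)%R%:R * ((al + lam (phi u y)) * Wt (v - u) (phi u y)))%R%:E =
  (1 - Wt v y)%R%:E.
Proof.
move=> v0.
(* [H u] is the inverse of [Wt u y]. By the cocycle property [Wt (v - u) (phi u y)] is
   [Wt v y * H u], and [H] has the density [(al + lam) * H] along the flow. *)
pose H u := (expR (al * u + - (b * u - rate_int s lam b u y)))%R.
have mrt : measurable_fun setT (fun t : R => (b * t - rate_int s lam b t y)%R) by exact: (measurable_rate_t hs hr y).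
have pH : prim 0%R v H (fun u => (al + lam (phi u y)) * H u)%R.
  apply: prim_expR.
    by apply: measurable_funD; [exact: measurable_funM|exact: measurableT_comp].
  have [bl hl] := prim_N (rate_prim hs hr y v).
  have bl' : bnd_on 0%R v (fun u => lam (phi u y)) by exact: (lam_phi_bnd_on hs hr y v).
  split; first by apply: bnd_onD => //; exact: bnd_on_cst.
  move=> u w u0 uw wv; have iw : leb.-integrable `[u, w] (EFin \o (fun u => lam (phi u y))).
    exact: bnd_on_int (bnd_onS u0 wv bl').
  rewrite RintegralD//; last exact: bnd_on_int (bnd_on_cst _ _ _).
  have := hl u w u0 uw wv; under [X in _ = X -> _]eq_Rintegral do rewrite opprK.
  move=> <-; have -> : (\int[leb]_(x in `[u, w]) al = al * (w - u))%R.
    have h := @Rintegral_cst _ _ _ leb _ (measurable_itv `[u, w]) al.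
    exact: (etrans h (congr1 (fun z => al * fine z)%R (leb_itv uw))).
  by ring.
have WH u : (0 <= u <= v)%R -> (Wt (v - u) (phi u y) = Wt v y * H u)%R.
  move=> /andP[u0 uv].
  have vu : (0 <= v - u)%R by rewrite subr_ge0.
  have e : weight v y = (weight u y * weight (v - u) (phi u y))%R.
    by rewrite -(weightD hs hr)// addrC subrK.
  have w1H : (weight u y * H u = expR (al * u))%R.
    by rewrite /weight /H -expRD; congr expR; ring.
  have ex : (expR (- (al * (v - u))) = expR (- (al * v)) * expR (al * u))%R.
    by rewrite -expRD; congr expR; ring.
  by rewrite /Wt e ex -w1H; ring.
have H0 : H 0%R = 1%R by rewrite /H rate_int_le0// !mulr0 subrr oppr0 addr0 expR0.
have Hv : (Wt v y * H v = 1)%R.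
  by rewrite -(WH v) ?v0 ?lexx// subrr /Wt mulr0 oppr0 expR0 weight0 mulr1.
have [bH /(_ 0%R v (lexx _) v0 (lexx _)) iH] := pH.
transitivity (\int[leb]_u ((0 <= u <= v)%R%:R * (Wt v y * ((al + lam (phi u y)) * H u)))%R%:E).
  apply: eq_integral => u _; congr EFin.
  have [h|h] := boolP (0 <= u <= v)%R; last by rewrite !mul0r.
  by congr (_ * _)%R; rewrite (WH u h) mulrCA.
rewrite -EFin_Rint; last by apply: bnd_onM => //; exact: bnd_on_cst.
congr EFin; rewrite RintegralZl//; last exact: bnd_on_int bH.
by rewrite -iH H0 mulrBr Hv mulr1.
Qed.

(** The resolvent identity between the flow killed at rate [al + lam] and the flow without killing.
    By Tonelli the last term integrates [f (phi v y)] against [1 - Wt v y], computed in [Wt_int]. *)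
Lemma Vz_Vop f y : nnm f ->
  Vz f y = Vop f y + Vz (fun z => (al + lam z)%:E * Vop f z) y.
Proof.
move=> f0.
have W0 t z : 0 <= ew t * Swt t z by rewrite mule_ge0 ?(nnm_ew al).2 ?Swt_ge0.
pose g (u v : R) : \bar R := ((0 <= u <= v)%R%:R * ((al + lam (phi u y)) * Wt (v - u) (phi u y)))%R%:E * f (phi v y).
have hg : nnm (fun z : R * R => g z.1 z.2).
  apply: nnmM; last first.
    by apply: (nnm_comp f0); apply: mphi.
  apply: nnm_EFin; last first.
    by move=> z; apply: mulr_ge0 => //; apply: mulr_ge0; [exact: alam_ge0|exact: Wt_ge0].
  apply: measurable_funM.
    apply: measurable_natr; apply: measurable_and; exact: measurable_fun_ler.
  have mp1 : measurable_fun setT (fun z : R * R => phi z.1 y) by exact: mphi.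
  apply: measurable_funM.
    by apply: measurable_funD => //; exact: (measurableT_comp (rt_meas hr) mp1).
  by apply: measurable_Wt => //; exact: measurable_funB.
have e1 : Vz (fun z => (al + lam z)%:E * Vop f z) y = \int[leb]_u \int[leb]_v g u v.
  apply: eq_integral => u _; have [u0|u0] := leP 0%R u; last first.
    by rewrite mul0e integral0_eq// => v _; rewrite /g leNgt u0 mul0r mul0e.
  rewrite mul1e.
  have h1 : nnm (fun t : R => ew t * Sop f (t, phi u y)).
    by apply: nnmM; [exact: nnm_ew|exact: (nnm_slice _ (nnm_Sop hs hr f0))].
  rewrite -(sf_scale (sf_integral leb) (alam_ge0 (phi u y)) h1).
  have h2 : nnm (fun v : R => g u v) by exact: (nnm_comp hg (@pair1_measurable _ _ R R u)).
  rewrite -[RHS](lebesgue_shift u h2); apply: eq_integral => t _; rewrite /g.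
  have [t0|t0] := leP 0%R t; last by rewrite ew_lt0// mul0e mule0 lerDr [(0 <= t)%R]leNgt t0 andbF mul0r mul0e.
  rewrite SopE (Swt_ge _ _ _ _ t0) ew_ge0// lerDr u0 t0 mul1r addrK.
  rewrite (phiD (sc_incr hs) (sc_cont hs) (sc_lim hs))// [(u + t)%R]addrC.
  by rewrite !muleA -!EFinM /Wt mulrA.
rewrite e1 (tonelli leb leb hg).
have hg' : nnm (fun v : R => \int[leb]_u g u v).
  exact: (nnm_int leb (F := fun v u => g u v) (nnm_comp hg (measurable_fun_pair (@measurable_snd _ _ R R) (@measurable_fst _ _ R R)))).
have hS : nnm (fun t : R => ew t * Sop f (t, y)).
  by apply: nnmM; [exact: nnm_ew|exact: (nnm_slice _ (nnm_Sop hs hr f0))].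
rewrite -(sf_add (sf_integral leb) hS hg'); apply: eq_integral => v _.
have [v0|v0] := leP 0%R v; last first.
  rewrite mul0e ew_lt0// mul0e add0e integral0_eq// => u _; rewrite /g.
  by case: andP => [[u0 uv]|_]; [move: (le_lt_trans (le_trans u0 uv) v0); rewrite ltxx|rewrite mul0r mul0e].
have fv : 0 <= f (phi v y) by exact: f0.2.
have hW : nnm (fun u : R => ((0 <= u <= v)%R%:R * ((al + lam (phi u y)) * Wt (v - u) (phi u y)))%R%:E).
  apply: nnm_EFin; last first.
    by move=> z; apply: mulr_ge0 => //; apply: mulr_ge0; [exact: alam_ge0|exact: Wt_ge0].
  apply: measurable_funM.
    by apply: measurable_natr; apply: measurable_and; exact: measurable_fun_ler.
  have mp1 : measurable_fun setT (fun z : R => phi z y) by exact: mphi.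
  apply: measurable_funM.
    by apply: measurable_funD => //; exact: (measurableT_comp (rt_meas hr) mp1).
  by apply: measurable_Wt => //; exact: measurable_funB.
have -> : \int[leb]_u g u v = (1 - Wt v y)%:E * f (phi v y).
  rewrite -(Wt_int y v0) -ge0_integralZr//; first exact: hW.1.
  by move=> u _; exact: hW.2.
rewrite mul1e SopE (Swt_ge _ _ _ _ v0) ew_ge0// muleA -EFinM -/(Wt v y).
have W1 : (0 <= 1 - Wt v y)%R.
  rewrite -lee_fin -(Wt_int y v0); apply: integral_ge0 => u _; exact: hW.2.
rewrite -ge0_muleDl ?lee_fin ?Wt_ge0//.
by rewrite -EFinD addrCA subrr addr0 mul1e.
Qed.

End resolvent.

(** * Domination of the minimal resolvent *)

Section minimality.
Context (R : realType).
Local Notation E := (posreal R).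
Local Notation leb := (@lebesgue_measure R).
Context (s : E -> R) (kap : R.-ker E ~> E) (lam : E -> R) (b al : R).
Hypothesis hs : scale s.
Hypothesis hr : rates kap lam b.
Hypothesis b_al : b < al.
Local Notation V := (Vop s lam b al).
Local Notation Vz := (Vz s).
Local Notation kint := (kint kap).
Local Open Scope ereal_scope.

Variables (U : (E -> \bar R) -> \bar R) (x : E).
Hypothesis sU : sfunctional U.
Hypothesis U1 : U (fun=> 1) < +oo.
(** The transformed forward equation for [tst], with the negative terms moved to the left; [b * tst]
    is added on both sides so that [lam] enters through the nonnegative [lam + b]. *)
Hypothesis hU : forall (n : R) (a : E) (B C : R), (0 < n)%R ->
  al%:E * U (fun y => (tst s n a B C y)%:E) +
  U (fun y => (chi n (s a) (s y) * (B <= s y < C)%R%:R + (lam y + b) * tst s n a B C y)%R%:E) =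
  (tst s n a B C x)%:E +
  U (fun y => (chi' n (s a) (s y) * cap B C (s y) + b * tst s n a B C y)%R%:E +
    kint (fun z => (tst s n a B C z)%:E) y).

Let b0 := rt_b0 hr.
Let ms : measurable_fun setT s := continuous_measurable_posreal (sc_cont hs).

Let al0 : (0 <= al)%R.
Proof. by rewrite (le_trans b0)// ltW. Qed.

Let wl (y : E) : \bar R := (al + (lam y + b))%:E.

Let wl0 : nnm wl.
Proof.
apply: nnm_EFin; last by move=> y; rewrite addr_ge0// (lamb_ge0 hr).
by apply: measurable_funD => //; apply: measurable_funD => //; exact: (rt_meas hr).
Qed.

Let al_lam0 : nnm (fun y => (al + lam y)%:E : \bar R).
Proof.
apply: nnm_EFin; last by move=> y; exact: (alam_ge0 hr b_al).
by apply: measurable_funD => //; exact: (rt_meas hr).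
Qed.

Lemma nnm_itv (B C : R) : nnm (fun y : E => (B <= s y < C)%R%:R%:E : \bar R).
Proof.
apply: nnm_EFin => //; apply: measurable_natr; apply: measurable_and.
  exact: measurable_fun_ler.
exact: measurable_fun_ltr.
Qed.

Lemma nnm_chi (n : R) (a : E) : nnm (fun y => (chi n (s a) (s y))%:E : \bar R).
Proof.
apply: nnm_EFin; last by move=> y; exact: chi_ge0.
apply: measurable_minr => //; apply: measurable_maxr => //.
by apply: measurable_funM => //; exact: measurable_funB.
Qed.

Section cutoff.
Variables (n : R) (a : E).
Hypothesis n0 : (0 < n)%R.
Let X (y : E) : \bar R := (chi n (s a) (s y))%:E.
Let X' (y : E) : \bar R := (chi' n (s a) (s y))%:E.

Let X0 : nnm X.
Proof. exact: nnm_chi. Qed.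

Let X'0 : nnm X'.
Proof.
apply: nnm_EFin; last by move=> y; rewrite /chi'; case: ifP => // _; exact: ltW.
apply: measurable_fun_ifT => //; apply: measurable_and.
  exact: measurable_fun_ler.
exact: measurable_fun_ltr.
Qed.

(** The parts of [hU] that depend on [Vz F], with an arbitrary [W] in its place, so that they can be
    split along [Vz f = V f + Vz ((al + lam) * V f)]. *)
Let Lf (W : E -> \bar R) := U (fun y => X y * (wl y * W y)).
Let Rk (W : E -> \bar R) y := X' y * W y + (b%:E * (X y * W y) + kint (fun z => X z * W z) y).
Let Rf (W : E -> \bar R) := X x * W x + U (Rk W).

Let sf_Lf : sfunctional Lf.
Proof.
have h1 : nnm (fun y => X y * wl y) by exact: nnmM.
have := sf_weight sU h1.
by rewrite (_ : (fun f => _) = Lf)//; apply/funext => W; apply: sf_ext => y; rewrite muleA.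
Qed.

Let sf_UX : sfunctional (fun F => U (fun y => X y * F y)).
Proof. exact: sf_weight. Qed.

Let nnm_kX W : nnm W -> nnm (fun y => kint (fun z => X z * W z) y).
Proof. by move=> W0; apply: (nnm_kint hr); exact: nnmM. Qed.

Let nnm_bX W : nnm W -> nnm (fun y => b%:E * (X y * W y)).
Proof. by move=> W0; apply: nnmM; [apply: nnm_cst; rewrite lee_fin|exact: nnmM]. Qed.

Let nnm_Rk W : nnm W -> nnm (Rk W).
Proof.
move=> W0; apply: nnmD; first exact: nnmM.
by apply: nnmD; [exact: nnm_bX|exact: nnm_kX].
Qed.

Let sf_Rf : sfunctional Rf.
Proof.
apply: sf_addf; first by apply: sf_cscale; [exact: X0.2|exact: sf_dirac].
apply: (@sf_comp _ _ E E R U (fun y W => Rk W y) sU); last by move=> W W0; exact: (nnm_Rk W0).1.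
move=> y; apply: sf_addf; first by apply: sf_cscale; [exact: X'0.2|exact: sf_dirac].
apply: sf_addf.
  apply: sf_cscale; first by rewrite lee_fin.
  by apply: sf_cscale; [exact: X0.2|exact: sf_dirac].
exact: (sf_weight (sf_integral (kap y)) X0).
Qed.

Let LHS F := Lf (Vz F) + U (fun y => X y * F y).
Let RHS F := Rf (Vz F).

Let sf_VzL (I : (E -> \bar R) -> \bar R) : sfunctional I -> sfunctional (fun F => I (Vz F)).
Proof.
move=> sI; apply: (@sf_comp _ _ E E R I (fun y F => Vz F y) sI); first exact: sf_Vz.
by move=> F F0; exact: (nnm_Vz hs F0).1.
Qed.

Let sf_LHS : sfunctional LHS.
Proof. by apply: sf_addf => //; exact: sf_VzL. Qed.

Let sf_RHS : sfunctional RHS.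
Proof. exact: sf_VzL. Qed.

Let ind B C (y : E) : \bar R := (B <= s y < C)%R%:R%:E.

Let tst0 B C : nnm (fun y => (tst s n a B C y)%:E).
Proof. by apply: nnm_EFin; [exact: (measurable_tst hs)|exact: tst_ge0]. Qed.

Let tstE B C (y : E) : X y * Vz (ind B C) y = (tst s n a B C y)%:E.
Proof. by rewrite (Vz_itv hs). Qed.

Let LHS_RHS B C : LHS (ind B C) = RHS (ind B C).
Proof.
have i0 := nnm_itv B C.
have l0 : nnm (fun y => (chi n (s a) (s y) * (B <= s y < C)%R%:R + (lam y + b) * tst s n a B C y)%R%:E).
  apply: nnm_EFin; last first.
    by move=> y; apply: addr_ge0; apply: mulr_ge0; rewrite ?chi_ge0 ?(lamb_ge0 hr) ?tst_ge0.
  apply: measurable_funD.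
    apply: measurable_funM; first by have /measurable_EFinP := X0.1.
    by have /measurable_EFinP := i0.1.
  apply: measurable_funM; last exact: (measurable_tst hs).
  by apply: measurable_funD => //; exact: (rt_meas hr).
transitivity (al%:E * U (fun y => (tst s n a B C y)%:E) +
  U (fun y => (chi n (s a) (s y) * (B <= s y < C)%R%:R + (lam y + b) * tst s n a B C y)%R%:E)).
  rewrite /LHS /Lf -(sf_scale sU al0 (tst0 B C)).
  have h1 : nnm (fun y => X y * (wl y * Vz (ind B C) y)).
    by apply: nnmM => //; apply: nnmM => //; exact: (nnm_Vz hs).
  have h2 : nnm (fun y => X y * ind B C y) by exact: nnmM.
  have h3 : nnm (fun y => al%:E * (tst s n a B C y)%:E).
    by apply: nnmM => //; apply: nnm_cst; rewrite lee_fin.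
  rewrite -(sf_add sU h1 h2) -(sf_add sU h3 l0); apply: sf_ext => y.
  rewrite muleCA tstE /X /wl /ind -!EFinM -!EFinD; congr EFin; ring.
rewrite (hU a B C n0) /RHS /Rf tstE; congr (_ + _); apply: sf_ext => y.
rewrite /Rk tstE (_ : (fun z => X z * Vz (ind B C) z) = fun z => (tst s n a B C z)%:E); last first.
  by apply/funext => z; rewrite tstE.
rewrite (Vz_itv hs); exact: (esym (addeA (chi' n (s a) (s y) * cap B C (s y))%R%:E
  (b * tst s n a B C y)%R%:E (kint (fun z => (tst s n a B C z)%:E) y))).
Qed.

(** Between the levels [s a] and [C] the rate [lam] is bounded, and elsewhere the integrands
    vanish. *)
Let LHS_fin B C : LHS (ind B C) < +oo.
Proof.
pose c := Num.max C (s a).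
have [c0 sc] : exists c0, s c0 = c.
  by apply: (s_surj (sc_cont hs) (sc_lim hs) (x := a)); rewrite le_max lexx orbT.
have [M hM] := locally_boundedP (val c0) (rt_lb hr) (val_gt0 a).
pose K : R := ((al + (`|M| + b)) * `|C - B| + 1)%R.
have K0 : (0 <= K)%R by rewrite addr_ge0// mulr_ge0// !addr_ge0.
have h1 : nnm (fun y => X y * (wl y * Vz (ind B C) y)).
  by apply: nnmM => //; apply: nnmM => //; exact/(nnm_Vz hs)/nnm_itv.
have h2 : nnm (fun y => X y * ind B C y) by apply: nnmM => //; exact: nnm_itv.
rewrite /LHS /Lf -(sf_add sU h1 h2).
have one0 : nnm (fun _ : E => 1 : \bar R) by apply: nnm_cst; exact: lee01.
have k1 : nnm (fun _ : E => K%:E * 1) by apply: nnm_cst; rewrite mule1 lee_fin.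
apply: (@le_lt_trans _ _ (U (fun=> K%:E * 1))).
  apply: (sf_le sU) => //; first exact: nnmD.
  move=> y; rewrite mule1 muleCA tstE /X /ind /wl -!EFinM -EFinD lee_fin.
  have chi0 := chi_ge0 n (s a) (s y); have chi1 := chi_le1 n (s a) (s y).
  have [ya|ay] := leP (s y) (s a).
    by rewrite /tst chi_eq0 ?(ltW n0)// !mul0r mulr0 addr0.
  have [yC|Cy] := ltP (s y) C; last first.
    by rewrite /tst cap_eq0// mulr0 mulr0 andbF mulr0 addr0.
  have lM : (lam y <= `|M|)%R.
    apply: (le_trans (ler_norm _)); apply: le_trans (ler_norm M); apply: hM.
    by rewrite -!(s_le (sc_incr hs)) (ltW ay) sc le_max (ltW yC).
  apply: lerD.
    apply: ler_pM; [by rewrite addr_ge0// (lamb_ge0 hr)|exact: tst_ge0|by rewrite lerD2l lerD2r|].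
    by rewrite -[leLHS]ger0_norm ?tst_ge0// tst_le.
  by rewrite mulr_ile1// ?lern1 ?leq_b1.
by rewrite (sf_scale sU K0 one0) lte_mul_pinfty// ge0_fin_numE// (sf_ge0 sU one0).
Qed.

Let cut C (F : E -> \bar R) (y : E) : \bar R := (s y < C)%R%:R%:E * F y.

(** Cut at [C], closed rays become the intervals [[B, C)], where equality and finiteness are known;
    the uniqueness on rays then gives every [F]. *)
Let eq_cut C F : nnm F -> LHS (cut C F) = RHS (cut C F).
Proof.
have hc : nnm (fun y : E => (s y < C)%R%:R%:E : \bar R).
  by apply: nnm_EFin => //; apply: measurable_natr; exact: measurable_fun_ltr.
have e (I : (E -> \bar R) -> \bar R) B : I (cut C (fun y => (\1_(ray true B) (s y))%:E)) = I (ind B C).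
  apply: sf_ext => y; rewrite /cut /ind -EFinM; congr EFin.
  rewrite indicE /ray (_ : (s y \in _) = (B <= s y)%R); last first.
    by apply/idP/idP => [/set_mem/=|h]; rewrite ?in_itv/= ?andbT//; apply/mem_set; rewrite /= in_itv/= h.
  by case: (B <= s y)%R; case: (s y < C)%R; rewrite ?mul1r ?mul0r ?mulr0 ?mulr1.
move=> F0.
have eLR B : LHS (cut C (fun y => (\1_(ray true B) (s y))%:E)) = RHS (cut C (fun y => (\1_(ray true B) (s y))%:E)).
  by rewrite !e; exact: LHS_RHS.
have fLR B : LHS (cut C (fun y => (\1_(ray true B) (s y))%:E)) < +oo.
  by rewrite e; exact: LHS_fin.
have sL : sfunctional (fun F => LHS (cut C F)) := sf_weight sf_LHS hc.
have sR : sfunctional (fun F => RHS (cut C F)) := sf_weight sf_RHS hc.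
exact: (sf_ray_unique_scale hs sL sR eLR fLR F0).
Qed.

Let eq_supp C F : nnm F -> (forall y, (C <= s y)%R -> F y = 0) -> LHS F = RHS F.
Proof.
move=> F0 FC; have <- : cut C F = F; last exact: eq_cut.
apply/funext => y; rewrite /cut; case: ltP => h /=; first by rewrite mul1e.
by rewrite FC// mule0.
Qed.

(* The instances [F = f] and [F = (al + lam) * V f] of the cutoff identity are
   subtracted; they differ by [Vz f = V f + Vz ((al + lam) * V f)]. *)
Lemma cutoff_ineq (C c : R) f : nnm f -> (0 <= c)%R ->
  (forall y, f y <= c%:E * (s a <= s y < C)%R%:R%:E) ->
  X x * V f x + U (kint (fun y => X y * V f y)) <= U f.
Proof.
move=> f0 c0 fc.
have fC y : (C <= s y)%R -> f y = 0.
  move=> Cy; apply/eqP; rewrite eq_le f0.2 andbT (le_trans (fc y))//.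
  by rewrite ltNge Cy andbF mule0.
have W0 := nnm_Vop al hs hr f0; set W := V f in W0 *.
pose F2 y := (al + lam y)%:E * W y.
have F20 : nnm F2 by exact: nnmM.
have F2C y : (C <= s y)%R -> F2 y = 0.
  move=> Cy; rewrite /F2 (_ : W y = 0) ?mule0//.
  transitivity (Lap al (fun=> 0)); last exact: (sf0 (sf_Lap al)).
  apply: Lap_ext => t t0.
  rewrite SopE fC ?mule0// (s_phi (sc_incr hs) (sc_cont hs) (sc_lim hs))//.
  by rewrite (le_trans Cy)// lerDl.
have Y0 := nnm_Vz hs F20; set Y := Vz F2 in Y0.
have VzE : Vz f = fun y => W y + Y y.
  by apply/funext => y; exact: (Vz_Vop hs hr b_al y f0).
have e1 := eq_supp f0 fC; have e2 := eq_supp F20 F2C.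
(* [f] is bounded by a multiple of one indicator; finiteness is what allows the subtraction
   below. *)
have fin : LHS f < +oo.
  have hc : nnm (fun _ : E => c%:E) by apply: nnm_cst; rewrite lee_fin.
  have h := sf_le sf_LHS f0 (nnmM hc (nnm_itv (s a) C)) fc.
  apply: (le_lt_trans h).
  rewrite (sf_scale sf_LHS c0 (nnm_itv (s a) C)) lte_mul_pinfty//; last exact: LHS_fin.
have XW0 : nnm (fun y => X y * W y) by exact: nnmM.
have XW2 : nnm (fun y => X y * F2 y) by exact: nnmM.
have X'W : nnm (fun y => X' y * W y) by exact: nnmM.
have LW : Lf W = U (fun y => X y * F2 y) + b%:E * U (fun y => X y * W y).
  rewrite /Lf -(sf_scale sU b0 XW0) -(sf_add sU XW2 (nnm_bX W0)); apply: sf_ext => y.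
  rewrite /F2 /wl addrA [(al + lam y + b)%:E]EFinD ge0_muleDl.
  - by rewrite ge0_muleDr ?mule_ge0 ?lee_fin ?(alam_ge0 hr b_al) ?W0.2// muleCA [X y * (b%:E * _)]muleCA.
  - by rewrite lee_fin (alam_ge0 hr b_al).
  - by rewrite lee_fin.
have RW : Rf W = X x * W x + (U (fun y => X' y * W y) + (b%:E * U (fun y => X y * W y) + U (kint (fun y => X y * W y)))).
  rewrite /Rf; congr (_ + _).
  rewrite -(sf_scale sU b0 XW0) -(sf_add sU (nnm_bX W0) (nnm_kX W0)).
  rewrite -(sf_add sU X'W (nnmD (nnm_bX W0) (nnm_kX W0))).
  by [].
move: fin e1; rewrite /LHS /RHS VzE (sf_add sf_Lf W0 Y0) (sf_add sf_Rf W0 Y0).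
move: e2; rewrite /LHS /RHS -/Y => <-; rewrite LW RW.
set A := Lf Y; set P := U (fun y => X y * F2 y); set Q := b%:E * _.
set Z := U (fun y => X y * f y); set D := U (fun y => X' y * W y).
set KK := U (kint _); set WX := X x * W x.
have hA : 0 <= A by exact: (sf_ge0 sf_Lf Y0).
have hP : 0 <= P by exact: (sf_ge0 sU XW2).
have hQ : 0 <= Q by rewrite mule_ge0 ?lee_fin//; exact: (sf_ge0 sU XW0).
have hZ : 0 <= Z by exact: (sf_ge0 sf_UX f0).
have hD : 0 <= D by exact: (sf_ge0 sU X'W).
have hK : 0 <= KK by exact: (sf_ge0 sU (nnm_kX W0)).
have hWX : 0 <= WX by exact: (XW0.2 x).
move=> fin e.
have ZU : Z <= U f.
  apply: (sf_le sU) => // [|y]; first exact: nnmM.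
  by rewrite gee_pMl ?f0.2// ?lee_fin ?chi_le1 ?chi_ge0.
apply: le_trans ZU.
have fT : P + Q + A \is a fin_num.
  rewrite ge0_fin_numE ?adde_ge0//; apply: le_lt_trans fin; exact: leeDl.
have : P + Q + A + Z = P + Q + A + (WX + (D + KK)).
  rewrite e [D + (Q + KK)]addeCA [WX + (Q + _)]addeCA addeAC; congr (_ + _).
  by rewrite [A + P]addeC addeA [Q + P]addeC.
move/(congr1 (fun z => z - (P + Q + A))); rewrite ![P + Q + A + _]addeC !addeK// => ->.
(* [D] comes from the derivative of the cutoff. Only its sign is known, so it is dropped and the
   equality does not survive. *)
by rewrite leeD2l// leeDr.
Qed.

End cutoff.

(** The cutoffs are removed by monotone convergence: the ramps start at [a k], tending to 0, with
    slope [k + 1], and [f] is truncated in position and in height so that [cutoff_ineq] applies to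
    [fk k]. *)
Lemma min_ineq f : nnm f -> V f x + U (kint (V f)) <= U f.
Proof.
move=> f0.
pose a (k : nat) : E := to_posreal (k.+1%:R^-1 : R)%R.
have va k : val (a k) = (k.+1%:R^-1 : R)%R by rewrite val_to_posreal// invr_gt0.
have da i j : (i <= j)%N -> (s (a j) <= s (a i))%R.
  by move=> ij; apply: (s_leW (sc_incr hs)); rewrite !va lef_pV2 ?posrE// ler_nat.
(* Eventually the ramp is over before the level [s y], so [chi] is 1 at [y]. *)
have aev y : \forall k \near \oo, (s (a k) + k.+1%:R^-1 <= s y)%R.
  pose v : R := (val y / 2)%R; have y0 := val_gt0 y.
  have v0 : (0 < v)%R by rewrite divr_gt0.
  pose d : R := (s y - s (to_posreal v))%R.
  have d0 : (0 < d)%R.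
    by rewrite subr_gt0 (s_lt (sc_incr hs)) val_to_posreal// ltr_pdivrMr// ltr_pMr// ltr1n.
  exists (Num.truncn (v^-1 + d^-1)%R).+1 => // k /= hk.
  have hk' : (v^-1 + d^-1 <= k.+1%:R)%R.
    by rewrite (le_trans (ltW (truncnS_gt _)))// ler_nat; exact: leqW.
  have vi : (0 < v^-1)%R by rewrite invr_gt0.
  have di : (0 < d^-1)%R by rewrite invr_gt0.
  have k1 : (0 < k.+1%:R :> R)%R by [].
  have h1 : (k.+1%:R^-1 <= v)%R.
    by rewrite -[leRHS]invrK lef_pV2 ?posrE//; apply: le_trans hk'; rewrite lerDl ltW.
  have h2 : (k.+1%:R^-1 <= d)%R.
    by rewrite -[leRHS]invrK lef_pV2 ?posrE//; apply: le_trans hk'; rewrite lerDr ltW.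
  have h3 : (s (a k) <= s (to_posreal v))%R.
    by apply: (s_leW (sc_incr hs)); rewrite va val_to_posreal.
  by rewrite (le_trans (lerD h3 h2))// /d addrC subrK.
pose fk (k : nat) y : \bar R := (s (a k) <= s y < k%:R)%R%:R%:E * mine (f y) k%:R%:E.
have mn0 k : nnm (fun y => mine (f y) (k%:R : R)%R%:E).
  split; first by apply: measurable_mine => //; exact: f0.1.
  by move=> y; rewrite le_min f0.2 lee_fin ler0n.
have fk0 k : nnm (fk k) by apply: nnmM => //; exact: nnm_itv.
have ndfk y : nondecreasing_seq (fk^~ y).
  move=> i j ij; rewrite /fk; apply: lee_pmul => //; rewrite ?lee_fin//.
  - exact: (mn0 i).2.
  - have [h|//] := boolP (s (a i) <= s y < i%:R)%R; move: h => /andP[h1 h2].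
    by rewrite (le_trans (da _ _ ij) h1) (lt_le_trans h2)// ler_nat.
  - by rewrite le_min !ge_min lexx /= lee_fin ler_nat ij orbT.
have limfk y : limn (fk^~ y) = f y.
  have ev : \forall k \near \oo, mine (f y) (k%:R : R)%R%:E = fk k y.
    near=> k; rewrite /fk (_ : (s (a k) <= s y < k%:R)%R) ?mul1e//; apply/andP; split.
      have h : (s (a k) + k.+1%:R^-1 <= s y)%R by near: k; exact: aev.
      by apply: le_trans h; rewrite lerDl.
    near: k; exists (Num.truncn `|s y|).+1 => // k /= hk.
    rewrite (le_lt_trans (ler_norm _))// (lt_le_trans (truncnS_gt _))// ler_nat.
    by [].
  apply/cvg_lim => //; apply: cvg_trans (near_eq_cvg ev) _.
  have := f0.2 y; case: (f y) => [r _|_|//].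
    apply: cvg_near_cst; exists (Num.truncn `|r|).+1 => // k /= hk; apply/min_idPl.
    rewrite lee_fin (le_trans (ler_norm _))// (le_trans (ltW (truncnS_gt _)))// ler_nat.
    by [].
  rewrite (_ : (fun k : nat => _) = fun k : nat => (k%:R : R)%R%:E).
    by apply/cvgeryP; exact: cvgr_idn.
  by apply/funext => k; apply/min_idPr; exact: leey.
pose Xk (k : nat) y : \bar R := (chi k.+1%:R (s (a k)) (s y))%:E.
pose G k y := Xk k y * V (fk k) y.
have Vk0 k := nnm_Vop al hs hr (fk0 k).
have Xk0 k : nnm (Xk k) by exact: nnm_chi.
have G0 k : nnm (G k) by exact: nnmM.
have ndXk y : nondecreasing_seq (Xk^~ y).
  move=> i j ij; rewrite lee_fin.
  have [sy|sy] := leP (s y) (s (a i)); first by rewrite chi_eq0// chi_ge0.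
  rewrite /chi le_min !ge_min lexx /=; apply/orP; right.
  rewrite ge_max !le_max lexx /=; apply/orP; right.
  by apply: ler_pM; rewrite ?ler_nat ?subr_ge0 ?(ltW sy)// lerD2l lerN2 da.
have ndV y : nondecreasing_seq (fun k => V (fk k) y).
  by move=> i j ij; apply: (sf_le (sf_Vop al hs hr y) (fk0 i) (fk0 j)) => z; exact: ndfk.
have ndG y : nondecreasing_seq (G^~ y).
  move=> i j ij; apply: lee_pmul; [exact: (Xk0 i).2|exact: (Vk0 i).2|exact: ndXk|exact: ndV].
have limG y : limn (G^~ y) = V f y.
  rewrite -[in RHS](_ : (fun y => limn (fk^~ y)) = f); last exact/funext.
  rewrite (sf_lim (sf_Vop al hs hr y) fk0 ndfk).
  apply/cvg_lim => //; have h := ereal_nondecreasing_is_cvgn (ndV y).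
  apply: cvg_trans h; apply: near_eq_cvg; near=> k; rewrite /G /Xk chi_eq1 ?mul1e//.
  by near: k; exact: aev.
have sfI : sfunctional (fun W => W x + U (kint W)).
  apply: sf_addf; first exact: sf_dirac.
  apply: (@sf_comp _ _ E E R U (fun y W => kint W y) sU).
    by move=> y; exact: sf_integral.
  by move=> W W0; exact: (nnm_kint hr W0).1.
have e := sf_lim sfI G0 ndG.
rewrite (_ : (fun y => limn (G^~ y)) = V f) in e; last exact/funext.
rewrite limG in e; rewrite e; apply: limn_le => [i j ij|k].
  by apply: (sf_le sfI (G0 i) (G0 j)) => y; exact: ndG.
have k1 : (0 < k.+1%:R :> R)%R by [].
apply: le_trans (cutoff_ineq (a := a k) k1 (C := k%:R) (c := k%:R) (fk0 k) _ _) _ => //.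
  by move=> y; rewrite /fk muleC lee_wpmul2r ?lee_fin// ge_min lexx orbT.
apply: (sf_le sU (fk0 k) f0) => y; rewrite -limfk.
by apply: (@le_limn _ (fk^~ y)); exact: ndfk.
Unshelve. all: by end_near. Qed.

(** Apply [min_ineq], and the induction hypothesis to [kint (V f)] in place of [f]. *)
Lemma Rn_le_U n f : nnm f -> Rn s kap lam b al n f x <= U f.
Proof.
elim: n f => [|n ih] f f0; first exact: (sf_ge0 sU f0).
rewrite (Rn_comm al hs hr n x f0); apply: le_trans (min_ineq f0).
by apply: leeD2l; exact: (ih _ (nnm_kint hr (nnm_Vop al hs hr f0))).
Qed.

End minimality.

Lemma fin_num_lty (R : realType) (z : \bar R) : z \is a fin_num -> (z < +oo)%E.
Proof. by rewrite fin_numElt => /andP[]. Qed.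

Lemma mass_balance (R : realType) (al b u q u' q' : R) : al * u' + q' = 1 + b * u' ->
  al * u + q = 1 + b * u -> q' <= q -> al * u - b * u <= al * u' - b * u'.
Proof. lra. Qed.

Lemma add_squeeze (R : realType) (u v u' v' : R) : u + v = u' + v' -> u' <= u -> v' <= v -> u <= u'.
Proof. lra. Qed.

(** * Uniqueness *)

Section uniqueness.
Context (R : realType).
Local Notation E := (posreal R).
Local Notation leb := (@lebesgue_measure R).
Context (s : E -> R) (kap : R.-ker E ~> E) (lam : E -> R) (b : R).
Hypothesis hs : scale s.
Hypothesis hr : rates kap lam b.
Local Notation gen := (gen kap lam).
Local Notation kreal := (kreal kap).
Local Notation kint := (kint kap).

Let b0 := rt_b0 hr.

Let one0 : nnm (fun _ : E => 1%E : \bar R).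
Proof. by apply: nnm_cst; exact: lee01. Qed.

Lemma measurable_gen (g D : E -> R) (M : R) : measurable_fun setT g -> measurable_fun setT D ->
  (forall y, `|g y| <= M) -> measurable_fun setT (gen g D).
Proof.
move=> mg mD gM; apply: measurable_funD; last exact: (measurable_kreal hr mg gM).
by apply: measurable_funB => //; apply: measurable_funM => //; exact: (rt_meas hr).
Qed.

Lemma EFin_kreal (g : E -> R) (M : R) y : measurable_fun setT g -> (forall y, `|g y| <= M) ->
  (kreal g y)%:E = kint (fun z => (g z)%:E) y.
Proof.
move=> mg gM; rewrite /kreal fineK//.
exact: (integrable_fin_num measurableT (kap_integrable hr y mg gM)).
Qed.

Lemma kreal1E y : kreal (fun=> 1) y = fine (kap y setT).
Proof. exact: kreal1. Qed.

(** This is [b - c] of the mass balance, [c] being [r - lam]. *)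
Definition qrate (y : E) : R := lam y + b - kreal (fun=> 1) y.

Lemma measurable_kreal1 : measurable_fun setT (kreal (fun=> 1)).
Proof. by apply: (@measurable_kreal _ _ _ _ hr _ 1) => // y; rewrite normr1. Qed.

Lemma qrate_ge0 y : 0 <= qrate y.
Proof. by rewrite /qrate kreal1E; have := rt_ge hr y; rewrite subr_ge0 lerBlDr. Qed.

Lemma measurable_qrate : measurable_fun setT qrate.
Proof.
apply: measurable_funB; last exact: measurable_kreal1.
by apply: measurable_funD => //; exact: (rt_meas hr).
Qed.

Section family.
Variables (m : R -> {measure set E -> \bar R}) (x : E).
Hypothesis m0 : forall t, t < 0 -> m t setT = 0%E.
Hypothesis hm : tests s m x gen.

Let nnmf := nnm_family hs measurable_gen m0 hm.
Let mg1 : measurable_fun setT (gen (fun=> 1) (fun=> 0)) := measurable_L1 measurable_gen.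

Lemma occ_abs (f : E -> R) g t : measurable_fun setT f -> fwd m x g f -> 0 <= t ->
  (occ m t (fun y => `|f y|%:E) < +oo)%E.
Proof.
move=> mf hf t0; have [_ _ fin _] := hf t t0; apply: le_lt_trans fin.
have ha : nnm (fun y : E => `|f y|%:E) by apply: nnm_EFin => //; exact: measurableT_comp.
rewrite int_patch le_eqVlt; apply/orP; left; apply/eqP; apply: eq_integral => u _; rewrite /patch.
have [u0|u0] := leP 0 u; first by rewrite mem_set.
by rewrite (family0 m0 ha u0) memNset//= leNgt u0.
Qed.

(** The decomposition [|f| - (|f| - f)]: both parts have finite occupation integrals, since the
    integrability clause is about [|f|]. *)
Lemma fwd_abs (f g : E -> R) t : measurable_fun setT f -> fwd m x g f -> 0 <= t ->
  (\int[m t]_y (g y)%:E + occ m t (fun y => (`|f y| - f y)%:E) =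
   (g x)%:E + occ m t (fun y => `|f y|%:E))%E.
Proof.
move=> mf hf t0; have ma : measurable_fun setT (fun y => `|f y|) by exact: measurableT_comp.
apply: (fwd_occ hs measurable_gen m0 hm mf hf ma _ _ _ _ t0) => //.
- exact: measurable_funB.
- by move=> y; rewrite subr_ge0 ler_norm.
- by move=> y; rewrite opprB addrC subrK.
Qed.

Lemma nnm_absB (f : E -> R) : measurable_fun setT f -> nnm (fun y => (`|f y| - f y)%:E).
Proof.
move=> mf; apply: nnm_EFin; last by move=> y; rewrite subr_ge0 ler_norm.
by apply: measurable_funB => //; exact: measurableT_comp.
Qed.

Lemma mass_occ t : 0 <= t ->
  (m t setT + occ m t (fun y => (qrate y)%:E) = 1 + occ m t (fun=> b%:E))%E.
Proof.
move=> t0.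
have e y : gen (fun=> 1) (fun=> 0) y = b - qrate y by rewrite /gen /qrate; ring.
have h := fwd_occ hs measurable_gen m0 hm mg1 hm.1 (measurable_cst (b : R)) measurable_qrate
  (fun _ => b0) qrate_ge0 e t0.
have e1 : (m t setT = \int[m t]_y 1%:E)%E by rewrite integral_cst// mul1e.
exact: (etrans (adde_eq e1 erefl) h).
Qed.

Section resolvent_family.
Variable al : R.
Hypothesis b_al : b < al.

Let al0 : 0 < al. Proof. exact: le_lt_trans b0 b_al. Qed.

Definition Ures (f : E -> \bar R) : \bar R := Lap al (fun t => \int[m t]_y f y)%E.

Lemma sf_Ures : sfunctional Ures.
Proof.
exact: (@sf_comp _ _ (measurableTypeR R) E R (Lap al) (fun u (f : E -> \bar R) => \int[m u]_y f y)%E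
  (sf_Lap al) (fun u => sf_integral (m u)) (fun f hf => (nnmf hf).1)).
Qed.

Lemma Lap_occ f : nnm f -> (al%:E * Lap al (fun t => occ m t f) = Ures f)%E.
Proof.
move=> f0; apply: (Lap_int al0 (nnmf f0)) => u u0.
exact: (family0 m0 f0 u0).
Qed.

Lemma nnm_occ f : nnm f -> nnm (fun t => occ m t f).
Proof.
move=> f0; apply: (@nnm_int _ _ _ _ _ leb (fun t u => ((u <= t)%R%:R%:E * \int[m u]_y f y)%E)).
apply: nnmM; first exact: nnm_ler.
exact: (nnm_comp (nnmf f0)).
Qed.

Lemma lap_fwd (A : R -> \bar R) (n p : E -> \bar R) (c : R) : nnm A -> nnm n -> nnm p -> 0 <= c ->
  (forall t : R, 0 <= t -> (A t + occ m t n = c%:E + occ m t p)%E) ->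
  (al%:E * Lap al A + Ures n = c%:E + Ures p)%E.
Proof.
move=> A0 n0 p0 c0 e.
have oneR : nnm (fun _ : R => 1%E : \bar R) by apply: nnm_cst; exact: lee01.
have c1 : nnm (fun _ : R => c%:E * 1 : \bar R)%E by apply: nnm_cst; rewrite mule1 lee_fin.
have al0e : (0 <= al%:E)%E by rewrite lee_fin ltW.
rewrite -(Lap_occ n0) -(Lap_occ p0) -ge0_muleDr; [|exact: (sf_ge0 (sf_Lap al) A0)|exact: (sf_ge0 (sf_Lap al) (nnm_occ n0))].
rewrite -(sf_add (sf_Lap al) A0 (nnm_occ n0)).
rewrite (_ : Lap al _ = Lap al (fun t => c%:E * 1 + occ m t p)%E); last first.
  by apply: Lap_ext => t t0; rewrite mule1 e.
rewrite (sf_add (sf_Lap al) c1 (nnm_occ p0)) ge0_muleDr; [|exact: (sf_ge0 (sf_Lap al) c1)|exact: (sf_ge0 (sf_Lap al) (nnm_occ p0))].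
by rewrite (sf_scale (sf_Lap al) c0 oneR) muleCA Lap_one// mule1.
Qed.

Lemma nnm_mass : nnm (fun t => m t setT).
Proof.
have := nnmf one0; rewrite (_ : (fun t => _) = fun t => m t setT)//.
by apply/funext => t; rewrite integral_cst// mul1e.
Qed.

Lemma Ures1E : Ures (fun=> 1%E) = Lap al (fun t => m t setT).
Proof. by apply: Lap_ext => t _; rewrite integral_cst// mul1e. Qed.

(** The equation for the constant 1 bounds the mass by 1 plus [b] times its primitive, as
    [Lap_gronwall] wants; the local bound on the mass comes from the integrability clause. *)
Lemma Ures1_fin : (Ures (fun=> 1%E) < +oo)%E.
Proof.
rewrite Ures1E; apply: le_lt_trans (ltry (al - b)^-1).
have q0 := nnm_EFin measurable_qrate qrate_ge0.
apply: Lap_gronwall => //.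
- exact: nnm_mass.
- move=> T.
  pose T' := Num.max T 0.
  have T'0 : 0 <= T' by rewrite le_max lexx orbT.
  have ha : nnm (fun y : E => `|gen (fun=> 1) (fun=> 0) y|%:E).
    by apply: nnm_EFin => //; exact: measurableT_comp.
  have fin := occ_abs mg1 hm.1 T'0.
  have f0 := sf_ge0 (sf_occ hs measurable_gen m0 hm T') ha.
  exists (1 + fine (occ m T' (fun y => `|gen (fun=> 1) (fun=> 0) y|%:E))) => t tT.
  rewrite EFinD fineK ?ge0_fin_numE//.
  have [t0|t0] := leP 0 t; last by rewrite m0// adde_ge0.
  have := fwd_abs mg1 hm.1 t0; rewrite integral_cst// mul1e => e.
  have h1 : (m t setT <= m t setT + occ m t (fun y => (`|gen (fun=> 1) (fun=> 0) y| - gen (fun=> 1) (fun=> 0) y)%:E))%E.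
    by apply: leeDl; exact: (sf_ge0 (sf_occ hs measurable_gen m0 hm t) (nnm_absB mg1)).
  apply: (le_trans h1); rewrite e; apply: leeD2l.
  apply: ge0_le_integral => //.
  + by move=> u _; rewrite mule_ge0// (nnmf ha).2.
  + apply: emeasurable_funM; last exact: (nnmf ha).1.
    exact: (nnm_ler (@measurable_id _ R setT) (measurable_cst t)).1.
  + apply: emeasurable_funM; last exact: (nnmf ha).1.
    exact: (nnm_ler (@measurable_id _ R setT) (measurable_cst T')).1.
  + move=> u _; rewrite lee_wpmul2r ?(nnmf ha).2// lee_fin ler_nat.
    by have [h|//] := leP u t; rewrite (le_trans h)// le_max tT.
- move=> t t0; have h1 : (m t setT <= m t setT + occ m t (fun y => (qrate y)%:E))%E.
    by apply: leeDl; exact: (sf_ge0 (sf_occ hs measurable_gen m0 hm t) q0).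
  apply: (le_trans h1); rewrite (mass_occ t0); apply: leeD2l.
  rewrite (_ : (fun=> b%:E) = fun _ : E => b%:E * 1)%E; last by apply/funext => y; rewrite mule1.
  rewrite (sf_scale (sf_occ hs measurable_gen m0 hm t) b0 one0) le_eqVlt; apply/orP; left; apply/eqP.
  by congr (_ * _)%E; apply: eq_integral => u _; rewrite integral_cst// mul1e.
Qed.

Lemma Ures_mass : (al%:E * Ures (fun=> 1) + Ures (fun y => (qrate y)%:E) = 1 + b%:E * Ures (fun=> 1))%E.
Proof.
have q0 := nnm_EFin measurable_qrate qrate_ge0.
rewrite {1}Ures1E -(sf_scale sf_Ures b0 one0).
rewrite (_ : (fun=> b%:E * 1)%E = fun _ : E => b%:E); last by apply/funext => y; rewrite mule1.
have bc : nnm (fun _ : E => b%:E) by apply: nnm_cst; rewrite lee_fin.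
exact: (lap_fwd nnm_mass q0 bc ler01 (fun t t0 => mass_occ t0)).
Qed.

(** Supplies [hU]: the forward equation for [tst], with the parts [p1] and [n1], is transformed by
    [lap_fwd]. *)
Lemma Rn_le_Ures n f : nnm f -> (Rn s kap lam b al n f x <= Ures f)%E.
Proof.
move=> f0; apply: (Rn_le_U hs hr b_al sf_Ures Ures1_fin _ n f0) => k a B C k0.
have mt := measurable_tst hs k a B C.
have tC := tst_le s k a B C.
have g0 := tst_ge0 s k a B C.
have mch : measurable_fun setT (fun y : E => chi k (s a) (s y)) by have /measurable_EFinP := (nnm_chi hs k a).1.
have mi : measurable_fun setT (fun y : E => (B <= s y < C)%R%:R : R) by have /measurable_EFinP := (nnm_itv hs B C).1.
have ms := continuous_measurable_posreal (sc_cont hs).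
have hg : nnm (fun y => (tst s k a B C y)%:E) by exact: nnm_EFin.
have mcap : measurable_fun setT (fun y : E => cap B C (s y)).
  by apply: measurable_maxr => //; apply: measurable_funB => //; exact: measurable_maxr.
have mch' : measurable_fun setT (fun y : E => chi' k (s a) (s y)).
  apply: measurable_fun_ifT => //; apply: measurable_and.
    exact: measurable_fun_ler.
  exact: measurable_fun_ltr.
have ch'0 y : 0 <= chi' k (s a) (s y) by rewrite /chi'; case: ifP => // _; exact: ltW.
pose n1 y := chi k (s a) (s y) * (B <= s y < C)%R%:R + (lam y + b) * tst s k a B C y.
pose p1 y := chi' k (s a) (s y) * cap B C (s y) + b * tst s k a B C y + kreal (tst s k a B C) y.
have mn1 : measurable_fun setT n1.
  apply: measurable_funD; first exact: measurable_funM.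
  by apply: measurable_funM => //; apply: measurable_funD => //; exact: (rt_meas hr).
have n10 y : 0 <= n1 y.
  by apply: addr_ge0; apply: mulr_ge0; rewrite ?chi_ge0 ?(lamb_ge0 hr).
have mp1 : measurable_fun setT p1.
  apply: measurable_funD; last exact: (measurable_kreal hr mt tC).
  by apply: measurable_funD; exact: measurable_funM.
have p10 y : 0 <= p1 y.
  apply: addr_ge0; first by apply: addr_ge0; apply: mulr_ge0; rewrite ?cap_ge0.
  by apply: fine_ge0; apply: integral_ge0 => z _; rewrite lee_fin.
have eg y : gen (tst s k a B C) (tst' s k a B C) y = p1 y - n1 y.
  by rewrite /gen /n1 /p1 /tst'; ring.
have mLt := measurable_Ltst hs measurable_gen a B C k0.
have e := lap_fwd (nnmf hg) (nnm_EFin mn1 n10) (nnm_EFin mp1 p10) (g0 x)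
  (fun t t0 => fwd_occ hs measurable_gen m0 hm mLt (hm.2 k a B C k0) mp1 mn1 p10 n10 eg t0).
rewrite [LHS]e; apply: (congr1 (fun z => (tst s k a B C x)%:E + z)%E); apply: sf_ext => y.
by rewrite /= /p1 EFinD (EFin_kreal y mt tC).
Qed.

End resolvent_family.

End family.

Variables (m m' : R -> {measure set E -> \bar R}) (x : E).
Hypothesis m0 : forall t, t < 0 -> m t setT = 0%E.
Hypothesis hm : tests s m x gen.
Hypothesis m'0 : forall t, t < 0 -> m' t setT = 0%E.
Hypothesis hm' : tests s m' x gen.
Hypothesis m'P : forall t f, nnm f -> (\int[m' t]_y f y = Poo s kap lam b f (t, x))%E.

Lemma Ures_le al f : b < al -> nnm f -> (Ures m' al f <= Ures m al f)%E.
Proof.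
move=> b_al f0.
have -> : Ures m' al f = limn (fun n => Rn s kap lam b al n f x).
  by rewrite -(Lap_Poo al hs hr x f0); apply: Lap_ext => t _; exact: m'P.
apply: limn_le => [i j ij|n]; last exact: (Rn_le_Ures m0 hm b_al).
rewrite -!(Lap_Pn al hs hr _ x f0); apply: (sf_le (sf_Lap al)).
- exact: (nnm_slice x (nnm_Pn hs hr i f0)).
- exact: (nnm_slice x (nnm_Pn hs hr j f0)).
- by move=> t; exact: (nd_Pn hs hr (t, x) f0).
Qed.

(* [Ures m'] is dominated by [Ures m], and the mass balance makes the total masses
   equal; apply this to [f] and [1 - f]. *)
Lemma Ures_eq al f : b < al -> nnm f -> (forall y, f y <= 1)%E -> Ures m' al f = Ures m al f.
Proof.
move=> b_al f0 f1.
have q0 := nnm_EFin measurable_qrate qrate_ge0.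
have sU := sf_Ures m0 hm al; have sU' := sf_Ures m'0 hm' al.
have fin (I : (E -> \bar R) -> \bar R) : sfunctional I -> (I (fun=> 1%E) < +oo)%E -> I (fun=> 1%E) \is a fin_num.
  by move=> sI h; rewrite ge0_fin_numE// (sf_ge0 sI one0).
have u1 := fin _ sU (Ures1_fin m0 hm b_al); have u1' := fin _ sU' (Ures1_fin m'0 hm' b_al).
have e1 := Ures_mass m0 hm b_al; have e1' := Ures_mass m'0 hm' b_al.
have l1 := Ures_le b_al one0; have lq := Ures_le b_al q0.
have q1 : Ures m al (fun y => (qrate y)%:E) \is a fin_num.
  rewrite ge0_fin_numE ?(sf_ge0 sU q0)//.
  apply: (@le_lt_trans _ _ (al%:E * Ures m al (fun=> 1) + Ures m al (fun y => (qrate y)%:E))%E).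
    by rewrite leeDr// mule_ge0 ?(sf_ge0 sU one0)// lee_fin (le_trans b0)// ltW.
  rewrite e1 -(fineK u1) -EFinM -EFinD; exact: ltry.
have q1' : Ures m' al (fun y => (qrate y)%:E) \is a fin_num.
  rewrite ge0_fin_numE ?(sf_ge0 sU' q0)//; apply: (le_lt_trans lq).
  exact: fin_num_lty.
have e : Ures m' al (fun=> 1%E) = Ures m al (fun=> 1%E).
  move: e1 e1' l1 lq; rewrite -(fineK u1) -(fineK u1') -(fineK q1) -(fineK q1').
  rewrite -!EFinM -!EFinD !lee_fin => -[e1] [e1'] l1 lq; congr EFin.
  apply/eqP; rewrite eq_le l1 /=.
  have d0 : 0 < al - b by rewrite subr_gt0.
  rewrite -(ler_pM2l d0) !mulrBl.
  exact: (mass_balance e1' e1 lq).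
have g0 : nnm (fun y => 1 - f y)%E.
  split; first by apply: emeasurable_funB => //; exact: f0.1.
  by move=> y; rewrite sube_ge0 ?f1// orbT.
have fg : (fun _ : E => 1%E) = (fun y => f y + (1 - f y))%E.
  apply/funext => y; have fy : f y \is a fin_num.
    by rewrite ge0_fin_numE ?f0.2// (le_lt_trans (f1 y))// ltry.
  by rewrite addeC subeK.
have lf := Ures_le b_al f0; have lg := Ures_le b_al g0.
have s1 := sf_add sU f0 g0; have s2 := sf_add sU' f0 g0; rewrite -fg in s1 s2.
apply/eqP; rewrite eq_le lf /=.
have fU : Ures m al f \is a fin_num.
  rewrite ge0_fin_numE ?(sf_ge0 sU f0)//; apply: (@le_lt_trans _ _ (Ures m al (fun=> 1%E))).
    exact: (sf_le sU f0 one0).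
  exact: fin_num_lty.
have gU : Ures m al (fun y => 1 - f y)%E \is a fin_num.
  rewrite ge0_fin_numE ?(sf_ge0 sU g0)//; apply: (@le_lt_trans _ _ (Ures m al (fun=> 1%E))).
    by rewrite s1; apply: leeDr; exact: (sf_ge0 sU f0).
  exact: fin_num_lty.
have fU' : Ures m' al f \is a fin_num.
  rewrite ge0_fin_numE ?(sf_ge0 sU' f0)//; apply: (le_lt_trans lf).
  exact: fin_num_lty.
have gU' : Ures m' al (fun y => 1 - f y)%E \is a fin_num.
  rewrite ge0_fin_numE ?(sf_ge0 sU' g0)//; apply: (le_lt_trans lg).
  exact: fin_num_lty.
move: s2 lf lg; rewrite e s1 -(fineK fU) -(fineK gU) -(fineK fU') -(fineK gU') -!EFinD !lee_fin => -[].
exact: add_squeeze.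
Qed.

(** For [f <= 1] the functions of time are finite and [Lap_inj] inverts the transform. In general
    [f] is the limit of its truncations at [k + 1], each of which is rescaled to stay below 1. *)
Lemma occ_eq t f : nnm f -> occ m' t f = occ m t f.
Proof.
have so := sf_occ hs measurable_gen m0 hm t; have so' := sf_occ hs measurable_gen m'0 hm' t.
have le1 g : nnm g -> (forall y, g y <= 1)%E -> occ m' t g = occ m t g.
  move=> g0 g1.
  have fin (mu : {measure set E -> \bar R}) : (mu setT < +oo)%E -> (\int[mu]_y g y)%E \is a fin_num.
    move=> mf; rewrite ge0_fin_numE ?(sf_ge0 (sf_integral mu) g0)//.
    apply: le_lt_trans mf; rewrite -[leRHS]mul1e -integral_cst//.
    exact: (sf_le (sf_integral mu) g0 one0).
  have fm u := fin _ (family_fin measurable_gen m0 hm u).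
  have fm' u := fin _ (family_fin measurable_gen m'0 hm' u).
  have n1 := nnm_family hs measurable_gen m0 hm g0.
  have n1' := nnm_family hs measurable_gen m'0 hm' g0.
  pose a u := fine (\int[m u]_y g y); pose a' u := fine (\int[m' u]_y g y).
  have aE u : (a u)%:E = (\int[m u]_y g y)%E by rewrite fineK.
  have aE' u : (a' u)%:E = (\int[m' u]_y g y)%E by rewrite fineK.
  have LE al : Lap al (EFin \o a) = Ures m al g by apply: Lap_ext => u _; exact: aE.
  have LE' al : Lap al (EFin \o a') = Ures m' al g by apply: Lap_ext => u _; exact: aE'.
  have key : (\int[leb]_u ((u <= t)%R%:R%:E * (a' u)%:E) = \int[leb]_u ((u <= t)%R%:R%:E * (a u)%:E))%E; last first.
    transitivity (\int[leb]_u ((u <= t)%R%:R%:E * (a' u)%:E))%E.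
      by apply: eq_integral => u _; rewrite aE'.
    by rewrite key; apply: eq_integral => u _; rewrite aE.
  apply: (@Lap_inj R b a' a b0).
  - exact: (measurableT_comp (@fine_measurable R _ measurableT) n1'.1).
  - exact: (measurableT_comp (@fine_measurable R _ measurableT) n1.1).
  - by move=> u; rewrite fine_ge0// n1'.2.
  - by move=> u; rewrite fine_ge0// n1.2.
  - by move=> u u0; rewrite /a' (family0 m'0 g0 u0).
  - by move=> u u0; rewrite /a (family0 m0 g0 u0).
  - by move=> al b_al; rewrite LE LE'; exact: Ures_eq.
  - move=> al b_al; rewrite LE'.
    apply: le_lt_trans (Ures1_fin m'0 hm' b_al).
    exact: (sf_le (sf_Ures m'0 hm' al) g0 one0).
move=> f0.
pose F (k : nat) y := mine (f y) k.+1%:R%:E.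
have F0 k : nnm (F k).
  split; first by apply: measurable_mine => //; exact: f0.1.
  by move=> y; rewrite le_min f0.2 lee_fin ler0n.
have ndF y : nondecreasing_seq (F^~ y).
  by move=> i j ij; rewrite le_min !ge_min lexx /= lee_fin ler_nat ltnS ij orbT.
have limF y : limn (F^~ y) = f y.
  apply/cvg_lim => //; have := f0.2 y; rewrite /F; case: (f y) => [r _|_|//].
    apply: cvg_near_cst; exists (Num.truncn `|r|).+1 => // k /= hk; apply/min_idPl.
    rewrite lee_fin (le_trans (ler_norm _))// (le_trans (ltW (truncnS_gt _)))// ler_nat.
    exact: leqW.
  rewrite (_ : (fun k : nat => _) = fun k : nat => k.+1%:R%:E).
    apply/cvgeryP/cvgryPge => A; exists (Num.truncn `|A|).+1 => // k /= hk.
    rewrite (le_trans (ler_norm _))// (le_trans (ltW (truncnS_gt _)))// ler_nat.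
    exact: leqW.
  by apply/funext => k; apply/min_idPr; exact: leey.
have -> : f = fun y => limn (F^~ y) by apply/funext => y; rewrite limF.
rewrite (sf_lim so F0 ndF) (sf_lim so' F0 ndF); congr (limn _); apply/funext => k.
have k0 : 0 <= k.+1%:R :> R by [].
have ki0 : 0 <= k.+1%:R^-1 :> R by rewrite invr_ge0.
have G0 : nnm (fun y => (k.+1%:R^-1)%:E * F k y)%E.
  by apply: nnmM => //; apply: nnm_cst; rewrite lee_fin.
have FE : F k = fun y => (k.+1%:R%:E * ((k.+1%:R^-1)%:E * F k y))%E.
  by apply/funext => y; rewrite muleA -EFinM mulfV ?mul1e.
rewrite FE (sf_scale so k0 G0) (sf_scale so' k0 G0); congr (_ * _)%E; apply: le1 => // y.
apply: (@le_trans _ _ ((k.+1%:R^-1)%:E * k.+1%:R%:E)%E).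
  by rewrite lee_wpmul2l ?lee_fin// ge_min lexx orbT.
by rewrite -EFinM mulVf.
Qed.

(** The forward equation determines the integral of [g] from occupation integrals, which agree; that
    of [|f| - f] is finite and can be cancelled. *)
Lemma test_eq (g f : E -> R) t : measurable_fun setT f -> fwd m x g f -> fwd m' x g f -> 0 <= t ->
  (\int[m' t]_y (g y)%:E = \int[m t]_y (g y)%:E)%E.
Proof.
move=> mf hf hf' t0.
have ha : nnm (fun y : E => `|f y|%:E) by apply: nnm_EFin => //; exact: measurableT_comp.
have hn := nnm_absB mf.
have so := sf_occ hs measurable_gen m0 hm t.
have e := fwd_abs m0 hm mf hf t0; have e' := fwd_abs m'0 hm' mf hf' t0.
rewrite !occ_eq// in e'.
have fin : occ m t (fun y => (`|f y| - f y)%:E) \is a fin_num.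
  rewrite ge0_fin_numE ?(sf_ge0 so hn)//.
  have h2 : nnm (fun y : E => 2%:E * `|f y|%:E)%E by apply: nnmM => //; apply: nnm_cst; rewrite lee_fin.
  apply: (@le_lt_trans _ _ (occ m t (fun y => 2%:E * `|f y|%:E)%E)).
    apply: (sf_le so hn h2) => y; rewrite -EFinM lee_fin.
    by rewrite mulr_natl mulr2n lerD2l -normrN ler_norm.
  rewrite (sf_scale so _ ha)// lte_mul_pinfty// ?lee_fin// (occ_abs m0 mf hf t0).
  by [].
by rewrite -[LHS](addeK _ fin) e' -e addeK.
Qed.

(** The trapezoids carry [test_eq] to rays, and rays determine a measure. *)
Lemma family_unique t A : measurable A -> m' t A = m t A.
Proof.
have [t0|t0] := leP 0 t; last first.
  move=> mA; have h (mu : {measure set E -> \bar R}) : mu setT = 0%E -> mu A = 0%E.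
    move=> mu0; apply/eqP; rewrite eq_le measure_ge0 andbT -mu0.
    by apply: le_measure; [exact/mem_set|exact/mem_set/measurableT|].
  by rewrite !h// ?m0// m'0.
have massE : m' t setT = m t setT.
  have := test_eq (measurable_L1 measurable_gen) hm.1 hm'.1 t0.
  by rewrite !integral_cst// !mul1e.
have trapE a k : (\int[m' t]_y (trap s a k y)%:E = \int[m t]_y (trap s a k y)%:E)%E.
  have k0 : 0 < k.+1%:R :> R by [].
  have ki0 : 0 <= k.+1%:R^-1 :> R by rewrite invr_ge0.
  have t00 : nnm (fun y => (tst s k.+1%:R a k.+1%:R (k.+1%:R * 2) y)%:E).
    by apply: nnm_EFin; [exact: (measurable_tst hs)|exact: tst_ge0].
  have h (mu : {measure set E -> \bar R}) : (\int[mu]_y (trap s a k y)%:E =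
     (k.+1%:R^-1)%:E * \int[mu]_y (tst s k.+1%:R a k.+1%:R (k.+1%:R * 2) y)%:E)%E.
    by rewrite -(sf_scale (sf_integral mu) ki0 t00).
  rewrite !h; congr (_ * _)%E.
  apply: (test_eq (measurable_Ltst hs measurable_gen a _ _ k0) (hm.2 _ a _ _ k0) (hm'.2 _ a _ _ k0) t0).
have rayE r : (\int[m' t]_y (\1_(ray false r) (s y))%:E = \int[m t]_y (\1_(ray false r) (s y))%:E)%E.
  have mr : measurable (s @^-1` ray false r).
    rewrite -[X in measurable X]setTI.
    exact: (continuous_measurable_posreal (sc_cont hs) measurableT (measurable_ray _ _)).
  have h (mu : {measure set E -> \bar R}) : (\int[mu]_y (\1_(ray false r) (s y))%:E = mu (s @^-1` ray false r))%E.
    transitivity (\int[mu]_y (\1_(s @^-1` ray false r) y)%:E)%E; first by [].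
    by rewrite integral_indic// setIT.
  rewrite !h; have [[a ar]|na] := pselect (exists a, s a = r); last first.
    have -> : s @^-1` ray false r = setT; last exact: massE.
    apply/seteqP; split => // y _; rewrite /ray /= in_itv /= andbT ltNge.
    apply/negP => ya; apply: na; exact: (s_surj (sc_cont hs) (sc_lim hs) ya).
  rewrite -ar -!(trap_lim hs); congr (limn _); apply/funext => k; exact: trapE.
move=> mA.
have rayF r : (\int[m' t]_y (\1_(ray false r) (s y))%:E < +oo)%E.
  apply: le_lt_trans (family_fin measurable_gen m'0 hm' t).
  rewrite -[leRHS]mul1e -integral_cst//; apply: ge0_le_integral => //.
  - apply/measurable_EFinP; apply: (measurableT_comp (measurable_indic (measurable_ray false r))).
    exact: (continuous_measurable_posreal (sc_cont hs)).
  - by move=> y _; rewrite lee_fin indicE lern1 leq_b1.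
have := sf_ray_unique_scale hs (sf_integral (m' t)) (sf_integral (m t)) rayE rayF (nnm_indic R mA).
by rewrite !integral_indic// !setIT.
Qed.

End uniqueness.

(** Infinite values are allowed, including [+oo - +oo], whose conventional value is kept by a
    positive factor. *)
Lemma pmuleBr (R : realType) (c : R) (A B : \bar R) : 0 < c -> (0 <= A)%E -> (0 <= B)%E ->
  (c%:E * (A - B) = c%:E * A - c%:E * B)%E.
Proof.
move=> c0; case: A => [a||//]; case: B => [b||//] _ _.
- by rewrite -EFinB -!EFinM -EFinB mulrBr.
- by rewrite gt0_muley ?lte_fin// addeNy gt0_muleNy ?lte_fin.
- by rewrite gt0_muley ?lte_fin// -EFinM -!EFinN !addye// gt0_muley ?lte_fin.
- by rewrite gt0_muley ?lte_fin// addeNy gt0_muleNy ?lte_fin.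
Qed.

Lemma fine_pM (R : realType) (c : R) (A : \bar R) : 0 < c -> fine (c%:E * A)%E = c * fine A.
Proof.
move=> c0; case: A => [a//||] /=.
- by rewrite gt0_muley ?lte_fin// mulr0.
- by rewrite gt0_muleNy ?lte_fin// mulr0.
Qed.

(** * The h-transform *)

Section weighted.
Context d (T : measurableType d) (R : realType).

Lemma weighted_integral (mu nu : {measure set T -> \bar R}) (c : R) (w g : T -> R) :
  0 < c -> measurable_fun setT w -> (forall y, 0 < w y) ->
  (forall f, nnm f -> \int[nu]_y f y = c%:E * \int[mu]_y ((w y)%:E * f y))%E ->
  measurable_fun setT g ->
  (\int[nu]_y (g y)%:E = c%:E * \int[mu]_y (w y * g y)%:E)%E.
Proof.
move=> c0 mw w0 h mg; rewrite integralE [in RHS]integralE.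
have mge : measurable_fun setT (EFin \o g) by exact/measurable_EFinP.
have mwg : measurable_fun setT (fun y => (w y * g y)%:E).
  by apply/measurable_EFinP; exact: measurable_funM.
have np : nnm (fun y => ((EFin \o g)^\+ y)%E) by split => //; exact: measurable_funepos.
have nn : nnm (fun y => ((EFin \o g)^\- y)%E) by split => //; exact: measurable_funeneg.
have ip : (0 <= \int[mu]_y ((fun y => (w y * g y)%:E)^\+ y))%E by apply: integral_ge0.
have i_n : (0 <= \int[mu]_y ((fun y => (w y * g y)%:E)^\- y))%E by apply: integral_ge0.
rewrite (h _ np) (h _ nn) (pmuleBr c0 ip i_n); congr (_ * _ - _ * _)%E; apply: eq_integral => y _.
  by rewrite !funeposE -!EFin_max -EFinM maxr_pMr ?mulr0// ltW.
by rewrite !funenegE -!EFinN -!EFin_max -EFinM maxr_pMr ?mulr0 ?mulrN// ltW.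
Qed.

End weighted.

Section forward_scaling.
Context (R : realType).
Local Notation leb := (@lebesgue_measure R).

(** The common shape of [fwd] and [forward_equation] at one time, so that multiplication by [h x] or
    its inverse is treated once. *)
Definition fwd_at (a b : R -> \bar R) (v : \bar R) (w t : R) :=
  [/\ measurable_fun `[0, t] a, measurable_fun `[0, t] b,
      (\int[leb]_(u in `[0%R, t]) a u < +oo)%E &
      (v = w%:E + \int[leb]_(u in `[0%R, t]) b u)%E].

Lemma fwd_at_scale (c : R) a b v w t : 0 < c -> (forall u, 0 <= a u)%E ->
  (forall u, `|b u| <= a u)%E -> fwd_at a b v w t ->
  fwd_at (fun u => c%:E * a u)%E (fun u => c%:E * b u)%E (c%:E * v)%E (c * w) t.
Proof.
move=> c0 a0 ba [ma mb fin ->].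
have Ib : leb.-integrable `[0, t] b.
  apply/integrableP; split => //; apply: le_lt_trans fin; apply: ge0_le_integral => //.
  by apply: measurableT_comp.
split.
- by apply: emeasurable_funM.
- by apply: emeasurable_funM.
- rewrite ge0_integralZl//; last by rewrite lee_fin ltW.
  rewrite lte_mul_pinfty ?lee_fin ?(ltW c0)//.
- by rewrite integralZl// EFinM muleDr.
Qed.

Lemma fwd_at_ext a b v w t a' b' v' w' : (forall u, 0 <= u -> a u = a' u) ->
  (forall u, 0 <= u -> b u = b' u) -> v = v' -> w = w' ->
  fwd_at a b v w t -> fwd_at a' b' v' w' t.
Proof.
move=> ea eb -> -> [ma mb fin e].
have h (f f' : R -> \bar R) : (forall u, 0 <= u -> f u = f' u) -> {in `[0, t]%classic, f =1 f'}.
  by move=> ff u /set_mem; rewrite /= in_itv /= => /andP[u0 _]; exact: ff.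
split.
- exact: (eq_measurable_fun _ (h _ _ ea)).
- exact: (eq_measurable_fun _ (h _ _ eb)).
- have <- : (\int[leb]_(u in `[0%R, t]) a u = \int[leb]_(u in `[0%R, t]) a' u)%E by apply: eq_integral; exact: h.
  exact: fin.
- have <- : (\int[leb]_(u in `[0%R, t]) b u = \int[leb]_(u in `[0%R, t]) b' u)%E by apply: eq_integral; exact: h.
  exact: e.
Qed.

End forward_scaling.

(** * Transfer of the forward equation *)

Section link.
Context (R : realType).
Local Notation E := (posreal R).
Variables (k : R.-ker E ~> E) (s K h : E -> R) (h_pos : forall y, 0 < h y).
Variables (T : R -> R.-ker E ~> E) (m : R -> {measure set E -> \bar R}) (x : E).
Hypothesis link : forall u (f : E -> R), 0 <= u -> measurable_fun setT f ->
  act T u (fun y => h y * f y) x = ((h x)%:E * \int[m u]_y (f y)%:E)%E.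
Hypothesis mh : measurable_fun setT h.
Variables (f g F : E -> R).
Hypothesis fE : forall y, f y = h y * g y.
Hypothesis AE : forall y, opA k s K f y = h y * F y.
Hypothesis mg : measurable_fun setT g.
Hypothesis mF : measurable_fun setT F.

Let maF : measurable_fun setT (fun y => `|F y|).
Proof. exact: measurableT_comp. Qed.

Let actA u : 0 <= u -> act T u (opA k s K f) x = ((h x)%:E * \int[m u]_y (F y)%:E)%E.
Proof. by move=> u0; rewrite -link//; apply: eq_integral => y _; rewrite AE. Qed.

Let actabsA u : 0 <= u ->
  act T u (fun y => `|opA k s K f y|) x = ((h x)%:E * \int[m u]_y `|F y|%:E)%E.
Proof.
move=> u0; rewrite -link//; apply: eq_integral => y _.
by rewrite AE normrM (gtr0_norm (h_pos y)).
Qed.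

Let actf u : 0 <= u -> act T u f x = ((h x)%:E * \int[m u]_y (g y)%:E)%E.
Proof. by move=> u0; rewrite -link//; apply: eq_integral => y _; rewrite fE. Qed.

Let F_le u : (`|\int[m u]_y (F y)%:E| <= \int[m u]_y `|F y|%:E)%E.
Proof. exact: abse_integral_le. Qed.

Let F0 u : (0 <= \int[m u]_y `|F y|%:E)%E.
Proof. by apply: integral_ge0 => y _; rewrite lee_fin. Qed.

Lemma forward_of_fwd t : 0 <= t -> fwd m x g F -> forward_equation k s K T f t x.
Proof.
move=> t0 /(_ t t0) hf.
have := fwd_at_scale (h_pos x) F0 F_le hf; apply: fwd_at_ext => // [u u0|u u0|].
- by rewrite actabsA.
- by rewrite actA.
- by rewrite actf.
Qed.

Lemma fwd_of_forward : (forall t, 0 <= t -> forward_equation k s K T f t x) -> fwd m x g F.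
Proof.
move=> hf t t0; have hi : 0 < (h x)^-1 by rewrite invr_gt0.
have hK z : ((h x)^-1%:E * ((h x)%:E * z) = z)%E.
  by rewrite muleA -EFinM mulVf ?mul1e// gt_eqF.
have A0 u : (0 <= act T u (fun y => `|opA k s K f y|%R) x)%E.
  by apply: integral_ge0 => y _; rewrite lee_fin.
have mAf : measurable_fun setT (opA k s K f).
  rewrite (_ : opA k s K f = fun y => h y * F y); last exact/funext.
  exact: measurable_funM.
have A_le u : (`|act T u (opA k s K f) x| <= act T u (fun y => `|opA k s K f y|%R) x)%E.
  exact: abse_integral_le.
have := fwd_at_scale hi A0 A_le (hf t t0); apply: fwd_at_ext => // [u u0|u u0||].
- by rewrite actabsA.
- by rewrite actA.
- by rewrite actf.
- by rewrite fE mulKf// gt_eqF.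
Qed.

End link.

Section transform.
Context (R : realType).
Local Notation E := (posreal R).
Local Notation leb := (@lebesgue_measure R).
Variables (k : R.-ker E ~> E) (s K h : E -> R).
Hypothesis hs : scale s.
Hypothesis k_lower : forall x : E, k x [set y | val x <= val y] = 0%E.
Hypothesis K_meas : measurable_fun setT K.
Hypothesis K_locb : locally_bounded K.
Hypothesis h_pos : forall x, 0 < h x.
Hypothesis h_Cloc : Cs_loc s h.

Let ch : continuous h. Proof. by case: h_Cloc => [[]]. Qed.
Let dh x : sderivable s h x. Proof. by case: h_Cloc => [[_]]. Qed.
Let mh : measurable_fun setT h. Proof. exact: continuous_measurable_posreal. Qed.
Let mhi : measurable_fun setT (fun y => (h y)^-1).
Proof.
have [[ci _] _] := Cs_loc_inv hs h_pos h_Cloc.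
exact: continuous_measurable_posreal.
Qed.
Let hi0 x : 0 < (h x)^-1. Proof. by rewrite invr_gt0. Qed.
Let nh : nnm (fun y => (h y)%:E). Proof. by apply: nnm_EFin => // y; exact: ltW. Qed.
Let nhi : nnm (fun y => (h y)^-1%:E). Proof. by apply: nnm_EFin => // y; exact: ltW. Qed.

Lemma measurable_up (x : E) : measurable [set y : E | val x <= val y].
Proof.
have -> : [set y : E | val x <= val y] = val @^-1` `[val x, +oo[%classic.
  by apply/seteqP; split => y; rewrite /= in_itv /= andbT.
by rewrite -[X in measurable X]setTI; exact: (@measurable_pval R measurableT).
Qed.

Lemma low_integral x (f : E -> \bar R) : nnm f ->
  (\int[k x]_(y in [set y | (val y < val x)%R]) f y = \int[k x]_y f y)%E.
Proof.
move=> [mf f0]; rewrite [RHS](ge0_negligible_integral (measurable_up x) measurableT mf _ (k_lower x))//.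
congr integral; apply/seteqP; split => y /=; first by move=> yx; split => //; apply/negP; rewrite -ltNge.
by move=> [_ /negP]; rewrite -ltNge.
Qed.

Lemma transform_kernel : exists kap : R.-ker E ~> E, forall x f, nnm f ->
  (\int[kap x]_y f y = (h x)^-1%:E * \int[k x]_y ((h y)%:E * f y))%E.
Proof.
pose J (x : E) (f : E -> \bar R) := ((h x)^-1%:E * \int[k x]_y ((h y)%:E * f y))%E.
have sJ x : sfunctional (J x).
  apply: sf_cscale; first by rewrite lee_fin ltW.
  exact: (sf_weight (sf_integral (k x)) nh).
have mJ f : nnm f -> measurable_fun setT (fun x => J x f).
  move=> f0; have hf := nnmM nh f0; apply: emeasurable_funM; first exact: nhi.1.
  exact: (measurable_fun_integral_kernel (measurable_kernel k) hf.2 hf.1).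
by have [kap [_ hk]] := sf_kernel sJ mJ; exists kap.
Qed.

Variable kap : R.-ker E ~> E.
Hypothesis kapE : forall x f, nnm f ->
  (\int[kap x]_y f y = (h x)^-1%:E * \int[k x]_y ((h y)%:E * f y))%E.

(** This is [r - c]: the integral term of [A h / h] is [r] and cancels, leaving [K - h' / h]. *)
Definition lam_of (x : E) : R := K x - sderive s h x / h x.

(** The product rule for [h * g]: the derivative of [h] goes into [lam_of], and the factor [h]
    inside the integral into [kap]. The integrals may be infinite; a positive factor respects the
    convention of [fine]. *)
Lemma opA_gen (f g D : E -> R) x : measurable_fun setT g -> (forall y, f y = h y * g y) ->
  sderivable s g x -> sderive s g x = D x ->
  opA k s K f x = h x * gen kap lam_of g D x.
Proof.
move=> mg fE dg gD; have -> : f = fun y => h y * g y by exact/funext.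
have mf : measurable_fun setT (fun y => h y * g y) by exact: measurable_funM.
have mfe : measurable_fun setT (fun y => (h y * g y)%:E) by exact/measurable_EFinP.
have [_ e] := sderive_mul hs (@dh x) dg.
rewrite /opA e gD /gen /lam_of /kreal.
rewrite (weighted_integral (hi0 x) mh h_pos (fun f f0 => kapE x f0) mg) (fine_pM _ (hi0 x)).
have -> : (\int[k x]_(y in [set y | (val y < val x)%R]) (h y * g y)) = fine (\int[k x]_y (h y * g y)%:E)%E.
  rewrite /Rintegral integralE [in RHS]integralE; congr (fine (_ - _)%E); apply: low_integral.
    by split => //; exact: measurable_funepos.
  by split => //; exact: measurable_funeneg.
have hx : h x != 0 by rewrite gt_eqF.
by move: (fine _) => I; field.
Qed.

Lemma sderive_one x : sderivable s (fun=> 1 : R) x /\ sderive s (fun=> 1 : R) x = 0.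
Proof.
apply: (sderive_phi0 hs); apply: cvg_near_cst; apply: nearW => e.
by rewrite subrr mul0r.
Qed.

Lemma kap_low x : kap x [set y | val x <= val y] = 0%E.
Proof.
transitivity (\int[kap x]_y (\1_[set y : E | val x <= val y] y)%:E)%E.
  by rewrite integral_indic ?setIT//; exact: measurable_up.
rewrite kapE; last exact: (nnm_indic R (measurable_up x)).
rewrite -low_integral; last by apply: nnmM => //; exact: (nnm_indic R (measurable_up x)).
rewrite integral0_eq ?mule0// => y /= yx; rewrite indicE memNset ?mule0//=.
by apply/negP; rewrite -ltNge.
Qed.

Hypothesis h_int : forall M : R, 0 < M ->
  (ereal_sup [set \int[k x]_(y in [set y | (val y < val x)%R]) (h y / h x)%:E
             | x in [set x : posreal R | (val x < M)%R]] < +oo)%E.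

Lemma kap_mass x : (kap x setT = \int[k x]_(y in [set y | (val y < val x)%R]) (h y / h x)%:E)%E.
Proof.
have one0 : nnm (fun _ : E => 1%E : \bar R) by apply: nnm_cst; exact: lee01.
transitivity (\int[kap x]_y 1)%E; first by rewrite integral_cst// mul1e.
have hn : nnm (fun y => (h y / h x)%:E).
  by apply: nnm_EFin; [exact: measurable_funM|move=> y; rewrite divr_ge0// ltW].
rewrite (kapE x one0) low_integral//.
rewrite -(sf_scale (sf_integral (k x)) (ltW (hi0 x)) (nnmM nh one0)).
by apply: eq_integral => y _; rewrite mule1 -EFinM mulrC.
Qed.

Lemma kap_bound (M : R) : exists C : R, forall x, val x <= M -> (kap x setT <= C%:E)%E.
Proof.
(* [h_int] is about [val x < M] with [0 < M], whence the maximum and the [+ 1]. *)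
pose M' := Num.max M 0 + 1.
have M'0 : 0 < M' by rewrite ltr_wpDl// le_max lexx orbT.
have hM := h_int M'0; set S := ereal_sup _ in hM.
exists (fine S) => x xM; have xM' : val x < M'.
  by rewrite (le_lt_trans xM)// /M' (le_lt_trans (_ : M <= Num.max M 0))// ?ltrDl// le_max lexx.
have h1 : (kap x setT <= S)%E.
  by rewrite kap_mass; apply: ereal_sup_ubound; exists x.
rewrite fineK// ge0_fin_numE//; exact: le_trans h1.
Qed.

Lemma transform_rates (b : R) : 0 <= b -> (forall x, opA k s K h x / h x <= b) ->
  rates kap lam_of b.
Proof.
move=> b0 hb.
have fin x : (kap x setT < +oo)%E.
  by have [C hC] := kap_bound (val x); exact: le_lt_trans (hC x (lexx _)) (ltry _).
split => //.
- exact: kap_low.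
- move=> M; have [C hC] := kap_bound M; exists C => x xM.
  by rewrite -lee_fin fineK ?ge0_fin_numE// hC.
- apply: measurable_funB => //; apply: measurable_funM => //.
  exact: (measurable_sderive (sc_incr hs) (sc_cont hs) (sc_lim hs)).
- apply: locally_bounded_of => u v u0.
  have [M1 h1] := locally_boundedP v K_locb u0.
  have [M2 h2] := locally_boundedP v h_Cloc.2 u0.
  have [[ci _] _] := Cs_loc_inv hs h_pos h_Cloc.
  have [M3 h3] := locally_boundedP v (locally_bounded_continuous ci) u0.
  exists (M1 + M2 * M3) => x hx; rewrite (le_trans (ler_normB _ _))// lerD ?h1// normrM.
  by rewrite ler_pM ?h2 ?h3.
- move=> x; have := hb x; have [d1 e1] := sderive_one x.
  rewrite (@opA_gen h (fun=> 1) (fun=> 0))//; last by move=> y; rewrite mulr1.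
  rewrite mulrAC mulfV ?mul1r ?gt_eqF// /gen /kreal integral_cst// mul1e.
  by move=> hx; lra.
Qed.

End transform.

(** * The minimal semigroup as a solution *)

Section solution.
Context (R : realType).
Local Notation E := (posreal R).
Local Notation leb := (@lebesgue_measure R).
Variables (s : E -> R) (kap : R.-ker E ~> E) (lam : E -> R) (b : R).
Hypothesis hs : scale s.
Hypothesis hr : rates kap lam b.
Local Notation Poo := (Poo s kap lam b).
Local Notation gen := (gen kap lam).

Lemma Poo0 f x : nnm f -> Poo f (0, x) = f x.
Proof.
move=> f0; rewrite (Poo_fix hs hr (0, x) f0) SopE (Swt_ge _ _ _ _ (lexx 0)) weight0 mul1e.
rewrite (phi0 (sc_incr hs)) QopE integral0_eq ?adde0// => u _.
have [u0|u0] := leP u 0; first by rewrite (Qwt_le _ _ _ _ u0) mul0e.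
rewrite integral0_eq ?mule0// => y _.
by rewrite (Poo_lt0 s kap lam b _ _ f0)// sub0r oppr_lt0.
Qed.

Lemma Poo_family x : exists m : R -> {measure set E -> \bar R},
  forall t f, nnm f -> (\int[m t]_y f y = Poo f (t, x))%E.
Proof.
have [m hm] := choice (fun t : R => sf_riesz (sf_Poo hs hr (t, x))).
by exists m => t f f0; exact: (hm t).2.
Qed.

(** The occupation measure [M] of [core_forward] is obtained from [Iop] by [sf_riesz]; the rest
    exchanges the time integral with the positive and negative parts of the generator. *)
Lemma Poo_fwd (m : R -> {measure set E -> \bar R}) x (g D : E -> R) (C : R) :
  (forall t f, nnm f -> (\int[m t]_y f y = Poo f (t, x))%E) ->
  flow_prim s g D -> (forall y, `|g y| <= C) -> (forall y, `|D y| <= C) ->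
  fwd m x g (gen g D).
Proof.
move=> mE hg gC DC t t0.
have [mg mD _] := hg.
have mF := measurable_gen hr mg mD gC; set F := gen g D in mF *.
have nP f : nnm f -> nnm (fun u : R => Poo f (u, x)).
  by move=> f0; exact: (nnm_slice x (nnm_Poo hs hr f0)).
have sI : sfunctional (fun f => Iop (Poo f) (t, x)).
  have h1 : @sfunctional _ (measurableTypeR R) R (fun w : R -> \bar R => \int[leb]_u ((u <= t)%R%:R%:E * w u))%E.
    by apply: (sf_weight (sf_integral leb)); exact: nnm_ler.
  exact: (@sf_comp _ _ (measurableTypeR R) E R _ (fun u (f : E -> \bar R) => Poo f (u, x)) h1
    (fun u => sf_Poo hs hr (u, x)) (fun f f0 => (nP f f0).1)).
have [M [_ ME]] := sf_riesz sI.
have [i1 i2 e] := core_forward hs hr t0 (mE t) ME hg gC DC; rewrite -/F in i2 e.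
have mFe : measurable_fun setT (EFin \o F) by exact/measurable_EFinP.
have na : nnm (fun y => `|F y|%:E) by apply: nnm_EFin => //; exact: measurableT_comp.
have np : nnm (fun y => ((EFin \o F)^\+ y)%E) by split => //; exact: measurable_funepos.
have nn : nnm (fun y => ((EFin \o F)^\- y)%E) by split => //; exact: measurable_funeneg.
have itvE f : nnm f -> (\int[leb]_(u in `[0%R, t]) \int[m u]_y f y = \int[M]_y f y)%E.
  move=> f0; rewrite (ME f f0) int_patch; apply: eq_integral => u _.
  apply: (congr1 (fun z => ((u <= t)%R%:R%:E * z)%E)); rewrite /patch.
  have [u0|u0] := leP 0 u; first by rewrite mem_set// mE.
  by rewrite memNset/= ?leNgt ?u0// (Poo_lt0 s kap lam b x u0 f0).
have mI f : nnm f -> measurable_fun `[0, t] (fun u : R => \int[m u]_y f y)%E.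
  move=> f0; apply: measurable_funTS.
  rewrite (_ : (fun u => _) = fun u => Poo f (u, x)); first exact: (nP f f0).1.
  by apply/funext => u; rewrite mE.
have afin : (\int[M]_y `|F y|%:E < +oo)%E by have /integrableP[_] := i2.
have FpN u : (\int[m u]_y (F y)%:E = \int[m u]_y (EFin \o F)^\+ y - \int[m u]_y (EFin \o F)^\- y)%E.
  exact: integralE.
have le_abs f : nnm f -> (forall y, f y <= `|F y|%:E)%E ->
    leb.-integrable `[0, t] (fun u : R => \int[m u]_y f y)%E.
  move=> f0 fF; apply/integrableP; split; first exact: mI.
  apply: le_lt_trans afin; rewrite -(itvE _ na); apply: ge0_le_integral => //.
  - by apply: measurableT_comp => //; exact: mI.
  - exact: mI.
  - move=> u _; rewrite gee0_abs; last exact: (sf_ge0 (sf_integral (m u)) f0).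
    exact: (sf_le (sf_integral (m u)) f0 na).
have Ip : leb.-integrable `[0, t] (fun u : R => \int[m u]_y (EFin \o F)^\+ y)%E.
  apply: le_abs => // y; rewrite funeposE -EFin_max lee_fin ge_max normr_ge0 andbT.
  exact: ler_norm.
have In : leb.-integrable `[0, t] (fun u : R => \int[m u]_y (EFin \o F)^\- y)%E.
  apply: le_abs => // y; rewrite funenegE -EFinN -EFin_max lee_fin ge_max normr_ge0 andbT.
  by rewrite -normrN; exact: ler_norm.
split.
- exact: mI.
- rewrite (_ : (fun u : R => _) = (fun u => \int[m u]_y (EFin \o F)^\+ y - \int[m u]_y (EFin \o F)^\- y)%E).
    by apply: emeasurable_funB; exact: mI.
  by apply/funext => u; exact: FpN.
- by rewrite itvE.
- have -> : (\int[leb]_(u in `[0%R, t]) \int[m u]_y (F y)%:E = \int[M]_y (F y)%:E)%E.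
    rewrite [RHS]integralE -(itvE _ np) -(itvE _ nn) -integralB//.
    by apply: eq_integral => u _; exact: FpN.
  rewrite -(fineK (integrable_fin_num measurableT i1)) -(fineK (integrable_fin_num measurableT i2)) -EFinD.
  by congr EFin.
Qed.

End solution.

(** * Return to the original operator *)

Section theorem.
Context (R : realType).
Local Notation E := (posreal R).
Local Notation leb := (@lebesgue_measure R).
Variables (k : R.-ker E ~> E) (s K h : E -> R).
Hypothesis hs : scale s.
Hypothesis k_lower : forall x : E, k x [set y | val x <= val y] = 0%E.
Hypothesis K_meas : measurable_fun setT K.
Hypothesis h_pos : forall x, 0 < h x.
Hypothesis h_Cloc : Cs_loc s h.
Variables (kap : R.-ker E ~> E) (b : R).
Hypothesis kapE : forall x f, nnm f ->
  (\int[kap x]_y f y = (h x)^-1%:E * \int[k x]_y ((h y)%:E * f y))%E.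
Local Notation lam := (lam_of s K h).
Hypothesis hr : rates kap lam b.
Local Notation Poo := (Poo s kap lam b).
Local Notation gen := (gen kap lam).

Let mh : measurable_fun setT h.
Proof. by apply: continuous_measurable_posreal; case: h_Cloc => [[]]. Qed.
Let mhi : measurable_fun setT (fun y => (h y)^-1).
Proof.
by have [[ci _] _] := Cs_loc_inv hs h_pos h_Cloc; exact: continuous_measurable_posreal.
Qed.
Let hi0 x : 0 < (h x)^-1. Proof. by rewrite invr_gt0. Qed.
Let h0 x : h x != 0. Proof. by rewrite gt_eqF. Qed.
Let nh : nnm (fun y => (h y)%:E). Proof. by apply: nnm_EFin => // y; exact: ltW. Qed.
Let nhi : nnm (fun y => (h y)^-1%:E). Proof. by apply: nnm_EFin => // y; exact: ltW. Qed.
Let hK x (z : \bar R) : ((h x)%:E * ((h x)^-1%:E * z) = z)%E.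
Proof. by rewrite muleA -EFinM mulfV ?mul1e. Qed.
Let hiK x (z : \bar R) : ((h x)^-1%:E * ((h x)%:E * z) = z)%E.
Proof. by rewrite muleA -EFinM mulVf ?mul1e. Qed.

Let A_gen := @opA_gen R k s K h hs k_lower h_pos h_Cloc kap kapE.

(** The inverse h-transform of the minimal semigroup. *)
Definition evolution (T : R -> R.-ker E ~> E) := forall t x f, nnm f ->
  (\int[T t x]_y f y = (h x)%:E * Poo (fun y => (h y)^-1%:E * f y) (t, x))%E.

Definition solves (T : R -> R.-ker E ~> E) := forall f, (Cs_c s `|` [set h]) f ->
  forall t : R, 0 <= t -> forall x, forward_equation k s K T f t x.

Lemma evolution_exists : exists T, evolution T.
Proof.
pose J t (x : E) (f : E -> \bar R) := ((h x)%:E * Poo (fun y => (h y)^-1%:E * f y) (t, x))%E.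
have sJ t x : sfunctional (J t x).
  apply: sf_cscale; first by rewrite lee_fin ltW.
  exact: (sf_weight (sf_Poo hs hr (t, x)) nhi).
have mJ t f : nnm f -> measurable_fun setT (fun x => J t x f).
  move=> f0; apply: emeasurable_funM; first exact: nh.1.
  exact: (measurableT_comp (nnm_Poo hs hr (nnmM nhi f0)).1 (@pair1_measurable _ _ R E t)).
have [T hT] := choice (fun t => sf_kernel (sJ t) (mJ t)).
by exists T => t x f f0; exact: (hT t).2.
Qed.

Section evolution.
Variable T : R -> R.-ker E ~> E.
Hypothesis hT : evolution T.

Lemma evolutionE t x A : measurable A ->
  T t x A = ((h x)%:E * Poo (fun y => (h y)^-1%:E * (\1_A y)%:E) (t, x))%E.
Proof.
move=> mA; rewrite -hT; last exact: nnm_indic.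
by rewrite integral_indic// setIT.
Qed.

Lemma evolution_semigroup : semigroup T.
Proof.
split=> [x A mA|t u t0 u0 x A mA].
  have f0 := nnmM nhi (nnm_indic R mA).
  by rewrite (evolutionE _ _ mA) (Poo0 hs hr x f0) hK diracE indicE.
have f0 := nnmM nhi (nnm_indic R mA).
rewrite (evolutionE _ _ mA) (Poo_semigroup hs hr x f0 t0 u0).
have nT : nnm (fun y => T u y A) by split => //; exact: measurable_kernel.
rewrite (hT t x nT); congr (_ * Poo _ _)%E; apply/funext => y.
by rewrite (evolutionE _ _ mA) hiK.
Qed.

Lemma evolution_bound t x (C : R) (f : E -> R) : 0 <= t -> 0 <= C -> measurable_fun setT f ->
  (forall y, `|f y / h y| <= C) ->
  (\int[T t x]_y `|f y|%:E <= (h x * (C * expR (b * t)))%:E)%E.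
Proof.
move=> t0 C0 mf fC.
have na : nnm (fun y => `|f y|%:E) by apply: nnm_EFin => //; exact: measurableT_comp.
have one0 : nnm (fun _ : E => 1%E : \bar R) by apply: nnm_cst; exact: lee01.
have nC : nnm (fun _ : E => C%:E * 1 : \bar R)%E by apply: nnm_cst; rewrite mule1 lee_fin.
rewrite (hT t x na) EFinM lee_wpmul2l ?lee_fin ?(ltW (h_pos x))//.
apply: (@le_trans _ _ (Poo (fun=> C%:E * 1)%E (t, x))).
  apply: (sf_le (sf_Poo hs hr (t, x)) (nnmM nhi na) nC) => y.
  rewrite mule1 -EFinM lee_fin (le_trans _ (fC y))// normrM mulrC.
  by rewrite (gtr0_norm (hi0 y)).
rewrite (sf_scale (sf_Poo hs hr (t, x)) C0 one0) EFinM lee_wpmul2l ?lee_fin//.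
exact: (Poo_le_exp hs hr).
Qed.

Lemma evolution_on : semigroup_on T (weighted_bounded h).
Proof.
split; first exact: evolution_semigroup.
move=> t t0 f [mf [M [_ hM]]].
pose C := `|M| + 1.
have C0 : 0 <= C by rewrite addr_ge0.
have fC y : `|f y / h y| <= C.
  by apply: hM => //; rewrite (le_lt_trans (ler_norm _))// ltrDl.
have mfe : measurable_fun setT (EFin \o f) by exact/measurable_EFinP.
have fi x : (T t x).-integrable setT (EFin \o f).
  apply/integrableP; split => //.
  exact: le_lt_trans (evolution_bound x t0 C0 mf fC) (ltry _).
split => //; split.
  have np : nnm (fun y => ((EFin \o f)^\+ y)%E) by split => //; exact: measurable_funepos.
  have nn : nnm (fun y => ((EFin \o f)^\- y)%E) by split => //; exact: measurable_funeneg.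
  apply: (measurableT_comp (@fine_measurable R _ measurableT)).
  rewrite (_ : act T t f = fun x => (\int[T t x]_y (EFin \o f)^\+ y - \int[T t x]_y (EFin \o f)^\- y)%E).
    by apply: emeasurable_funB; apply: measurable_fun_integral_kernel;
      [exact: measurable_kernel|exact: np.2|exact: np.1|exact: measurable_kernel|exact: nn.2|exact: nn.1].
  by apply/funext => x; exact: integralE.
exists (C * expR (b * t)); split; first exact: num_real.
move=> B hB x _; apply: le_trans (ltW hB).
have fin := integrable_fin_num measurableT (fi x).
rewrite normrM (gtr0_norm (hi0 x)) ler_pdivrMr// mulrC -lee_fin.
apply: le_trans (evolution_bound x t0 C0 mf fC).
rewrite (_ : `|fine (act T t f x)|%:E = `|\int[T t x]_y (f y)%:E|)%E; last first.
  by rewrite /act -{2}(fineK fin).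
exact: abse_integral_le.
Qed.

Lemma evolution_solves : solves T.
Proof.
move=> f hf t t0 x.
have [m mE] := Poo_family hs hr x.
have link u (F : E -> R) : 0 <= u -> measurable_fun setT F ->
    act T u (fun y => h y * F y) x = ((h x)%:E * \int[m u]_y (F y)%:E)%E.
  move=> u0 mF; have mhF : measurable_fun setT (fun y => h y * F y) by exact: measurable_funM.
  have hw F' : nnm F' -> (\int[T u x]_y F' y = (h x)%:E * \int[m u]_y ((h y)^-1%:E * F' y))%E.
    by move=> F'0; rewrite (hT u x F'0) (mE u _ (nnmM nhi F'0)).
  rewrite /act (weighted_integral (h_pos x) mhi hi0 hw mhF).
  by congr (_ * _)%E; apply: eq_integral => y _; rewrite mulKf.
(* For [h] take [g = 1]; for a compactly supported [f], the quotient [f / h] is again in [Cs_c], by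
   [Cs_loc_inv] and [Cs_c_mul]. *)
suff [g [D [C [fE mg fp gC [DC dg]]]]] : exists g D, exists C : R,
    [/\ forall y, f y = h y * g y, measurable_fun setT g, flow_prim s g D,
        forall y, `|g y| <= C & (forall y, `|D y| <= C) /\
        forall y, sderivable s g y /\ sderive s g y = D y].
  have [_ mD _] := fp.
  apply: (forward_of_fwd h_pos link fE _ mg (measurable_gen hr mg mD gC) t0).
    by move=> y; exact: (A_gen mg fE (dg y).1 (dg y).2).
  exact: (Poo_fwd hs hr mE fp gC DC).
case: hf => [fc|->]; last first.
  exists (fun=> 1), (fun=> 0), 1; split => //.
  - by move=> y; rewrite mulr1.
  - split => // y u; split; first exact: bnd_on_cst.
    by move=> v w _ _ _; rewrite subrr Rintegral_cst// mul0r.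
  - by move=> y; rewrite normr1.
  - by split => [y|y]; [rewrite normr0|exact: (sderive_one hs)].
have := Cs_c_mul hs (Cs_loc_inv hs h_pos h_Cloc) fc.
set g := fun y => (h y)^-1 * f y => gc; have [[cg dg] cK [M [_ hM]]] := gc.
pose C1 := `|M| + 1.
have DC y : `|sderive s g y| <= C1.
  by apply: hM => //; rewrite (le_lt_trans (ler_norm _))// ltrDl.
have [M2 h2] := compact_bounded_fun cg cK.
have gC y : `|g y| <= `|M2|.
  have [hy|hy] := pselect (closure [set y | g y != 0] y).
    exact: le_trans (h2 y hy) (ler_norm _).
  suff -> : g y = 0 by rewrite normr0.
  by apply/eqP; apply: contra_notT hy => gy; exact: subset_closure.
exists g, (sderive s g), (C1 + `|M2|); split.
- by move=> y; rewrite /g mulVKf.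
- exact: continuous_measurable_posreal.
- apply: (flow_prim_sderive hs cg dg); apply: locally_bounded_of => u v u0.
  by exists C1 => y _.
- by move=> y; rewrite (le_trans (gC y))// lerDr addr_ge0.
- by split => // y; rewrite (le_trans (DC y))// lerDl.
Qed.

End evolution.

Lemma solution_family (T : R -> R.-ker E ~> E) x : solves T ->
  exists m : R -> {measure set E -> \bar R},
  [/\ forall t, t < 0 -> m t setT = 0%E, tests s m x gen &
      forall t f, 0 <= t -> nnm f ->
        (\int[m t]_y f y = (h x)^-1%:E * \int[T t x]_y ((h y)%:E * f y))%E].
Proof.
move=> sT.
(* The indicator makes the family vanish at negative times, where [T] is arbitrary. *)
pose J (t : R) (f : E -> \bar R) :=
  ((0 <= t)%R%:R%:E * ((h x)^-1%:E * \int[T t x]_y ((h y)%:E * f y)))%E.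
have sJ t : sfunctional (J t).
  apply: sf_cscale; first by rewrite lee_fin.
  apply: sf_cscale; first by rewrite lee_fin ltW.
  exact: (sf_weight (sf_integral (T t x)) nh).
have [m hm] := choice (fun t => sf_riesz (sJ t)).
have mE t f : 0 <= t -> nnm f ->
    (\int[m t]_y f y = (h x)^-1%:E * \int[T t x]_y ((h y)%:E * f y))%E.
  by move=> t0 f0; rewrite (hm t).2// /J t0 mul1e.
have link u (F : E -> R) : 0 <= u -> measurable_fun setT F ->
    act T u (fun y => h y * F y) x = ((h x)%:E * \int[m u]_y (F y)%:E)%E.
  move=> u0 mF; rewrite (weighted_integral (hi0 x) mh h_pos (fun f f0 => mE u f u0 f0) mF).
  by rewrite hK.
exists m; split=> [t t0||//].
  by rewrite (hm t).1// /J leNgt t0 mul0e.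
split=> [|n a B C n0].
  have mg : measurable_fun setT (fun _ : E => 1 : R) by exact: measurable_cst.
  have fE y : h y = h y * 1 by rewrite mulr1.
  have d1 := sderive_one hs.
  have g1 (y : E) : `|1 : R| <= 1 by rewrite normr1.
  have mF := measurable_gen hr mg (measurable_cst (0 : R)) g1.
  have AE y : opA k s K h y = h y * gen (fun=> 1) (fun=> 0) y.
    exact: (A_gen mg fE (d1 y).1 (d1 y).2).
  apply: (fwd_of_forward h_pos link mh fE AE mg mF) => t t0.
  by apply: sT => //; right.
have mg := measurable_tst hs n a B C.
have mF := measurable_gen hr mg (measurable_tst' hs a B C n0) (tst_le s n a B C).
have AE y : opA k s K (fun y => h y * tst s n a B C y) y = h y * gen (tst s n a B C) (tst' s n a B C) y.
  have [d1 d2] := tst_sderive hs a B C y n0.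
  exact: (A_gen mg (fun=> erefl) d1 d2).
apply: (fwd_of_forward h_pos link mh (fun=> erefl) AE mg mF) => t t0.
by apply: sT => //; left; exact: (Cs_c_mul hs h_Cloc (tst_Cs_c hs a B C n0)).
Qed.

(** Each point [x] is treated separately: [family_unique] compares the h-transforms of [T'] and [T]
    at [x], and the second is the minimal one. *)
Lemma solution_unique (T T' : R -> R.-ker E ~> E) : evolution T -> solves T -> solves T' ->
  forall t, 0 <= t -> forall x A, measurable A -> T' t x A = T t x A.
Proof.
move=> hT sT sT' t t0 x A mA.
have [m [m0 hm mE]] := solution_family x sT.
have [m' [m'0 hm' m'E]] := solution_family x sT'.
have mP u f : nnm f -> (\int[m u]_y f y = Poo f (u, x))%E.
  move=> f0; have [u0|u0] := leP 0 u; last first.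
    by rewrite (family0 m0 f0 u0) (Poo_lt0 s kap lam b x u0 f0).
  rewrite (mE u f u0 f0) (hT u x _ (nnmM nh f0)) hiK.
  by congr (Poo _ _); apply/funext => y; rewrite hiK.
have mm B : measurable B -> m t B = m' t B.
  by move=> mB; exact: (family_unique hs hr m'0 hm' m0 hm mP t mB).
have n1 := nnmM nhi (nnm_indic R mA).
have h1 (S : R -> R.-ker E ~> E) (mu : {measure set E -> \bar R}) :
    (forall f, nnm f -> (\int[mu]_y f y = (h x)^-1%:E * \int[S t x]_y ((h y)%:E * f y))%E) ->
    S t x A = ((h x)%:E * \int[mu]_y ((h y)^-1%:E * (\1_A y)%:E))%E.
  move=> e; rewrite (e _ n1) hK; transitivity (\int[S t x]_y (\1_A y)%:E)%E.
    by rewrite integral_indic// setIT.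
  by apply: eq_integral => y _; rewrite hK.
rewrite (h1 T' (m' t) (fun f f0 => m'E t f t0 f0)) (h1 T (m t) (fun f f0 => mE t f t0 f0)).
by congr (_ * _)%E; apply: eq_measure_integral => B mB _; rewrite mm.
Qed.

End theorem.

Theorem theorem1 (R : realType)
  (k : R.-ker (posreal R) ~> (posreal R))
  (k_lower : forall x : posreal R, k x [set y | val x <= val y] = 0%E)
  (s : posreal R -> R)
  (s_incr : forall x y : posreal R, val x < val y -> s x < s y)
  (s_cont : continuous s)
  (s_one : s (to_posreal 1) = 0)
  (s_lim : s (to_posreal r) @[r --> +oo] --> +oo)
  (K : posreal R -> R)
  (K_meas : measurable_fun setT K)
  (K_locb : locally_bounded K)
  (h : posreal R -> R)
  (h_pos : forall x, 0 < h x)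
  (h_Cloc : Cs_loc s h)
  (h_int : forall M : R, 0 < M ->
     (ereal_sup [set \int[k x]_(y in [set y | (val y < val x)%R]) (h y / h x)%:E
                | x in [set x : posreal R | (val x < M)%R]] < +oo)%E)
  (h_bdabove : has_ubound (range (fun x => opA k s K h x / h x)))
  (h_locb : locally_bounded (fun x => opA k s K h x / h x)) :
  let solution (T : R -> R.-ker (posreal R) ~> (posreal R)) :=
    semigroup_on T (weighted_bounded h) /\
    forall f, (Cs_c s `|` [set h]) f ->
      forall t : R, 0 <= t -> forall x, forward_equation k s K T f t x in
  exists T, solution T /\
    forall T', solution T' ->
      forall t : R, 0 <= t -> forall (x : posreal R) (A : set (posreal R)),
        measurable A -> T' t x A = T t x A.
Proof.
have hs : scale s by split.
have [kap kapE] := transform_kernel k hs h_pos h_Cloc.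
have [b0 hb0] := h_bdabove.
(* The bound of [A h / h] may be negative, while [rates] and the Laplace argument take [b]
   nonnegative. *)
pose b := Num.max 0 b0.
have b_ge0 : 0 <= b by rewrite le_max lexx.
have hb x : opA k s K h x / h x <= b.
  by rewrite le_max; apply/orP; right; apply: hb0; exists x.
have hr := transform_rates hs k_lower K_meas K_locb h_pos h_Cloc kapE h_int b_ge0 hb.
have [T hT] := evolution_exists hs h_pos h_Cloc hr.
have sT := evolution_solves hs k_lower h_pos h_Cloc kapE hr hT.
exists T; split.
  by split; [exact: (evolution_on hs h_pos h_Cloc hr hT)|exact: sT].
move=> T' [_ sT'] t t0 x A mA.
exact: (solution_unique hs k_lower h_pos h_Cloc kapE hr hT sT sT').
Qed.
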